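(* Let $P$ be a probability measure on $\mathbb{R}^d$, let $\phi_0$ be a convex potential, $Q=(\nabla\phi_0)_\sharp P$, and let $\mathcal{F}$ be a set of convex potentials. Assume: (i) there exist $\beta,a\ge 0$ such that $\phi_0$ and every $\phi\in\mathcal{F}$ are $(\beta,a)$-smooth; (ii) $P$ satisfies a Poincaré inequality: there is $0\le C_{\mathtt{PI}}<\infty$ with $\mathrm{Var}_P(f)\le C_{\mathtt{PI}}\int\|\nabla f\|^2\,dP$ for every differentiable $f:\mathbb{R}^d\to\mathbb{R}$; (iii) there exists $\gamma\ge 0$ such that, for some constants $C_1,q_1\ge 0$ and all $h>0$, $\log\mathcal{N}(h,\mathcal{F},L^\infty)\le C_1\log_+(1/h)^{q_1}h^{-\gamma}$; (iv) $P$ is supported in $B(0;R)$ for some $0<R<\infty$ and, for every $\phi\in\mathcal{F}$, $\mathrm{dom}(\phi)=B(0;2R)$ and $\|\nabla\phi\|\le R$ on the support of $P$. Let $\ell^\star=\inf_{\phi\in\mathcal{F}}(S(\phi)-S(\phi_0))$. Then there exist constants $C,q\ge 0$, independent of $n$, such that for all $n\ge 2$ $$\mathbb{E}\,\|\nabla\hat\phi_{\mathcal F}-\nabla\phi_0\|^2_{L^2(P)}\le C(\log n)^q\Big(\ell^\star+\big(n^{-\frac{2}{2+\gamma}}\vee n^{-\frac1\gamma}\big)\Big).$$ Moreover the constant does not depend on the dimension $d$ (it depends only on the constants appearing in the hypotheses and on a bound for $\|\nabla\phi_0\|$ on the support of $P$).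
   Context: $d\ge 2$; $B(x;r)$ is the Euclidean ball; $\langle x\rangle^a=(1+\|x\|)^a$; $\log_+(x)=\max\{1,\log x\}$; $u\vee v=\max(u,v)$; for $\gamma=0$ the term $n^{-1/\gamma}$ is read as $0$. A potential is a function $\phi:\mathbb{R}^d\to\mathbb{R}\cup\{+\infty\}$ with $0\in\mathrm{dom}(\phi)=\{\phi<\infty\}$ and $\phi(0)=0$. It is $(\beta,a)$-smooth if it is twice differentiable and $\|\nabla^2\phi(x)\|_{\mathrm{op}}\le\beta\langle x\rangle^a$ for all $x\in\mathrm{dom}(\phi)$ (for $a=0$, differentiability with $\beta$-Lipschitz gradient suffices). $\phi^*(y)=\sup_x\{\langle x,y\rangle-\phi(x)\}$ is the convex conjugate. $S(\phi)=\int\phi\,dP+\int\phi^*\,dQ$. One observes independent i.i.d. samples $X_1,\dots,X_n\sim P$ and $Y_1,\dots,Y_n\sim Q$, with empirical measures $P_n,Q_n$; $\hat\phi_{\mathcal F}\in\arg\min_{\phi\in\mathcal F}\int\phi\,dP_n+\int\phi^*\,dQ_n$ is a (measurable) minimizer, assumed to exist. $\mathcal{N}(h,A,E)$ is the smallest number of balls of radius $h$ in the metric space $E$ needed to cover $A$; here $L^\infty$ is the sup norm on the common domain $B(0;2R)$. $\|f\|_{L^2(P)}^2=\int\|f\|^2dP$. *)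

(* Defs.v *)
From HB Require Import structures.
From mathcomp Require Import all_boot all_order all_algebra.
From mathcomp Require Import all_classical all_reals all_analysis.
From mathcomp Require Import measurable_realfun.

Set Implicit Arguments.
Unset Strict Implicit.
Unset Printing Implicit Defensive.

Import Order.TTheory GRing.Theory Num.Theory.
Import numFieldNormedType.Exports.

Local Open Scope classical_set_scope.
Local Open Scope ring_scope.

(* R^d is the row space 'rV[R]_d.  The library norm on 'rV[R]_d is the sup
   norm: it is only used for the topology, the Borel sets and
   differentiability, which do not depend on the choice of the norm. *)
Section euclidean.
Context {R : realType} {d : nat}.
Implicit Types (x y : 'rV[R]_d) (r a : R).

Definition inner x y : R := \sum_i x 0 i * y 0 i.

Definition enorm x : R := Num.sqrt (inner x x).

Definition eball x r : set 'rV[R]_d := [set y | enorm (y - x) < r].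

Definition bracket x a : R := (1 + enorm x) `^ a.

Definition opnorm (A : 'M[R]_d) : R :=
  sup [set enorm (v *m A) | v in [set v | enorm v <= 1]].

Definition gradient (f : 'rV[R]_d -> R) x : 'rV[R]_d :=
  \row_i 'D_(delta_mx 0 i) f x.

End euclidean.

Notation borel_rV R d := (g_sigma_algebraType (@open 'rV[R]_d)).

Section potentials.
Context {R : realType} {d : nat}.
Implicit Types (phi : 'rV[R]_d -> \bar R) (beta a : R).

Definition dom phi : set 'rV[R]_d := [set x | (phi x < +oo)%E].

Definition potential phi : Prop :=
  (forall x, phi x != -oo%E) /\ phi 0 = 0%E.

Definition convex phi : Prop :=
  forall (x y : 'rV[R]_d) (t : R), 0 <= t <= 1 ->
    (phi (t *: x + (1 - t) *: y)%R <=
       t%:E * phi x + (1 - t)%R%:E * phi y)%E.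

(* Only meaningful at interior points of [dom phi]; set to 0 off [dom phi]. *)
Definition nabla phi (x : 'rV[R]_d) : 'rV[R]_d :=
  if x \in dom phi then gradient (fine \o phi) x else 0.

(* Differentiability at every point of the domain presupposes that [phi] is
   finite near each such point, i.e. that the domain is open.  The last
   disjunct is the convention for a = 0: a beta-Lipschitz gradient is enough. *)
Definition smooth beta a phi : Prop :=
  [/\ open (dom phi),
      forall x, dom phi x -> differentiable (fine \o phi) x &
      (forall x, dom phi x -> differentiable (nabla phi) x /\
         opnorm ('J (nabla phi) x) <= beta * bracket x a)
      \/
      (a = 0 /\ forall x y, dom phi x -> dom phi y ->
         enorm (nabla phi x - nabla phi y) <= beta * enorm (x - y))].

Definition conjugate phi (y : 'rV[R]_d) : \bar R :=
  ereal_sup [set ((inner x y)%:E - phi x)%E | x in [set: 'rV[R]_d]].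

Definition semidual (P Q : {measure set (borel_rV R d) -> \bar R}) phi
    : \bar R :=
  (\int[P]_x phi x + \int[Q]_y conjugate phi y)%E.

End potentials.

(* Closed balls, with centers anywhere in E; the distance of E is extended-real
   valued.  The covering number is +oo when no finite cover exists. *)
Definition covering_number {R : realType} {E : Type} (dist : E -> E -> \bar R)
    (h : R) (A : set E) : \bar R :=
  ereal_inf [set (N%:R)%:E | N in [set N : nat |
    exists c : 'I_N -> E, forall f, A f -> exists i, (dist (c i) f <= h%:E)%E]].

(* Sup distance on B. It is +oo between a function bounded on B and one that is
   not (or that takes infinite values there), so that only centers in
   L^oo(B) are of use in a cover of a set of functions bounded on B. *)
Definition dist_Loo {R : realType} {d : nat} (B : set 'rV[R]_d)
    (f g : 'rV[R]_d -> \bar R) : \bar R :=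
  ereal_sup [set `|f x - g x|%E | x in B].

Definition logp {R : realType} (x : R) : R := Num.max 1 (ln x).

Section measures.
Context {R : realType} {d : nat}.
Variable P : probability (borel_rV R d) R.

Definition msupport : set 'rV[R]_d :=
  [set x | forall r, 0 < r -> (0 < P (eball x r))%E].

Definition poincare (C : R) : Prop :=
  forall f : 'rV[R]_d -> R, (forall x, differentiable f x) ->
    ('V_P[f] <= C%:E * \int[P]_x (enorm (gradient f x) ^+ 2)%:E)%E.

Definition sqnorm_L2 (f : 'rV[R]_d -> 'rV[R]_d) : \bar R :=
  (\int[P]_x (enorm (f x) ^+ 2)%:E)%E.

End measures.

Section empirical_measure.
Context {disp : measure_display} {T : measurableType disp} {R : realType}.
Variables (n : nat) (x : 'I_n -> T).

Definition empirical (A : set T) : \bar R :=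
  ((n%:R^-1)%:E * \sum_(i < n) \d_(x i) A)%E.

Let empirical0 : empirical set0 = 0%E.
Proof. by rewrite /empirical big1 ?mule0// => i _; rewrite measure0. Qed.

Let empirical_ge0 A : (0 <= empirical A)%E.
Proof.
by apply: mule_ge0; [rewrite lee_fin invr_ge0|apply: sume_ge0].
Qed.

Let empirical_sigma_additive : semi_sigma_additive empirical.
Proof.
move=> F mF tF mUF; rewrite /empirical.
have n0 : 0 <= n%:R^-1 :> R by rewrite invr_ge0.
rewrite [X in X @ _ --> _](_ : _ = (fun k => (n%:R^-1)%:E *
    \sum_(0 <= l < k) \sum_(i < n) \d_(x i) (F l))%E); last first.
  apply/funext => k; rewrite ge0_sume_distrr// => l _; exact: sume_ge0.
apply: cvgeZl => //.
rewrite [X in X @ _ --> _](_ : _ = (fun k =>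
    \sum_(i < n) \sum_(0 <= l < k) \d_(x i) (F l))%E); last first.
  by apply/funext => k; rewrite exchange_big.
apply: cvg_nnesum => [i _|i _].
  by near=> k; apply: sume_ge0.
exact: measure_semi_sigma_additive.
Unshelve. all: by end_near. Qed.

HB.instance Definition _ := isMeasure.Build _ _ _ empirical
  empirical0 empirical_ge0 empirical_sigma_additive.

End empirical_measure.

Section sampling.
Context {dO disp : measure_display} {Omega : measurableType dO}
  {T : measurableType disp} {R : realType}.
Variable Pr : probability Omega R.

Definition mutually_independent {I : finType} (Z : I -> Omega -> T) : Prop :=
  forall (J : {set I}) (A : I -> set T), (forall i, measurable (A i)) ->
    Pr (\bigcap_(i in [set` J]) (Z i @^-1` A i)) =
    (\prod_(i in J) Pr (Z i @^-1` A i))%E.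

Definition has_law (Z : {mfun Omega >-> T}) (mu : set T -> \bar R) : Prop :=
  forall A, measurable A -> distribution Pr Z A = mu A.

Definition two_samples {n : nat} (P Q : probability T R)
    (X Y : 'I_n -> {mfun Omega >-> T}) : Prop :=
  [/\ forall i, has_law (X i) P, forall i, has_law (Y i) Q &
      mutually_independent
        (fun k : 'I_n + 'I_n =>
           match k with inl i => X i | inr j => Y j end : Omega -> T)].

End sampling.

Definition argmin_on {R : realType} {E : Type} (F : set E) (J : E -> \bar R)
  : set E := [set f | F f /\ forall g, F g -> (J f <= J g)%E].

Section setting.
Context {R : realType} {d : nat}.
Variables (P Q : probability (borel_rV R d) R).
Variables (phi0 : 'rV[R]_d -> \bar R) (F : set ('rV[R]_d -> \bar R)).

(* The clause [P (dom phi0) = 1] is what makes the push-forward of P by the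
   gradient of phi0 meaningful. *)
Record setting : Prop := Setting {
  potential_phi0 : potential phi0 ;
  convex_phi0 : convex phi0 ;
  P_dom_phi0 : P (dom phi0) = 1%E ;
  pushforward_Q : forall A, measurable A ->
    Q A = pushforward P (nabla phi0 : borel_rV R d -> borel_rV R d) A ;
  potential_F : forall phi, F phi -> potential phi ;
  convex_F : forall phi, F phi -> convex phi
}.

(* In [support_P] the ball is closed, as supports are: every measure
   concentrated on the open ball of radius r is covered. *)
Record assumptions (beta a CPI gamma C1 q1 r : R) : Prop := Assumptions {
  smooth_phi0 : smooth beta a phi0 ;
  smooth_F : forall phi, F phi -> smooth beta a phi ;
  poincare_P : poincare P CPI ;
  entropy_F : forall h : R, 0 < h ->
    (lne (covering_number (dist_Loo (eball 0 (2 * r))) h F) <=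
       (C1 * (logp (h^-1)) `^ q1 * h `^ (- gamma))%:E)%E ;
  support_P : forall x, msupport P x -> enorm x <= r ;
  dom_F : forall phi, F phi -> dom phi = eball 0 (2 * r) ;
  nabla_F : forall phi x, F phi -> msupport P x -> enorm (nabla phi x) <= r
}.


Definition ell_star : \bar R :=
  ereal_inf [set (semidual P Q phi - semidual P Q phi0)%E | phi in F].

(* n^(-1/gamma) is read as 0 for gamma = 0. *)
Definition rate (gamma : R) (n : nat) : R :=
  Num.max (n%:R `^ (- (2 / (2 + gamma))))
          (if gamma == 0 then 0 else n%:R `^ (- gamma^-1)).

(* Measurability of the random function [phih] means that its value at each x is
   a random variable; for functions that are continuous on a common open ball and
   +oo off it, this is Borel measurability for uniform convergence on compact
   subsets of that ball. *)
Definition risk_bound (gamma C q : R) : Prop :=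
  forall n : nat, (2 <= n)%N ->
  forall (dO : measure_display) (Omega : measurableType dO)
    (Pr : probability Omega R)
    (X Y : 'I_n -> {mfun Omega >-> borel_rV R d})
    (phih : Omega -> 'rV[R]_d -> \bar R),
  two_samples Pr P Q X Y ->
  (forall x, measurable_fun [set: Omega] (phih^~ x)) ->
  (forall w, argmin_on F
     (semidual (empirical (fun i => X i w)) (empirical (fun i => Y i w)))
     (phih w)) ->
  (\int[Pr]_w sqnorm_L2 P (fun x => nabla (phih w) x - nabla phi0 x)%R
     <= (C * (ln n%:R) `^ q)%:E * (ell_star + (rate gamma n)%:E))%E.

End setting.

(* Main.v *)
Require Import Defs.
From mathcomp Require Import all_boot all_order all_algebra.
From mathcomp Require Import all_classical all_reals all_analysis.
From mathcomp Require Import ring lra measurable_realfun.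

(** Why the bound holds. Write [y = nabla phi0 x]. Since [phi0] attains equality in the Fenchel-Young
    inequality at [(x, y)], the excess risk [S(phi) - S(phi0)] of a candidate is the mean under [P] of
    its Fenchel gap [phi^*(y) + phi(x) - <x, y>] ([semidual_excess]). Testing the supremum in [phi^*(y)]
    at a short step from [x] in the direction [y - nabla phi x], inside a domain twice as large as the
    support, bounds [|nabla phi x - y|^2] by a constant times the gap ([fenchel_gap_quadratic]). It is
    therefore enough to bound the excess risk of the empirical minimizer.

    The losses satisfy a Bernstein condition: the variance of the loss difference of two candidates is
    at most a constant times the sum of their excess risks ([var_diff_le_excess]). For the potentials
    this is the Poincare inequality, applied after a cutoff ([poincare_ball]), followed by the quadratic
    bound. For the conjugates, [phi^* - psi^*] at [y] is a difference of gaps minus [phi - psi] at [x],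
    and gaps are nonnegative and bounded, so their second moments are controlled by their means.

    The rest is empirical process theory. For finitely many functions, exponential moments and the
    inequality [u <= exp u] give one nonnegative random variable [G] of mean at most
    [(ln N + 1) / (lam n)] such that each deviation is at most [2 lam] times the variance plus [G]
    ([deviation_finite_family]). A candidate is chained through nets of decreasing radii
    ([chained_risk_bound]). The coarsest net, of radius [h_0 = n^(-1/(2+gamma))], uses the Bernstein
    condition with a constant [lam]; passing to the net changes variances by [O(h_0^2)] only, and
    [h_0^2 = n^(-2/(2+gamma))]. The links at scale [h] have variance [O(h^2)], and the best [lam] makes
    their cost [h * sqrt (h^-gamma / n)] up to logarithms. This never exceeds the rate for [h] between
    the rate and [h_0] ([chaining_rate_le]), and [O(log n)] dyadic scales suffice
    ([erm_oracle_inequality]). Conjugation is a contraction for the sup distance, so the nets of the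
    potentials are nets of the conjugates ([conjugate_contraction]).

    Every bound on the supremum over the class is a pointwise bound by a finite sum of exponentials,
    whose expectation factorizes over the independent samples ([expectation_prod_independent]). The
    constants are explicit in the data of the hypotheses and in a bound [M] for the gradient of [phi0]
    on the support, whence their uniformity; when [M] is not given, the Lipschitz gradient of [phi0]
    provides one ([nabla_bounded]). *)

Set Implicit Arguments.
Unset Strict Implicit.
Unset Printing Implicit Defensive.

Import Order.TTheory GRing.Theory Num.Theory.
Import numFieldNormedType.Exports.

Local Open Scope classical_set_scope.
Local Open Scope ring_scope.

(** * Expectations of products of independent variables *)

Section independence.
Context {d d' : measure_display} {Omega : measurableType d} {T : measurableType d'}
  {R : realType}.
Local Open Scope ereal_scope.
Import HBNNSimple.

(** Both sides are linear in [f] and continuous along increasing sequences, so indicators suffice: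
    [W] acts as a density that does not see [Z]. *)
Lemma ge0_integral_weighted_comp (Pr : {measure set Omega -> \bar R})
    (mu : {measure set T -> \bar R}) (W : Omega -> R) (Z : Omega -> T) (c : \bar R) :
  measurable_fun setT W -> (forall w, 0 <= W w)%R -> measurable_fun setT Z ->
  0 <= c -> c \is a fin_num ->
  (forall A, measurable A ->
     \int[Pr]_w ((W w)%:E * (\1_A (Z w))%:E) = c * mu A) ->
  forall f : T -> \bar R, measurable_fun setT f -> (forall x, 0 <= f x) ->
  \int[Pr]_w ((W w)%:E * f (Z w)) = c * \int[mu]_x f x.
Proof.
move=> /measurable_EFinP mW W0 mZ c0 cfin H f mf f0.
pose f_ := nnsfun_approx measurableT mf.
have simple n : \int[Pr]_w ((W w)%:E * (f_ n (Z w))%:E) = c * \int[mu]_x (f_ n x)%:E.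
  have fE x : (f_ n x)%:E =
      \sum_(k \in range (f_ n)) k%:E * (\1_(f_ n @^-1` [set k]) x)%:E.
    by rewrite fimfunE -fsumEFin//; apply: eq_fsbigr => k _; rewrite EFinM.
  have k0 k x : 0 <= k%:E * (\1_(f_ n @^-1` [set k]) x)%:E :> \bar R.
    by rewrite -EFinM nnfun_muleindic_ge0.
  under eq_integral => w _ do
    (rewrite fE ge0_mule_fsumr; last by move=> k; exact: k0).
  rewrite ge0_integral_fsum//; last 2 first.
  - move=> k; apply: emeasurable_funM => //; apply: emeasurable_funM => //.
    by apply/measurable_EFinP; apply: (measurableT_comp _ mZ); exact: measurable_indic.
  - by move=> k w _; apply: mule_ge0; [rewrite lee_fin|exact: k0].
  under [in RHS]eq_integral => x _ do rewrite fE.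
  rewrite ge0_integral_fsum//; last first.
    move=> k; apply: emeasurable_funM => //.
    by apply/measurable_EFinP; exact: measurable_indic.
  rewrite ge0_mule_fsumr; last by move=> k; exact: integral_ge0.
  apply: eq_fsbigr => k /[!inE] -[x _ <-].
  have fx0 : 0 <= (f_ n x)%:E :> \bar R by rewrite lee_fin.
  rewrite ge0_integralZl//; last first.
    by apply/measurable_EFinP; exact: measurable_indic.
  rewrite integral_indic// setIT.
  rewrite muleCA -H//.
  rewrite -ge0_integralZl//; last 2 first.
  - apply: emeasurable_funM => //; apply/measurable_EFinP.
    by apply: (measurableT_comp _ mZ); exact: measurable_indic.
  - by move=> w _; apply: mule_ge0; rewrite lee_fin//.
  by apply: eq_integral => w _; rewrite muleCA.
have m1 n : measurable_fun setT (fun x => (f_ n x)%:E).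
  exact/measurable_EFinP/measurable_funTS.
have mono x : nondecreasing_seq (fun n => (f_ n x)%:E).
  by move=> m n mn; rewrite lee_fin; exact/lefP/nd_nnsfun_approx.
have mfZ n : measurable_fun setT (fun w => (f_ n (Z w))%:E).
  by apply/measurable_EFinP; exact: measurableT_comp.
have cvg x : (f_ n x)%:E @[n --> \oo] --> f x.
  by apply: (cvg_nnsfun_approx measurableT mf) => // *; exact: f0.
have lim_f x : limn (fun n => (f_ n x)%:E) = f x by exact/cvg_lim.
have cvg_int : \int[mu]_x (f_ n x)%:E @[n --> \oo] --> \int[mu]_x f x.
  rewrite (eq_integral (fun x => limn (fun n => (f_ n x)%:E))); last first.
    by move=> x _; rewrite lim_f.
  by apply: cvg_monotone_convergence => // n x _; rewrite lee_fin.
transitivity (limn (fun n => \int[Pr]_w ((W w)%:E * (f_ n (Z w))%:E))).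
  rewrite -monotone_convergence//.
  - apply: eq_integral => w _; apply/esym/cvg_lim => //.
    by apply: cvgeZl => //; exact: cvg.
  - by move=> n; apply: emeasurable_funM => //; apply: mfZ.
  - by move=> n w _; rewrite mule_ge0// lee_fin.
  - by move=> w _ m n mn; rewrite lee_wpmul2l// ?lee_fin//; exact: mono.
apply/cvg_lim => //; under eq_fun do rewrite simple.
exact: cvgeZl.
Qed.

(** The definition of independence is the case of indicators. They are exchanged for general
    functions one index at a time, the other factors playing the role of a weight. *)
Lemma expectation_prod_independent (Pr : probability Omega R) (I : finType)
    (Z : I -> Omega -> T) (f : I -> T -> R) :
  mutually_independent Pr Z -> (forall i, measurable_fun setT (Z i)) ->
  (forall i, measurable_fun setT (f i)) -> (forall i x, 0 <= f i x)%R ->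
  (forall i, \int[Pr]_w (f i (Z i w))%:E < +oo) ->
  \int[Pr]_w (\prod_i f i (Z i w))%:E = \prod_i \int[Pr]_w (f i (Z i w))%:E.
Proof.
move=> indep mZ.
suff H (s : seq I) (g : I -> T -> R) : (forall i, measurable_fun setT (g i)) ->
    (forall i x, 0 <= g i x)%R ->
    (forall i, \int[Pr]_w (g i (Z i w))%:E < +oo) ->
    (forall i, i \notin s -> exists2 A, measurable A & g i = \1_A) ->
    \int[Pr]_w (\prod_i g i (Z i w))%:E = \prod_i \int[Pr]_w (g i (Z i w))%:E.
  by move=> mf f0 ffin; apply: (H (enum I)) => // i; rewrite mem_enum.
elim: s g => [|k s IH] g mg g0 gfin gA.
  have /(_ _)/cid2-/all_sig2[A mA gE] := fun i => gA i isT.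
  have mZA i : measurable (Z i @^-1` A i).
    by rewrite -[X in measurable X]setTI; exact: mZ.
  have := indep finset.setT A mA.
  rewrite (_ : \bigcap_(i in _) _ = \bigcap_i (Z i @^-1` A i)); last first.
    by apply: eq_bigcapl; split=> i//= _; rewrite inE.
  under eq_bigl do rewrite inE.
  move=> E; transitivity (Pr (\bigcap_i (Z i @^-1` A i))).
    rewrite -[X in Pr X]setIT -integral_indic//; last first.
      by apply: fin_bigcap_measurable => //; exact: finite_finset.
    apply: eq_integral => w _; congr _%:E.
    under eq_bigr do rewrite gE.
    have [wA|wA] := pselect ((\bigcap_i Z i @^-1` A i) w).
      rewrite indicE mem_set//= big1// => i _.
      by rewrite indicE mem_set//; exact: wA.
    rewrite indicE memNset//=; move/existsNP : wA => [i /not_implyP[_ wA]].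
    by rewrite (bigD1 i)//= indicE memNset// mul0r.
  rewrite E; apply: eq_bigr => i _; rewrite gE.
  rewrite -[X in Pr X]setIT -integral_indic//.
pose W w := (\prod_(i | i != k) g i (Z i w))%R.
have mgZ i : measurable_fun setT (fun w => g i (Z i w)).
  by apply: (measurableT_comp (mg i)).
have W0 w : (0 <= W w)%R by apply: prodr_ge0.
have mW : measurable_fun setT W.
  rewrite [W](_ : _ = fun w => \prod_i (if i != k then g i (Z i w) else 1))%R; last first.
    by apply/funext => w; exact: big_mkcond.
  by apply: measurable_prod => i _; case: (i != k).
pose c := \prod_(i | i != k) \int[Pr]_w (g i (Z i w))%:E.
have g0Z i : 0 <= \int[Pr]_w (g i (Z i w))%:E by apply: integral_ge0 => w _; rewrite lee_fin.
have c0 : 0 <= c by apply: prode_ge0.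
have cfin : c \is a fin_num.
  apply: (big_ind (fun x => x \is a fin_num)) => //; first exact: fin_numM.
  by move=> i _; rewrite ge0_fin_numE.
pose nu := pushforward Pr (Z k).
have HA A : measurable A -> \int[Pr]_w ((W w)%:E * (\1_A (Z k w))%:E) = c * nu A.
  move=> mA; pose g' i := if i == k then \1_A else g i.
  have g'k i : i != k -> g' i = g i by rewrite /g' => /negbTE ->.
  have -> : nu A = \int[Pr]_w (g' k (Z k w))%:E.
    rewrite /g' eqxx /nu /pushforward -[X in Pr X]setIT -integral_indic//.
    by rewrite -[X in measurable X]setTI; exact: mZ.
  have -> : c = \prod_(i | i != k) \int[Pr]_w (g' i (Z i w))%:E.
    by apply: eq_bigr => i ik; rewrite g'k.
  transitivity (\prod_i \int[Pr]_w (g' i (Z i w))%:E); last first.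
    by rewrite (bigD1 k)//= muleC.
  rewrite -IH//.
  - apply: eq_integral => w _; rewrite (bigD1 k)//= mulrC EFinM; congr (_%:E * _%:E).
      by apply: eq_bigr => i ik; rewrite g'k.
    by rewrite /g' eqxx.
  - by move=> i; rewrite /g'; case: ifP => // _; exact: measurable_indic.
  - by move=> i x; rewrite /g'; case: ifP.
  - move=> i; rewrite /g'; case: ifP => // /eqP ->.
    apply: (@le_lt_trans _ _ (\int[Pr]_w (cst 1 w))).
      apply: ge0_le_integral => //; last by move=> w _; rewrite lee_fin indicE lern1 leq_b1.
      by apply/measurable_EFinP; apply: (measurableT_comp _ (mZ k)); exact: measurable_indic.
    rewrite integral_cst// mul1e. by rewrite -ge0_fin_numE// fin_num_measure.
  - move=> i is_; rewrite /g'; case: ifPn => ik; first by exists A.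
    by apply: gA; rewrite in_cons negb_or ik.
rewrite (bigD1 k)//= -/c.
under eq_integral do rewrite (bigD1 k)//= mulrC EFinM.
rewrite (@ge0_integral_weighted_comp Pr nu W (Z k) c mW W0 (mZ k) c0 cfin HA (EFin \o g k)).
- rewrite muleC; congr (_ * _).
  rewrite /nu ge0_integral_pushforward//; last by move=> x _; rewrite lee_fin.
  exact/measurable_EFinP/mg.
- exact/measurable_EFinP/mg.
- by move=> x; rewrite lee_fin.
Qed.
End independence.

(** * Means and variances of bounded measurable functions *)

Section bounded_measurable.
Context {d : measure_display} {T : measurableType d} {R : realType}.
Variable P : probability T R.
Implicit Types (f g : T -> R).

Definition bdmeas f := measurable_fun [set: T] f /\ exists b, forall x, `|f x| <= b.

(** Real-valued, so that the linear arithmetic of bounded functions stays in [R]. *)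
Definition mean f : R := \int[P]_x f x.

Definition var f : R := mean (fun x => (f x - mean f) ^+ 2).

Lemma bdmeas_cst (c : R) : bdmeas (fun=> c).
Proof. by split; [exact: measurable_cst|exists `|c|]. Qed.

Lemma bdmeasD f g : bdmeas f -> bdmeas g -> bdmeas (fun x => f x + g x).
Proof.
move=> [mf [b fb]] [mg [c gc]]; split; first exact: measurable_funD.
by exists (b + c) => x; apply: (le_trans (ler_normD _ _)); exact: lerD.
Qed.

Lemma bdmeasB f g : bdmeas f -> bdmeas g -> bdmeas (fun x => f x - g x).
Proof.
move=> [mf [b fb]] [mg [c gc]]; split; first exact: measurable_funB.
by exists (b + c) => x; apply: (le_trans (ler_normB _ _)); exact: lerD.
Qed.

Lemma bdmeasM f g : bdmeas f -> bdmeas g -> bdmeas (fun x => f x * g x).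
Proof.
move=> [mf [b fb]] [mg [c gc]]; split; first exact: measurable_funM.
by exists (b * c) => x; rewrite normrM ler_pM.
Qed.

Lemma bdmeas_sqr f : bdmeas f -> bdmeas (fun x => f x ^+ 2).
Proof. by move=> bf; apply: bdmeasM. Qed.

Lemma bdmeas_expR f : bdmeas f -> bdmeas (fun x => expR (f x)).
Proof.
move=> [mf [b fb]]; split; first exact: measurableT_comp.
exists (expR b) => x; rewrite ger0_norm ?expR_ge0// ler_expR.
by rewrite (le_trans (ler_norm _)).
Qed.

Lemma bdmeas_integrable f : bdmeas f -> P.-integrable [set: T] (EFin \o f).
Proof.
move=> [mf [b fb]]; apply: measurable_bounded_integrable => //.
  by rewrite -ge0_fin_numE// fin_num_measure.
by exists b; split; [exact: num_real|move=> c bc x _ /=; rewrite (le_trans (fb x))// ltW].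
Qed.

Lemma meanE f : bdmeas f -> (mean f)%:E = (\int[P]_x (f x)%:E)%E.
Proof. by move=> /bdmeas_integrable fi; rewrite /mean fineK// integrable_fin_num. Qed.

Lemma mean_cst (c : R) : mean (fun=> c) = c.
Proof. rewrite /mean Rintegral_cst//=; have := probability_setT P => ->; exact: mulr1. Qed.

Lemma meanD f g : bdmeas f -> bdmeas g ->
  mean (fun x => f x + g x) = mean f + mean g.
Proof. by move=> bf bg; apply: RintegralD => //; exact: bdmeas_integrable. Qed.

Lemma meanB f g : bdmeas f -> bdmeas g ->
  mean (fun x => f x - g x) = mean f - mean g.
Proof. by move=> bf bg; apply: RintegralB => //; exact: bdmeas_integrable. Qed.

Lemma meanZ (c : R) f : bdmeas f -> mean (fun x => c * f x) = c * mean f.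
Proof. by move=> bf; apply: RintegralZl => //; exact: bdmeas_integrable. Qed.

Lemma le_mean f g : bdmeas f -> bdmeas g -> (forall x, f x <= g x) ->
  mean f <= mean g.
Proof. by move=> bf bg fg; apply: le_Rintegral => //; exact: bdmeas_integrable. Qed.

Lemma mean_ge0 f : (forall x, 0 <= f x) -> 0 <= mean f.
Proof. by move=> f0; exact: Rintegral_ge0. Qed.

Lemma eq_mean f g : f =1 g -> mean f = mean g.
Proof. by move=> fg; apply: eq_Rintegral => x _. Qed.

Lemma normr_mean_le f b : bdmeas f -> (forall x, `|f x| <= b) -> `|mean f| <= b.
Proof.
move=> bf fb; rewrite ler_norml; apply/andP; split.
  rewrite -[leLHS]mean_cst; apply: le_mean => //; first exact: bdmeas_cst.
  by move=> x; have := fb x; rewrite ler_norml => /andP[].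
rewrite -[leRHS]mean_cst; apply: le_mean => //; first exact: bdmeas_cst.
by move=> x; have := fb x; rewrite ler_norml => /andP[].
Qed.

Lemma varE f : bdmeas f -> var f = mean (fun x => f x ^+ 2) - mean f ^+ 2.
Proof.
move=> bf; rewrite /var.
rewrite (@eq_mean _ (fun x => f x ^+ 2 - (2 * mean f * f x - mean f ^+ 2))); last first.
  by move=> x; ring.
have b1 : bdmeas (fun x => 2 * mean f * f x) by apply: bdmeasM => //; exact: bdmeas_cst.
have b2 := bdmeas_cst (mean f ^+ 2).
rewrite meanB//; [|exact: bdmeas_sqr|exact: bdmeasB].
by rewrite meanB// meanZ// mean_cst; ring.
Qed.

Lemma var_le_second_moment f : bdmeas f -> var f <= mean (fun x => f x ^+ 2).
Proof. by move=> bf; rewrite varE// lerBlDr lerDl sqr_ge0. Qed.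

Lemma var_le_sqr f b : bdmeas f -> (forall x, `|f x| <= b) -> var f <= b ^+ 2.
Proof.
move=> bf fb; apply: (le_trans (var_le_second_moment _)) => //.
rewrite -[leRHS]mean_cst; apply: le_mean => //; [exact: bdmeas_sqr|exact: bdmeas_cst|].
by move=> x; rewrite -[f x ^+ 2]ger0_norm ?sqr_ge0// normrX lerXn2r ?nnegrE// (le_trans _ (fb x)).
Qed.

Lemma varD_le f g : bdmeas f -> bdmeas g ->
  var (fun x => f x + g x) <= 2 * var f + 2 * var g.
Proof.
move=> bf bg.
have c1 : bdmeas (fun x => f x - mean f) by apply: bdmeasB => //; exact: bdmeas_cst.
have c2 : bdmeas (fun x => g x - mean g) by apply: bdmeasB => //; exact: bdmeas_cst.
have z h : bdmeas h -> bdmeas (fun x => 2 * h x) by move=> ?; apply: bdmeasM => //; exact: bdmeas_cst.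
have s1 := bdmeas_sqr c1; have s2 := bdmeas_sqr c2.
rewrite /var -meanZ// -meanZ// -meanD//; [|exact: z|exact: z].
apply: le_mean.
- by apply/bdmeas_sqr/bdmeasB => //; [exact: bdmeasD|exact: bdmeas_cst].
- by apply: bdmeasD; exact: z.
move=> x; rewrite meanD//.
have := sqr_ge0 ((f x - mean f) - (g x - mean g)).
set u := f x - mean f; set v := g x - mean g => H.
have -> : f x + g x - (mean f + mean g) = u + v by rewrite /u /v; ring.
nra.
Qed.

Lemma varN f : bdmeas f -> var (fun x => - f x) = var f.
Proof.
move=> bf; apply: eq_mean => x.
rewrite (@eq_mean _ (fun x => (-1) * f x)); last by move=> y; rewrite mulN1r.
by rewrite meanZ//; ring.
Qed.

Lemma varB_le f g : bdmeas f -> bdmeas g ->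
  var (fun x => f x - g x) <= 2 * var f + 2 * var g.
Proof.
move=> bf bg; rewrite -(varN bg); apply: varD_le => //.
rewrite (_ : (fun x => - g x) = fun x => 0 - g x); last by apply/funext => x; rewrite sub0r.
by apply: bdmeasB => //; exact: bdmeas_cst.
Qed.

(** The factor 2 in front of the square is the price of deducing the bound from
    [1 - u <= exp (- u)] alone. *)
Lemma expR_le_quadratic (u : R) : `|u| <= 2^-1 -> expR u <= 1 + u + 2 * u ^+ 2.
Proof.
rewrite ler_norml => /andP[u1 u2].
have e := expR_ge1Dx (- u).
have p : 0 < 1 - u by lra.
have : expR u <= (1 - u)^-1.
  by rewrite -[expR u]invrK lef_pV2 ?posrE ?invr_gt0 ?expR_gt0// -expRN.
move=> /le_trans; apply; rewrite -[leLHS]mulr1 ler_pdivrMl//.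
have q : 0 <= 1 - 2 * u by lra.
have := mulr_ge0 (sqr_ge0 u) q; nra.
Qed.

(** Bernstein's exponential moment: the linear term of [expR_le_quadratic] is centered. *)
Lemma mgf_centered (f : T -> R) (l : R) : bdmeas f ->
  (forall x, `|l * (mean f - f x)| <= 2^-1) ->
  (\int[P]_x (expR (l * (mean f - f x)))%:E <= (expR (2 * l ^+ 2 * var f))%:E)%E.
Proof.
move=> bf H.
have bc : bdmeas (fun x => mean f - f x) by apply: bdmeasB => //; exact: bdmeas_cst.
have z c h : bdmeas h -> bdmeas (fun x => c * h x) by move=> ?; apply: bdmeasM => //; exact: bdmeas_cst.
rewrite -meanE; last exact/bdmeas_expR/z.
rewrite lee_fin.
have b2 : bdmeas (fun x => 1 + l * (mean f - f x)) by apply: bdmeasD; [exact: bdmeas_cst|exact: z].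
have b3 : bdmeas (fun x => (2 * l ^+ 2) * (f x - mean f) ^+ 2).
  by apply/z/bdmeas_sqr/bdmeasB => //; exact: bdmeas_cst.
apply: (@le_trans _ _ (mean (fun x => 1 + l * (mean f - f x) + (2 * l ^+ 2) * (f x - mean f) ^+ 2))).
  apply: le_mean; [exact/bdmeas_expR/z|exact: bdmeasD|].
  by move=> x; apply: (le_trans (expR_le_quadratic (H x))); lra.
rewrite meanD// meanD; [|exact: bdmeas_cst|exact: z].
rewrite meanZ// meanB//; last exact: bdmeas_cst.
rewrite !mean_cst subrr mulr0 addr0 meanZ; last by apply/bdmeas_sqr/bdmeasB => //; exact: bdmeas_cst.
exact: expR_ge1Dx.
Qed.

End bounded_measurable.

(** * Deviations of a finite family *)

Lemma lee_prod_ord (R : realType) (n : nat) (f g : 'I_n -> \bar R) :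
  (forall i, 0 <= f i)%E -> (forall i, f i <= g i)%E ->
  (\prod_i f i <= \prod_i g i)%E.
Proof.
move=> f0 fg; elim: n f g f0 fg => [|n IH] f g f0 fg; first by rewrite !big_ord0.
rewrite !big_ord_recl; apply: lee_pmul => //; last by apply: IH.
by apply: prode_ge0 => i _.
Qed.

Section deviations.
Context {dO d : measure_display} {Omega : measurableType dO} {T : measurableType d}
  {R : realType}.
Variables (Pr : probability Omega R) (P Q : probability T R) (n : nat).
Variables (X Y : 'I_n -> {mfun Omega >-> T}).
Hypothesis n0 : (0 < n)%N.
Hypothesis samples : two_samples Pr P Q X Y.

(** Signed so that it bounds a population risk from above by an empirical one. *)
Definition deviation (mu : probability T R) (x : 'I_n -> T) (g : T -> R) : R :=
  mean mu g - n%:R^-1 * \sum_i g (x i).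

Lemma integral_has_law (Z : {mfun Omega >-> T}) (mu : probability T R) (f : T -> \bar R) :
  has_law Pr Z mu -> measurable_fun setT f -> (forall x, 0 <= f x)%E ->
  (\int[Pr]_w f (Z w) = \int[mu]_x f x)%E.
Proof.
move=> law mf f0; rewrite -[LHS](@ge0_integral_distribution _ _ _ _ _ Pr Z f)//.
by apply: eq_measure_integral => A mA _; exact: law.
Qed.

Lemma mgf_two_samples (gX gY : T -> R) (l : R) :
  bdmeas gX -> bdmeas gY ->
  (forall x, `|l * (mean P gX - gX x)| <= 2^-1) ->
  (forall x, `|l * (mean Q gY - gY x)| <= 2^-1) ->
  (\int[Pr]_w (expR (l * n%:R * (deviation P (fun i => X i w) gX
                                + deviation Q (fun i => Y i w) gY)
                     - 2 * n%:R * l ^+ 2 * (var P gX + var Q gY)))%:E <= 1)%E.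
Proof.
move=> bX bY HX HY; have [lawX lawY indep] := samples.
have n0' : n%:R != 0 :> R by rewrite pnatr_eq0 -lt0n.
(* The two samples form one family of 2n independent variables. *)
pose f (k : 'I_n + 'I_n) (x : T) : R := match k with
  | inl _ => expR (l * (mean P gX - gX x))
  | inr _ => expR (l * (mean Q gY - gY x)) end.
pose Z (k : 'I_n + 'I_n) : Omega -> T := match k with inl i => X i | inr j => Y j end.
have bf k : bdmeas (f k).
  case: k => i; apply: bdmeas_expR; apply: bdmeasM; [exact: bdmeas_cst| |exact: bdmeas_cst| ].
    by apply: bdmeasB => //; exact: bdmeas_cst.
  by apply: bdmeasB => //; exact: bdmeas_cst.
have mf k : measurable_fun setT (f k) by case: (bf k).
have f0 k x : 0 <= f k x by case: k => i; exact: expR_ge0.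
have If k : (\int[Pr]_w (f k (Z k w))%:E <=
    match k with inl _ => (expR (2 * l ^+ 2 * var P gX))%:E
               | inr _ => (expR (2 * l ^+ 2 * var Q gY))%:E end)%E.
  have mfE : measurable_fun setT (EFin \o f k) by apply/measurable_EFinP.
  have f0E x : (0 <= (EFin \o f k) x)%E by rewrite lee_fin.
  case: k mfE f0E => i mfE f0E.
    by rewrite (integral_has_law (lawX i) mfE f0E); exact: mgf_centered.
  by rewrite (integral_has_law (lawY i) mfE f0E); exact: mgf_centered.
have Ifin k : (\int[Pr]_w (f k (Z k w))%:E < +oo)%E.
  by apply: (le_lt_trans (If k)); case: k => i; exact: ltry.
have mZ k : measurable_fun setT (Z k) by case: k => i.
pose V := 2 * n%:R * l ^+ 2 * (var P gX + var Q gY).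
have E w : expR (l * n%:R * (deviation P (fun i => X i w) gX
            + deviation Q (fun i => Y i w) gY) - V) =
    expR (- V) * \prod_k f k (Z k w).
  rewrite addrC expRD; congr (_ * _).
  rewrite big_sumType/= -!expR_sum -expRD; congr expR.
  have sumE (c : R) (g : 'I_n -> R) : \sum_i (l * (c - g i)) = l * (n%:R * c - \sum_i g i).
    by rewrite -mulr_sumr sumrB sumr_const card_ord mulr_natl.
  rewrite !sumE /deviation /V.
  set A := \sum_i _; set B := \sum_i _.
  by field.
under eq_integral do rewrite E EFinM.
rewrite ge0_integralZl//; last 2 first.
- apply/measurable_EFinP/measurable_prod => k _.
  by apply: (measurableT_comp (mf k)).
- by move=> w _; rewrite lee_fin prodr_ge0.
rewrite (expectation_prod_independent indep mZ mf f0 Ifin) big_sumType/=.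
have A0 k : (0 <= \int[Pr]_w (f k (Z k w))%:E)%E.
  by apply: integral_ge0 => w _; rewrite lee_fin.
apply: (@le_trans _ _ ((expR (- V))%:E * ((expR (2 * l ^+ 2 * var P gX) ^+ n)%:E *
    (expR (2 * l ^+ 2 * var Q gY) ^+ n)%:E))%E).
  apply: lee_wpmul2l; first by rewrite lee_fin expR_ge0.
  rewrite -[X in (expR (_ * var P _) ^+ X)%:E]card_ord.
  rewrite -[X in (expR (_ * var Q _) ^+ X)%:E]card_ord -!prodr_const -!prodEFin.
  apply: lee_pmul.
  - by apply: prode_ge0 => i _; exact: (A0 (inl i)).
  - by apply: prode_ge0 => i _; exact: (A0 (inr i)).
  - by apply: lee_prod_ord => i; [exact: (A0 (inl i))|exact: (If (inl i))].
  - by apply: lee_prod_ord => i; [exact: (A0 (inr i))|exact: (If (inr i))].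
rewrite -!EFinM lee_fin -!expRM_natl -!expRD -[leRHS]expR0 ler_expR /V.
by rewrite le_eqVlt; apply/orP; left; apply/eqP; ring.
Qed.

(** A soft maximum replaces a union bound: for a normalized exponential moment
    [E exp (y k) <= 1] one has [y k <= ln N + N^-1 * \sum_j exp (y j)] at every outcome, and the
    right-hand side is measurable with mean at most [ln N + 1]. *)
Lemma deviation_finite_family (K : finType) (gX gY : K -> T -> R) (l : R) :
  (0 < #|K|)%N -> 0 < l ->
  (forall k, bdmeas (gX k)) -> (forall k, bdmeas (gY k)) ->
  (forall k x, `|l * (mean P (gX k) - gX k x)| <= 2^-1) ->
  (forall k x, `|l * (mean Q (gY k) - gY k x)| <= 2^-1) ->
  exists G : Omega -> R, [/\ measurable_fun setT G, forall w, 0 <= G w,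
    (\int[Pr]_w (G w)%:E <= ((ln #|K|%:R + 1) / (l * n%:R))%:E)%E &
    forall w k, deviation P (fun i => X i w) (gX k)
              + deviation Q (fun i => Y i w) (gY k)
              <= 2 * l * (var P (gX k) + var Q (gY k)) + G w].
Proof.
move=> K0 l0 bX bY HX HY.
have n0' : 0 < n%:R :> R by rewrite ltr0n.
have K0' : 0 < #|K|%:R :> R by rewrite ltr0n.
have K1 : 1 <= #|K|%:R :> R by rewrite ler1n.
pose y k w := l * n%:R * (deviation P (fun i => X i w) (gX k)
                   + deviation Q (fun i => Y i w) (gY k))
               - 2 * n%:R * l ^+ 2 * (var P (gX k) + var Q (gY k)).
have my k : measurable_fun setT (fun w => expR (y k w)).
  have [[mX _] [mY _]] := (bX k, bY k).
  apply: measurableT_comp => //; apply: measurable_funB => //.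
  apply: measurable_funM => //; apply: measurable_funD.
    apply: measurable_funB => //; apply: measurable_funM => //.
    by apply: measurable_sum => i; exact: (measurableT_comp mX).
  apply: measurable_funB => //; apply: measurable_funM => //.
  by apply: measurable_sum => i; exact: (measurableT_comp mY).
pose G w := (l * n%:R)^-1 * (ln #|K|%:R + #|K|%:R^-1 * \sum_k expR (y k w)).
have ln0 : 0 <= ln #|K|%:R :> R by exact: ln_ge0.
exists G; split.
- apply: measurable_funM => //; apply: measurable_funD => //; apply: measurable_funM => //.
  exact: measurable_sum.
- move=> w; rewrite /G mulr_ge0 ?invr_ge0 ?mulr_ge0 ?(ltW l0) ?(ltW n0')//.
  by rewrite addr_ge0// mulr_ge0 ?invr_ge0 ?(ltW K0')// sumr_ge0// => k _; exact: expR_ge0.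
- have ln_n0 : 0 < l * n%:R by rewrite mulr_gt0.
  have c0 : (0 <= ((l * n%:R)^-1)%:E)%E by rewrite lee_fin invr_ge0 ltW.
  have S0 w : 0 <= \sum_k expR (y k w) by rewrite sumr_ge0// => k _; exact: expR_ge0.
  have mS : measurable_fun setT (fun w => \sum_k expR (y k w)) by exact: measurable_sum.
  under eq_integral do rewrite /G EFinM EFinD EFinM.
  rewrite ge0_integralZl//; last 2 first.
  + apply/measurable_EFinP; apply: measurable_funD => //; exact: measurable_funM.
  + by move=> w _; rewrite -EFinM -EFinD lee_fin addr_ge0// mulr_ge0 ?invr_ge0 ?(ltW K0').
  rewrite [X in (_ <= X%:E)%E]mulrC EFinM; apply: lee_wpmul2l => //.
  rewrite ge0_integralD//; last 2 first.
  + by move=> w _; rewrite -EFinM lee_fin mulr_ge0 ?invr_ge0 ?(ltW K0').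
  + by apply/measurable_EFinP; exact: measurable_funM.
  rewrite integral_cst//=; have := probability_setT Pr => ->; rewrite mule1 EFinD.
  apply: leeD2l; rewrite ge0_integralZl//; last 2 first.
  + exact/measurable_EFinP.
  + by move=> w _; rewrite lee_fin.
  under eq_integral do rewrite -sumEFin.
  rewrite ge0_integral_sum//; last by move=> k; apply/measurable_EFinP; exact: my.
  apply: (@le_trans _ _ ((#|K|%:R^-1)%:E * (\sum_(k : K) 1)%:E)%E).
    apply: lee_wpmul2l; first by rewrite lee_fin invr_ge0 ltW.
    by rewrite -sumEFin; apply: lee_sum => k _; exact: mgf_two_samples.
  by rewrite sumr_const -EFinM lee_fin mulVf ?gt_eqF.
- move=> w k.
  set D := deviation _ _ _ + _; set V := var _ _ + _.
  (* [u <= exp u] at [u = y - ln N] bounds each term by the average exponential. *)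
  have step : y k w <= ln #|K|%:R + #|K|%:R^-1 * \sum_k expR (y k w).
    apply: (@le_trans _ _ (ln #|K|%:R + #|K|%:R^-1 * expR (y k w))).
      have := expR_ge1Dx (y k w - ln #|K|%:R).
      rewrite expRB lnK ?posrE// [_ / _]mulrC; lra.
    rewrite lerD2l ler_pM2l ?invr_gt0// (bigD1 k)//= lerDl sumr_ge0// => j _.
  have ln_n0 : 0 < l * n%:R by rewrite mulr_gt0.
  rewrite -lerBlDl /G -(ler_pM2l ln_n0) mulrA divff ?gt_eqF// mul1r.
  apply: le_trans step; rewrite /y -/D -/V.
  by rewrite le_eqVlt; apply/orP; left; apply/eqP; ring.
Qed.

End deviations.

(** * Chaining with a Bernstein condition *)

Lemma deviationB {d : measure_display} {T : measurableType d} {R : realType}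
    (n : nat) (mu : probability T R) (x : 'I_n -> T) (f g : T -> R) :
  bdmeas f -> bdmeas g ->
  deviation mu x (fun y => f y - g y) = deviation mu x f - deviation mu x g.
Proof. by move=> bf bg; rewrite /deviation meanB// sumrB; ring. Qed.

Lemma deviation_le {d : measure_display} {T : measurableType d} {R : realType}
    (n : nat) (mu : probability T R) (x : 'I_n -> T) (f : T -> R) (b : R) : (0 < n)%N ->
  bdmeas f -> (forall y, `|f y| <= b) -> deviation mu x f <= 2 * b.
Proof.
move=> n0 bf fb; rewrite /deviation.
have n0' : 0 < n%:R :> R by rewrite ltr0n.
have := normr_mean_le mu bf fb; rewrite ler_norml => /andP[_ H1].
have : - (n%:R^-1 * \sum_i f (x i)) <= b; last by lra.
rewrite -mulrN mulrC ler_pdivrMr// -sumrN.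
rewrite [leRHS]mulr_natr -[X in _ *+ X]card_ord -sumr_const; apply: ler_sum => i _.
by have := fb (x i); rewrite ler_norml; lra.
Qed.

Section chaining.
Context {dO d : measure_display} {Omega : measurableType dO} {T : measurableType d}
  {R : realType}.
Variables (Pr : probability Omega R) (P Q : probability T R) (n : nat).
Variables (X Y : 'I_n -> {mfun Omega >-> T}).
Hypothesis n0 : (0 < n)%N.
Hypothesis samples : two_samples Pr P Q X Y.
Variables (E : Type) (F : set E) (u v : E -> T -> R).
Hypothesis bu : forall f, F f -> bdmeas (u f).
Hypothesis bv : forall f, F f -> bdmeas (v f).

(** The representatives are members of the class, and a single index serves both functions
    attached to a candidate. *)
Definition net (e H : R) : Prop := exists N (rep : 'I_N -> E) (idx : E -> 'I_N),
  [/\ ln N%:R <= H, forall i, F (rep i) & forall f, F f -> forall x,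
    `|u f x - u (rep (idx f)) x| <= e /\ `|v f x - v (rep (idx f)) x| <= e].

Local Notation dev w f := (deviation P (fun i => X i w) (u f)
                         + deviation Q (fun i => Y i w) (v f)).

(** The hypothesis under which exponential moments are available. *)
Lemma scaled_centered_le (mu : probability T R) (g : T -> R) (b l : R) :
  bdmeas g -> (forall x, `|g x| <= b) -> 0 <= l -> 4 * b * l <= 1 ->
  forall x, `|l * (mean mu g - g x)| <= 2^-1.
Proof.
move=> bg gb l0 bl x; rewrite normrM (ger0_norm l0).
have H : `|mean mu g - g x| <= 2 * b.
  apply: (le_trans (ler_normB _ _)).
  by have := normr_mean_le mu bg gb; have := gb x; lra.
by apply: (le_trans (ler_wpM2l l0 H)); lra.
Qed.

(** First link of the chain: here the variance is kept, because it is what the Bernstein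
    condition controls. *)
Lemma deviation_coarse_net (N : nat) (rep : 'I_N -> E) (b l H : R) :
  (0 < N)%N -> (forall i, F (rep i)) -> ln N%:R <= H -> 0 < l -> 4 * b * l <= 1 ->
  (forall f x, F f -> `|u f x| <= b) -> (forall f x, F f -> `|v f x| <= b) ->
  exists G : Omega -> R, [/\ measurable_fun setT G, forall w, 0 <= G w,
    (\int[Pr]_w (G w)%:E <= ((H + 1) / (l * n%:R))%:E)%E &
    forall w i, dev w (rep i) <=
      2 * l * (var P (u (rep i)) + var Q (v (rep i))) + G w].
Proof.
move=> N0 Frep NH l0 bl ub vb.
have K0 : (0 < #|'I_N|)%N by rewrite card_ord.
have [G [mG G0 IG HG]] := deviation_finite_family n0 samples K0 l0
  (fun i => bu (Frep i)) (fun i => bv (Frep i))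
  (fun i => scaled_centered_le P (bu (Frep i)) (fun x => ub _ x (Frep i)) (ltW l0) bl)
  (fun i => scaled_centered_le Q (bv (Frep i)) (fun x => vb _ x (Frep i)) (ltW l0) bl).
exists G; split => //; apply: (le_trans IG); rewrite lee_fin card_ord.
by rewrite ler_pM2r ?lerD2r// invr_gt0 mulr_gt0// ltr0n.
Qed.

(** Middle links of the chain: between representatives at distance at most [b] the variance is
    at most [b ^+ 2], whatever their risk. *)
Lemma deviation_increment (N M : nat) (rep : 'I_N -> E) (rep' : 'I_M -> E) (b l H H' : R) :
  (0 < N)%N -> (0 < M)%N -> (forall i, F (rep i)) -> (forall i, F (rep' i)) ->
  ln N%:R <= H -> ln M%:R <= H' -> 0 < l -> 0 <= b -> 4 * b * l <= 1 ->
  exists G : Omega -> R, [/\ measurable_fun setT G, forall w, 0 <= G w,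
    (\int[Pr]_w (G w)%:E <= ((H + H' + 1) / (l * n%:R))%:E)%E &
    forall w i j, (forall x, `|u (rep i) x - u (rep' j) x| <= b) ->
      (forall x, `|v (rep i) x - v (rep' j) x| <= b) ->
      dev w (rep i) - dev w (rep' j) <= 4 * l * b ^+ 2 + G w].
Proof.
move=> N0 M0 Frep Frep' NH MH l0 b0 bl.
(* Only the pairs of close representatives can be links of a chain; the others are
   replaced by 0 so that the whole family obeys the bound [b]. *)
pose close (k : 'I_N * 'I_M) := `[< (forall x, `|u (rep k.1) x - u (rep' k.2) x| <= b) /\
      (forall x, `|v (rep k.1) x - v (rep' k.2) x| <= b) >].
pose gX k x := if close k then u (rep k.1) x - u (rep' k.2) x else 0.
pose gY k x := if close k then v (rep k.1) x - v (rep' k.2) x else 0.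
have bX k : bdmeas (gX k).
  rewrite /gX; case: (close k); last exact: bdmeas_cst.
  by apply: bdmeasB; exact: bu.
have bY k : bdmeas (gY k).
  rewrite /gY; case: (close k); last exact: bdmeas_cst.
  by apply: bdmeasB; exact: bv.
have gXb k x : `|gX k x| <= b.
  by rewrite /gX; case: ifPn => [/asboolP[]//|]; rewrite normr0.
have gYb k x : `|gY k x| <= b.
  by rewrite /gY; case: ifPn => [/asboolP[]//|]; rewrite normr0.
have K0 : (0 < #|{: 'I_N * 'I_M}|)%N by rewrite card_prod !card_ord muln_gt0 N0.
have [G [mG G0 IG HG]] := deviation_finite_family n0 samples K0 l0 bX bY
  (fun k => scaled_centered_le P (bX k) (gXb k) (ltW l0) bl)
  (fun k => scaled_centered_le Q (bY k) (gYb k) (ltW l0) bl).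
exists G; split => //.
  apply: (le_trans IG); rewrite lee_fin card_prod !card_ord natrM lnM ?posrE ?ltr0n//.
  by rewrite ler_pM2r ?invr_gt0 ?mulr_gt0 ?ltr0n// lerD2r lerD.
move=> w i j uij vij; have := HG w (i, j).
have cl : close (i, j) by apply/asboolP.
have -> : gX (i, j) = fun x => u (rep i) x - u (rep' j) x.
  by apply/funext => x; rewrite /gX cl.
have -> : gY (i, j) = fun x => v (rep i) x - v (rep' j) x.
  by apply/funext => x; rewrite /gY cl.
rewrite !deviationB; [|exact: bv|exact: bv|exact: bu|exact: bu].
have := var_le_sqr P (bdmeasB (bu (Frep i)) (bu (Frep' j))) uij.
have := var_le_sqr Q (bdmeasB (bv (Frep i)) (bv (Frep' j))) vij.
set A := var _ _; set B := var _ _ => HA HB Hd.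
have : 2 * l * (B + A) <= 4 * l * b ^+ 2.
  rewrite (_ : 4 * l * b ^+ 2 = 2 * l * (b ^+ 2 + b ^+ 2)); last by ring.
  by rewrite ler_pM2l ?mulr_gt0// lerD.
lra.
Qed.

(** Chaining along the nets of radii [e 0 >= e 1 >= ... >= e J]. The variance of the coarse
    representative exceeds twice that of [f] only by [O(e 0 ^+ 2)]: this square, in place of [e 0]
    itself, is what yields the fast rate, and the variance of [f] is absorbed through its loss. *)
Lemma chained_risk_bound (loss : E -> R) (f0 : E) (K b : R) (J : nat) (e H lam : nat -> R) :
  (forall f, F f -> loss f - loss f0 = mean P (u f) + mean Q (v f)) ->
  (forall f, F f -> var P (u f) + var Q (v f) <= K * (loss f + loss f0)) ->
  (forall f, F f -> 0 <= loss f) -> F f0 ->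
  (forall f x, F f -> `|u f x| <= b) -> (forall f x, F f -> `|v f x| <= b) ->
  (forall j, net (e j) (H j)) -> (forall j, e j.+1 <= e j <= 2 * e j.+1) ->
  (forall j, 0 < lam j) ->
  4 * b * lam 0%N <= 1 -> 8 * K * lam 0%N <= 1 ->
  (forall j, 12 * e j.+1 * lam j.+1 <= 1) ->
  exists G : Omega -> R, [/\ measurable_fun setT G, forall w, 0 <= G w,
    (\int[Pr]_w (G w)%:E <= (2 * ((H 0%N + 1) / (lam 0%N * n%:R) +
       \sum_(j < J) (H j.+1 + H j + 1) / (lam j.+1 * n%:R)))%:E)%E &
    forall w f, F f -> \sum_i u f (X i w) + \sum_i v f (Y i w) <= 0 ->
      loss f <= 3 * loss f0 + 2 * (8 * lam 0%N * e 0%N ^+ 2 + 4 * e J +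
        \sum_(j < J) 36 * lam j.+1 * e j.+1 ^+ 2) + G w].
Proof.
move=> lossE varK loss0 Ff0 ub vb nets eP l0 bl Kl el.
have n0' : 0 < n%:R :> R by rewrite ltr0n.
have /choice[N] := nets.
move=> /(_ _)/cid-/all_sig[rep] /(_ _)/cid-/all_sig[idx netP].
have N0 j : (0 < N j)%N by exact: leq_ltn_trans (ltn_ord (idx j f0)).
have NH j : ln (N j)%:R <= H j by case: (netP j).
have Frep j i : F (rep j i) by case: (netP j).
pose pi j f := rep j (idx j f).
have Fpi j f : F (pi j f) by exact: Frep.
have upi j f x : F f -> `|u f x - u (pi j f) x| <= e j.
  by move=> Ff; have [_ _ /(_ f Ff x)[]] := netP j.
have vpi j f x : F f -> `|v f x - v (pi j f) x| <= e j.
  by move=> Ff; have [_ _ /(_ f Ff x)[]] := netP j.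
have e0 j : 0 <= e j.
  by have x := @point T; apply: le_trans (upi j f0 x Ff0).
have [G0 [mG0 G00 IG0 HG0]] :=
  deviation_coarse_net (N0 0%N) (Frep 0%N) (NH 0%N) (l0 0%N) bl ub vb.
have incr j : exists G : Omega -> R, [/\ measurable_fun setT G, forall w, 0 <= G w,
    (\int[Pr]_w (G w)%:E <= ((H j.+1 + H j + 1) / (lam j.+1 * n%:R))%:E)%E &
    forall w f, F f -> dev w (pi j.+1 f) - dev w (pi j f)
        <= 36 * lam j.+1 * e j.+1 ^+ 2 + G w].
  have /andP[e1 e2] := eP j.
  have b3 : 0 <= 3 * e j.+1 by rewrite mulr_ge0.
  have bl3 : 4 * (3 * e j.+1) * lam j.+1 <= 1 by rewrite mulrA -natrM.
  have [G [mG Gge0 IG HG]] := deviation_increment (N0 j.+1) (N0 j) (Frep j.+1) (Frep j)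
    (NH j.+1) (NH j) (l0 j.+1) b3 bl3.
  exists G; split => // w f Ff.
  apply: (le_trans (HG w (idx j.+1 f) (idx j f) _ _)).
  - move=> x; rewrite -/(pi j f) -/(pi j.+1 f).
    have := upi j f x Ff; have := upi j.+1 f x Ff.
    by rewrite !ler_norml; lra.
  - move=> x; rewrite -/(pi j f) -/(pi j.+1 f).
    have := vpi j f x Ff; have := vpi j.+1 f x Ff.
    by rewrite !ler_norml; lra.
  - by rewrite lerD2r; lra.
move=> {nets}.
have /choice[G1 {incr}G1P] := incr.
have mG1 j : measurable_fun setT (G1 j) by case: (G1P j).
have G10 j w : 0 <= G1 j w by case: (G1P j).
pose G w := 2 * (G0 w + \sum_(j < J) G1 j w).
have mS : measurable_fun setT (fun w => \sum_(j < J) G1 j w) by exact: measurable_sum.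
have S0 w : 0 <= \sum_(j < J) G1 j w by exact: sumr_ge0.
exists G; split.
- by apply: measurable_funM => //; exact: measurable_funD.
- by move=> w; rewrite /G mulr_ge0// addr_ge0.
- rewrite /G; under eq_integral do rewrite EFinM.
  rewrite ge0_integralZl//; last 2 first.
  + by apply/measurable_EFinP; exact: measurable_funD.
  + by move=> w _; rewrite lee_fin addr_ge0.
  rewrite EFinM; apply: lee_wpmul2l; first by rewrite lee_fin.
  under eq_integral do rewrite EFinD.
  rewrite ge0_integralD//;
    do ?[by move=> w _; rewrite lee_fin | by apply/measurable_EFinP].
  rewrite EFinD; apply: leeD => //.
  under eq_integral do rewrite -sumEFin.
  rewrite ge0_integral_sum//;
    do ?[by move=> j; apply/measurable_EFinP | by move=> j w _; rewrite lee_fin].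
  by rewrite -sumEFin; apply: lee_sum => j _; case: (G1P j).
move=> w f Ff erm.
have devE : loss f - loss f0 <= dev w f.
  rewrite lossE// /deviation.
  have : n%:R^-1 * (\sum_i u f (X i w) + \sum_i v f (Y i w)) <= 0.
    by apply: mulr_ge0_le0 => //; rewrite invr_ge0 ltW.
  rewrite mulrDr; lra.
(* [loss f - loss f0 <= dev w f] is split into a last, a first and [J] middle links. *)
have last : dev w f - dev w (pi J f) <= 4 * e J.
  have := deviation_le P (fun i => X i w) n0 (bdmeasB (bu Ff) (bu (Fpi J f))) (fun x => upi J f x Ff).
  have := deviation_le Q (fun i => Y i w) n0 (bdmeasB (bv Ff) (bv (Fpi J f))) (fun x => vpi J f x Ff).
  rewrite !deviationB; [|exact: bu|exact: bu|exact: bv|exact: bv].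
  lra.
have first : dev w (pi 0%N f) <= 2^-1 * (loss f + loss f0) + 8 * lam 0%N * e 0%N ^+ 2 + G0 w.
  apply: (le_trans (HG0 w (idx 0%N f))); rewrite -/(pi 0%N f) lerD2r.
  have b1 := bdmeasB (bu Ff) (bu (Fpi 0%N f)).
  have b2 := bdmeasB (bv Ff) (bv (Fpi 0%N f)).
  have V1 : var P (u (pi 0%N f)) <= 2 * var P (u f) + 2 * e 0%N ^+ 2.
    rewrite (_ : u (pi 0%N f) = fun x => u f x - (u f x - u (pi 0%N f) x)); last first.
      by apply/funext => x; ring.
    apply: (le_trans (varB_le P (bu Ff) b1)); rewrite lerD2l ler_pM2l//.
    by apply: var_le_sqr => // x; exact: upi.
  have V2 : var Q (v (pi 0%N f)) <= 2 * var Q (v f) + 2 * e 0%N ^+ 2.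
    rewrite (_ : v (pi 0%N f) = fun x => v f x - (v f x - v (pi 0%N f) x)); last first.
      by apply/funext => x; ring.
    apply: (le_trans (varB_le Q (bv Ff) b2)); rewrite lerD2l ler_pM2l//.
    by apply: var_le_sqr => // x; exact: vpi.
  have s0 : 0 <= loss f + loss f0 by rewrite addr_ge0// loss0.
  have V3 : var P (u (pi 0%N f)) + var Q (v (pi 0%N f)) <=
      2 * (K * (loss f + loss f0)) + 4 * e 0%N ^+ 2.
    by have := varK f Ff; lra.
  (* [8 * K * lam 0 <= 1] leaves half of [loss f], absorbed by the left-hand side. *)
  apply: (le_trans (ler_wpM2l _ V3)); first by rewrite mulr_ge0// ltW.
  have := ler_wpM2r s0 Kl; lra.
have tele : dev w (pi J f) - dev w (pi 0%N f) <=
    \sum_(j < J) 36 * lam j.+1 * e j.+1 ^+ 2 + \sum_(j < J) G1 j w.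
  rewrite -(telescope_sumr (fun j => dev w (pi j f)))// big_mkord -big_split/=.
  by apply: ler_sum => j _; have [_ _ _ /(_ w f Ff)] := G1P j.
rewrite /G; lra.
Qed.

End chaining.

(** * Arithmetic of the rate *)

Section rates.
Context {R : realType}.
Variables (gamma : R) (n : nat).
Hypotheses (gamma0 : 0 <= gamma) (n2 : (2 <= n)%N).

Local Notation N := (n%:R : R).

Let N2 : 2 <= N. Proof. by rewrite ler_nat. Qed.

Let N0 : 0 < N. Proof. by apply: lt_le_trans N2. Qed.

(** The scale [h] at which [h ^+ 2] and [h^-gamma / n] coincide. *)
Definition coarse_scale : R := N `^ (- (2 + gamma)^-1).

Lemma coarse_scale_gt0 : 0 < coarse_scale.
Proof. exact: powR_gt0. Qed.

Lemma rate_gt0 : 0 < rate gamma n :> R.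
Proof. by rewrite /rate lt_max powR_gt0. Qed.

Lemma ln2_ge_half : 2^-1 <= ln 2 :> R.
Proof.
rewrite -[leLHS]expRK ler_ln ?posrE ?expR_gt0//.
by apply: (le_trans (expR_le_quadratic _)); rewrite ?ger0_norm; lra.
Qed.

Let lnN_gt0 : 0 < ln N.
Proof. by rewrite ln_gt0// (lt_le_trans _ N2)// ltr1n. Qed.

Let m_gt0 : 0 < (2 + gamma)^-1 :> R. Proof. by rewrite invr_gt0 ltr_wpDr. Qed.

Let m_eq : 2 * (2 + gamma)^-1 + gamma * (2 + gamma)^-1 = 1 :> R.
Proof.
have p : 0 < 2 + gamma by rewrite ltr_wpDr.
by rewrite -mulrDl divff// gt_eqF.
Qed.

Lemma ln_coarse_scale : ln coarse_scale = - (2 + gamma)^-1 * ln N.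
Proof. exact: ln_powR. Qed.

Lemma ln_rate_ge1 : - (2 * (2 + gamma)^-1) * ln N <= ln (rate gamma n).
Proof.
by rewrite -ln_powR ler_ln ?posrE ?powR_gt0 ?rate_gt0// /rate le_max lexx.
Qed.

Lemma ln_rate_ge2 : - ln N <= gamma * ln (rate gamma n).
Proof.
have [->|g0] := eqVneq gamma 0; first by rewrite mul0r; have := lnN_gt0; lra.
have gp : 0 < gamma by rewrite lt_neqAle eq_sym g0.
have : - gamma^-1 * ln N <= ln (rate gamma n).
  rewrite -ln_powR ler_ln ?posrE ?powR_gt0 ?rate_gt0// /rate (negbTE g0).
  by rewrite le_max lexx orbT.
rewrite -(ler_pM2l gp); apply: le_trans.
by rewrite mulNr mulrN mulrA divff ?mul1r// mulN1r.
Qed.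

Lemma ln_rate_le : ln (rate gamma n) <= ln coarse_scale.
Proof.
rewrite ler_ln ?posrE ?rate_gt0 ?coarse_scale_gt0// /rate ge_max.
have N1 : 1 <= N by have := N2; lra.
have g0' := gamma0; have m0 := m_gt0.
apply/andP; split; first by rewrite ler_powR//; lra.
case: ifPn => [_|g0]; first exact: powR_ge0.
have gp : 0 < gamma by rewrite lt_neqAle eq_sym g0.
by rewrite ler_powR// lerN2 lef_pV2 ?posrE//; lra.
Qed.

Lemma rate_le_coarse_scale : rate gamma n <= coarse_scale.
Proof. by rewrite -ler_ln ?posrE ?rate_gt0 ?coarse_scale_gt0// ln_rate_le. Qed.

Lemma coarse_scale_le1 : coarse_scale <= 1.
Proof.
rewrite -ler_ln ?posrE ?coarse_scale_gt0// ln1 ln_coarse_scale mulNr oppr_le0.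
by rewrite mulr_ge0// ltW.
Qed.

Lemma coarse_scale_sqr_le : coarse_scale ^+ 2 <= rate gamma n.
Proof.
rewrite -ler_ln ?posrE ?rate_gt0 ?exprn_gt0 ?coarse_scale_gt0//.
rewrite lnXn ?coarse_scale_gt0// ln_coarse_scale.
by have := ln_rate_ge1; rewrite mulr2n; lra.
Qed.

Lemma rate_ge_inv : N^-1 <= rate gamma n.
Proof.
rewrite -ler_ln ?posrE ?rate_gt0 ?invr_gt0// lnV ?posrE//.
have := ln_rate_ge1; apply: le_trans.
by have := mulr_ge0 gamma0 (ltW m_gt0); have := m_eq; have := lnN_gt0; nra.
Qed.

(** Above the rate the power of [h] in the entropy stays below [n], which bounds the parameters
    of the exponential moments. *)
Lemma entropy_rate_le (h : R) : rate gamma n <= h -> h `^ (- gamma) <= N.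
Proof.
move=> rh; have h0 : 0 < h := lt_le_trans rate_gt0 rh.
rewrite -ler_ln ?posrE ?powR_gt0// ln_powR.
have lnrh : ln (rate gamma n) <= ln h by rewrite ler_ln ?posrE ?rate_gt0.
have := ln_rate_ge2; have := ler_wpM2l gamma0 lnrh; lra.
Qed.

(** The left-hand side is a power of [h] with exponent [1 - gamma / 2]. It is nondecreasing for
    [gamma <= 2], hence extremal at the coarse scale, and decreasing otherwise, hence extremal at
    the rate. *)
Lemma chaining_rate_le (h : R) : rate gamma n <= h -> h <= coarse_scale ->
  h * Num.sqrt (h `^ (- gamma) / N) <= rate gamma n.
Proof.
move=> rh hc; have h0 : 0 < h := lt_le_trans rate_gt0 rh.
have lnrh : ln (rate gamma n) <= ln h by rewrite ler_ln ?posrE ?rate_gt0.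
have lnhc : ln h <= ln coarse_scale by rewrite ler_ln ?posrE ?coarse_scale_gt0.
have lN := lnN_gt0; have m0 := m_gt0; have g0' := gamma0; have mE := m_eq.
have pp : 0 < h `^ (- gamma) / N by rewrite divr_gt0// powR_gt0.
rewrite -[leRHS]ger0_norm ?(ltW rate_gt0)// -sqrtr_sqr.
rewrite -{1}[h]ger0_norm ?(ltW h0)// -sqrtr_sqr -sqrtrM ?sqr_ge0//.
rewrite ler_wsqrtr//.
rewrite -ler_ln ?posrE ?exprn_gt0 ?rate_gt0 ?mulr_gt0 ?exprn_gt0 ?powR_gt0 ?invr_gt0//.
rewrite lnM ?posrE ?exprn_gt0// ln_div ?posrE ?powR_gt0// !lnXn ?rate_gt0// ln_powR.
move: lnhc; rewrite ln_coarse_scale => lnhc.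
have g1 := ln_rate_ge1; have g2 := ln_rate_ge2.
rewrite !mulr2n.
set t := ln h in lnrh lnhc *; set r := ln (rate _ _) in lnrh g1 g2 *.
set L := ln N in lnhc g1 g2 *.
have [gle|glt] := leP gamma 2.
  have g' : 0 <= 2 - gamma by lra.
  have := ler_wpM2l g' lnhc.
  have mL : (2 * (2 + gamma)^-1 + gamma * (2 + gamma)^-1) * L = L by rewrite m_eq mul1r.
  lra.
have g' : 0 <= gamma - 2 by lra.
have := ler_wpM2l g' lnrh; lra.
Qed.

(** This is the equation that defines the coarse scale. *)
Lemma coarse_entropy_le : coarse_scale `^ (- gamma) / N <= rate gamma n.
Proof.
have p := coarse_scale_gt0.
apply: le_trans coarse_scale_sqr_le.
rewrite -ler_ln ?posrE ?exprn_gt0 ?divr_gt0 ?powR_gt0//.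
rewrite ln_div ?posrE ?powR_gt0// lnXn// ln_powR ln_coarse_scale mulr2n.
have mL : (2 * (2 + gamma)^-1 + gamma * (2 + gamma)^-1) * ln N = ln N by rewrite m_eq mul1r.
lra.
Qed.

Lemma logp_inv_le (h : R) : rate gamma n <= h -> logp h^-1 <= logp N.
Proof.
move=> rh; have h0 : 0 < h := lt_le_trans rate_gt0 rh.
rewrite /logp ge_max !le_max lexx/=; apply/orP; right.
rewrite ler_ln ?posrE ?invr_gt0// -[leRHS]invrK lef_pV2 ?posrE ?invr_gt0//.
exact: le_trans rate_ge_inv rh.
Qed.

Lemma logp_ge1 (x : R) : 1 <= logp x.
Proof. by rewrite /logp le_max lexx. Qed.

(** The number of links in the chain; it costs one more logarithm in the rate. *)
Lemma trunc_log_le_logp : (trunc_log 2 n).+1%:R <= 3 * logp N.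
Proof.
have : (2 ^ trunc_log 2 n <= n)%N by rewrite trunc_logP// (leq_trans _ n2).
rewrite -(ler_nat R) natrX => H.
have : ln (2 ^+ trunc_log 2 n) <= ln N by rewrite ler_ln ?posrE ?exprn_gt0.
rewrite lnXn// -[leLHS]mulr_natl => H1.
have H2 := ler_wpM2l (ler0n R (trunc_log 2 n)) ln2_ge_half.
have H3 : ln N <= logp N by rewrite /logp le_max lexx orbT.
have H4 := logp_ge1 N.
rewrite -natr1; lra.
Qed.

End rates.

(** * The oracle inequality for empirical risk minimizers *)

Section oracle.
Context {dO d : measure_display} {Omega : measurableType dO} {T : measurableType d}
  {R : realType}.
Variables (Pr : probability Omega R) (P Q : probability T R) (n : nat).
Variables (X Y : 'I_n -> {mfun Omega >-> T}).
Variables (E : Type) (F : set E) (u v : E -> T -> R).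

Lemma le_net (e H H' : R) : H <= H' -> net F u v e H -> net F u v e H'.
Proof.
move=> HH [N [rep [idx [NH Frep near]]]]; exists N, rep, idx; split => //.
exact: le_trans HH.
Qed.

Variables (gamma C1 q1 K b : R).
Hypotheses (gamma0 : 0 <= gamma) (C10 : 0 <= C1) (q10 : 0 <= q1) (K0 : 0 <= K) (b0 : 0 <= b).

(** The summands come from the coarse net, from the links, and from the variance and truncation
    terms. *)
Definition oracle_constant : R :=
  2 * ((C1 + 1) * (4 * b + 8 * K + 1) + 72 * (2 * C1 + 1)) + 116.

Lemma oracle_constant_ge0 : 0 <= oracle_constant.
Proof.
by rewrite /oracle_constant !(addr_ge0, mulr_ge0).
Qed.

(** [chained_risk_bound] at the scales [max (h_0 / 2^j) rate], from the coarse scale [h_0] down to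
    the rate: each link costs [h * sqrt (h^-gamma / n)], which never exceeds the rate. *)
Lemma erm_oracle_inequality (loss : E -> R) (f0 : E) :
  (2 <= n)%N -> two_samples Pr P Q X Y ->
  (forall f, F f -> bdmeas (u f)) -> (forall f, F f -> bdmeas (v f)) ->
  (forall f, F f -> loss f - loss f0 = mean P (u f) + mean Q (v f)) ->
  (forall f, F f -> var P (u f) + var Q (v f) <= K * (loss f + loss f0)) ->
  (forall f, F f -> 0 <= loss f) -> F f0 ->
  (forall f x, F f -> `|u f x| <= b) -> (forall f x, F f -> `|v f x| <= b) ->
  (forall h, 0 < h -> net F u v (2 * h) (C1 * logp h^-1 `^ q1 * h `^ (- gamma))) ->
  exists G : Omega -> R, [/\ measurable_fun setT G, forall w, 0 <= G w,
    (\int[Pr]_w (G w)%:E <=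
       (oracle_constant * logp n%:R `^ (q1 + 1) * rate gamma n)%:E)%E &
    forall w f, F f -> \sum_i u f (X i w) + \sum_i v f (Y i w) <= 0 ->
      loss f <= 3 * loss f0 + G w].
Proof.
move=> n2 samples bu bv lossE varK loss0 Ff0 ub vb nets.
have C10' := C10; have b0' := b0; have K0' := K0.
have n0 : (0 < n)%N by rewrite (leq_trans _ n2).
have N0 : 0 < n%:R :> R by rewrite ltr0n.
pose rho := rate gamma n; pose h0 := @coarse_scale R gamma n.
have rho0 : 0 < rho := rate_gt0 gamma n2.
have h00 : 0 < h0 := coarse_scale_gt0 gamma n2.
have rho_h0 : rho <= h0 := rate_le_coarse_scale gamma0 n2.
pose L : R := logp n%:R; have L1 : 1 <= L := logp_ge1 _.
pose A := L `^ q1.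
have A1 : 1 <= A by rewrite -(powRr0 L) ler_powR.
have AL : logp n%:R `^ (q1 + 1) = A * L.
  rewrite -/L powRD; last by apply/implyP => _; rewrite gt_eqF// (lt_le_trans _ L1).
  by rewrite powRr1// (le_trans _ L1).
pose h j := Num.max (h0 / 2 ^+ j) rho.
have hr j : rho <= h j by rewrite le_max lexx orbT.
have hp j : 0 < h j := lt_le_trans rho0 (hr j).
have p2 j : 0 < 2 ^+ j :> R by rewrite exprn_gt0.
have hh0 j : h j <= h0.
  rewrite ge_max rho_h0 andbT ler_pdivrMr// ler_peMr ?(ltW h00)//.
  by rewrite exprn_ege1// ler1n.
have h1 j : h j <= 1 := le_trans (hh0 j) (coarse_scale_le1 gamma0 n2).
have hS j : h j.+1 <= h j <= 2 * h j.+1.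
  have e : h0 / 2 ^+ j = 2 * (h0 / 2 ^+ j.+1).
    by rewrite exprS; field; rewrite expf_neq0.
  have q0 : 0 < h0 / 2 ^+ j.+1 by rewrite divr_gt0.
  rewrite /h e; set t := h0 / _ in q0 *.
  by case: (leP t rho) => ?; case: (leP (2 * t) rho) => ?; apply/andP; split; lra.
(* [2^J > n], and [1 / n <= rho]: the dyadic scale has fallen below [rho]. *)
pose J := (trunc_log 2 n).+1.
have hJ : h J = rho.
  apply/eqP; rewrite eq_le hr andbT ge_max lexx andbT.
  apply: (@le_trans _ _ n%:R^-1); last exact: rate_ge_inv.
  rewrite ler_pdivrMr// mulrC ler_pdivlMr//.
  apply: (@le_trans _ _ n%:R); first by rewrite ler_piMl// ?(ltW N0)// (coarse_scale_le1 gamma0 n2).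
  by rewrite -natrX ler_nat ltnW// trunc_log_ltn.
have JL : J%:R <= 3 * L := trunc_log_le_logp n2.
(* The coarse parameter only has to meet the two upper bounds of the chaining lemma. *)
pose c0 : R := (4 * b + 8 * K + 1)^-1.
have cd : 0 < 4 * b + 8 * K + 1 by lra.
have c00 : 0 < c0 by rewrite invr_gt0.
have c01 : c0 <= 1 by rewrite invf_le1//; lra.
pose s j := Num.sqrt (h j `^ (- gamma) / n%:R).
have ent0 j : 0 < h j `^ (- gamma) by rewrite powR_gt0.
have s0 j : 0 < s j by rewrite sqrtr_gt0 divr_gt0.
have s1 j : s j <= 1.
  rewrite -sqrtr1 ler_wsqrtr// ler_pdivrMr// mul1r; exact: entropy_rate_le.
have hs j : h j * s j <= rho by apply: chaining_rate_le.
have s2 j : h j `^ (- gamma) / n%:R = s j ^+ 2.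
  by rewrite sqr_sqrtr// ltW// divr_gt0.
(* [lam] balances the entropy term [h^-gamma / (lam n)] against the variance term
   [lam h^2] of a link, both of order [h * s]. *)
pose lam j := if j is j'.+1 then s j / (24 * h j) else c0.
have lam0 j : 0 < lam j.
  by case: j => //= j; rewrite divr_gt0// mulr_gt0.
have ent1 j : 1 <= h j `^ (- gamma).
  by rewrite -(powRr0 (h j)) ger_powR ?hp ?h1// oppr_le0.
have ent_mono j : h j `^ (- gamma) <= h j.+1 `^ (- gamma).
  have /andP[e _] := hS j.
  by rewrite !powRN lef_pV2 ?posrE ?powR_gt0// ge0_ler_powR// nnegrE ltW.
pose H j := C1 * A * h j `^ (- gamma).
have netsH j : net F u v (2 * h j) (H j).
  apply: le_net (nets _ (hp j)); rewrite /H ler_pM2r// ler_wpM2l//.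
  have logp0 (x : R) : 0 <= logp x by exact: le_trans (logp_ge1 x).
  apply: ge0_ler_powR; rewrite ?nnegrE//; first exact: logp0.
  exact: (logp_inv_le gamma0 n2 (hr j)).
have bl : 4 * b * lam 0%N <= 1 by rewrite ler_pdivrMr//; lra.
have Kl : 8 * K * lam 0%N <= 1 by rewrite ler_pdivrMr//; lra.
have hl j : h j.+1 * lam j.+1 = s j.+1 / 24.
  by rewrite /lam; field; rewrite gt_eqF.
have el j : 12 * (2 * h j.+1) * lam j.+1 <= 1.
  rewrite (_ : _ * _ = 24 * (h j.+1 * lam j.+1)); last by ring.
  by rewrite hl; have := s1 j.+1; lra.
have eS j : 2 * h j.+1 <= 2 * h j <= 2 * (2 * h j.+1).
  by have /andP[? ?] := hS j; apply/andP; split; lra.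
have [G [mG G0 IG HG]] := @chained_risk_bound _ _ _ _ _ Pr P Q n X Y n0 samples E F u v bu bv
  loss f0 K b J (fun j => 2 * h j) H lam lossE varK loss0 Ff0 ub vb netsH eS lam0 bl Kl el.
pose c := 116 * (A * L) * rho.
have Lr : rho <= A * L * rho.
  by rewrite ler_peMl ?(ltW rho0)// mulr_ege1.
have c_ge0 : 0 <= c by rewrite /c !mulr_ge0 ?ltW// ?(lt_le_trans _ A1)// (lt_le_trans _ L1).
exists (fun w => G w + c); split.
- exact: measurable_funD.
- by move=> w; rewrite addr_ge0.
- under eq_integral do rewrite EFinD.
  rewrite ge0_integralD//; do ?[by move=> w _; rewrite lee_fin | by apply/measurable_EFinP].
  rewrite integral_cst//=; have := probability_setT Pr => ->; rewrite mule1.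
  apply: (le_trans (leeD2r _ IG)); rewrite -EFinD lee_fin AL /oracle_constant.
  have first : (H 0%N + 1) / (lam 0%N * n%:R) <= (C1 + 1) * (4 * b + 8 * K + 1) * (A * L * rho).
    rewrite invfM /lam /c0 invrK.
    have e0 : h 0%N `^ (- gamma) / n%:R <= rho.
      rewrite (_ : h 0%N = h0); first exact: coarse_entropy_le.
      by rewrite /h expr0 divr1; apply/max_idPl.
    have : (H 0%N + 1) / n%:R <= (C1 + 1) * A * rho.
      apply: (@le_trans _ _ ((C1 + 1) * A * (h 0%N `^ (- gamma) / n%:R))); last first.
        by rewrite ler_wpM2l// mulr_ge0//; lra.
      rewrite mulrA ler_pM2r ?invr_gt0// /H.
      have := ler_pM ler01 ler01 A1 (ent1 0%N); lra.
    move=> /(ler_wpM2l (ltW cd)) => T1.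
    rewrite [leLHS](_ : _ = (4 * b + 8 * K + 1) * ((H 0%N + 1) / n%:R)); last by ring.
    apply: (le_trans T1).
    have T2 : rho * A <= A * L * rho.
      rewrite (_ : A * L * rho = rho * A * L); last by ring.
      by rewrite ler_peMr// mulr_ge0 ?(ltW rho0)//; lra.
    have T3 : 0 <= (C1 + 1) * (4 * b + 8 * K + 1) by rewrite mulr_ge0//; lra.
    have := ler_wpM2l T3 T2; lra.
  have others j : (H j.+1 + H j + 1) / (lam j.+1 * n%:R) <= 24 * (2 * C1 + 1) * A * rho.
    rewrite invfM.
    have T1 : (H j.+1 + H j + 1) / n%:R <= (2 * C1 + 1) * A * s j.+1 ^+ 2.
      rewrite -s2 mulrA ler_pM2r ?invr_gt0// /H.
      have CA : 0 <= C1 * A by rewrite mulr_ge0//; lra.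
      have := ler_wpM2l CA (ent_mono j).
      have := ler_pM ler01 ler01 A1 (ent1 j.+1); lra.
    have T2 : (lam j.+1)^-1 = 24 * h j.+1 / s j.+1 by rewrite /lam invf_div.
    rewrite T2.
    have T3 : 0 <= 24 * h j.+1 / s j.+1 by rewrite divr_ge0 ?mulr_ge0// ltW.
    rewrite [leLHS](_ : _ = 24 * h j.+1 / s j.+1 * ((H j.+1 + H j + 1) / n%:R)); last by ring.
    apply: (le_trans (ler_wpM2l T3 T1)).
    rewrite [leLHS](_ : _ = 24 * (2 * C1 + 1) * A * (h j.+1 * s j.+1)); last first.
      by field; rewrite gt_eqF.
    by rewrite ler_wpM2l// !mulr_ge0//; lra.
  have sum : \sum_(j < J) (H j.+1 + H j + 1) / (lam j.+1 * n%:R) <=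
      72 * (2 * C1 + 1) * (A * L * rho).
    apply: (@le_trans _ _ (\sum_(j < J) 24 * (2 * C1 + 1) * A * rho)).
      by apply: ler_sum => j _; exact: others.
    rewrite sumr_const card_ord -[leLHS]mulr_natl.
    have T1 : 0 <= 24 * (2 * C1 + 1) * A * rho.
      by rewrite !mulr_ge0 ?(ltW rho0)//; lra.
    have := ler_wpM2r T1 JL; lra.
  rewrite /c -/rho; lra.
- move=> w f Ff erm; apply: (le_trans (HG w f Ff erm)).
  rewrite -addrA lerD2l addrC lerD2l.
  have T1 : 8 * lam 0%N * (2 * h 0%N) ^+ 2 <= 32 * (A * L * rho).
    have : h 0%N ^+ 2 <= rho.
      apply: le_trans (coarse_scale_sqr_le gamma n2).
      by rewrite lerXn2r ?nnegrE ?(ltW (hp _)) ?(ltW h00).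
    have := ler_pM (ltW c00) (sqr_ge0 (h 0%N)) c01 (lexx _).
    rewrite /lam exprMn; lra.
  have T2 : 4 * (2 * h J) <= 8 * (A * L * rho) by rewrite hJ; lra.
  have T3 : \sum_(j < J) 36 * lam j.+1 * (2 * h j.+1) ^+ 2 <= 18 * (A * L * rho).
    apply: (@le_trans _ _ (\sum_(j < J) 6 * rho)).
      apply: ler_sum => j _.
      rewrite [leLHS](_ : _ = 144 * (h j.+1 * lam j.+1) * h j.+1); last by ring.
      by rewrite hl; have := hs j.+1; lra.
    rewrite sumr_const card_ord -[leLHS]mulr_natl.
    have r6 : 0 <= 6 * rho by rewrite mulr_ge0// ltW.
    apply: (le_trans (ler_wpM2r r6 JL)).
    have : L * rho <= A * L * rho.
      by rewrite -mulrA ler_peMl// mulr_ge0 ?(ltW rho0)// (le_trans _ L1).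
    lra.
  rewrite /c; lra.
Qed.

End oracle.

(** * Euclidean geometry of row vectors *)

Section euclidean_geometry.
Context {R : realType} {d : nat}.
Implicit Types (x y z : 'rV[R]_d) (c : R).

Lemma innerC x y : inner x y = inner y x.
Proof. by apply: eq_bigr => i _; rewrite mulrC. Qed.

Lemma innerDl x y z : inner (x + y) z = inner x z + inner y z.
Proof. by rewrite /inner -big_split; apply: eq_bigr => i _; rewrite mxE mulrDl. Qed.

Lemma innerZl c x z : inner (c *: x) z = c * inner x z.
Proof. by rewrite /inner mulr_sumr; apply: eq_bigr => i _; rewrite mxE mulrA. Qed.

Lemma innerDr x y z : inner x (y + z) = inner x y + inner x z.
Proof. by rewrite innerC innerDl !(innerC x). Qed.

Lemma innerZr c x z : inner x (c *: z) = c * inner x z.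
Proof. by rewrite innerC innerZl innerC. Qed.

Lemma innerNl x z : inner (- x) z = - inner x z.
Proof. by rewrite -scaleN1r innerZl mulN1r. Qed.

Lemma innerNr x z : inner x (- z) = - inner x z.
Proof. by rewrite innerC innerNl innerC. Qed.

Lemma innerBl x y z : inner (x - y) z = inner x z - inner y z.
Proof. by rewrite innerDl innerNl. Qed.

Lemma innerBr x y z : inner x (y - z) = inner x y - inner x z.
Proof. by rewrite innerDr innerNr. Qed.

Lemma inner0l x : inner 0 x = 0.
Proof. by rewrite -(scale0r 0) innerZl mul0r. Qed.

Lemma inner_ge0 x : 0 <= inner x x.
Proof. by apply: sumr_ge0 => i _; rewrite -expr2 sqr_ge0. Qed.

Lemma enorm_ge0 x : 0 <= enorm x.
Proof. exact: sqrtr_ge0. Qed.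

Lemma enorm_sqr x : enorm x ^+ 2 = inner x x.
Proof. by rewrite sqr_sqrtr// inner_ge0. Qed.

Lemma enorm0 : enorm (0 : 'rV[R]_d) = 0.
Proof. by rewrite /enorm inner0l sqrtr0. Qed.

(** Cauchy-Schwarz, from the minimum over [t] of the squared norm of [x - t y]. *)
Lemma inner_sqr_le x y : inner x y ^+ 2 <= inner x x * inner y y.
Proof.
have [y0|y0] := eqVneq (inner y y) 0.
  have : inner x y = 0.
    have [//|xy] := eqVneq (inner x y) 0.
    have H t := inner_ge0 (x + t *: y).
    (* At this [t] the affine function [t |-> inner (x + t y) (x + t y)] is [-1]. *)
    pose t := - (inner x x + 1) / (2 * inner x y).
    move: (H t); rewrite !innerDl !innerDr !innerZl !innerZr (innerC y x) y0 /t => H1.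
    exfalso; move: H1; rewrite (_ : _ + _ = -1); last by field.
    by rewrite ler0N1.
  by move=> ->; rewrite y0 mulr0 expr0n.
have yp : 0 < inner y y by rewrite lt_neqAle eq_sym y0 inner_ge0.
have := inner_ge0 (x - (inner x y / inner y y) *: y).
rewrite !innerBl !innerBr !innerZl !innerZr (innerC y x).
set a := inner x y; set b := inner y y in y0 yp *; set c := inner x x.
rewrite (_ : _ - _ = c - a ^+ 2 / b); last by field.
by rewrite subr_ge0 ler_pdivrMr.
Qed.

Lemma normr_inner_le x y : `|inner x y| <= enorm x * enorm y.
Proof.
rewrite -[leRHS]ger0_norm ?mulr_ge0 ?enorm_ge0//.
by rewrite -[leLHS]sqrtr_sqr -[leRHS]sqrtr_sqr ler_wsqrtr// exprMn !enorm_sqr inner_sqr_le.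
Qed.

Lemma inner_le x y : inner x y <= enorm x * enorm y.
Proof. exact: le_trans (ler_norm _) (normr_inner_le x y). Qed.

Lemma enormZ c x : enorm (c *: x) = `|c| * enorm x.
Proof. by rewrite /enorm innerZl innerZr mulrA -expr2 sqrtrM ?sqr_ge0// sqrtr_sqr. Qed.

Lemma enormN x : enorm (- x) = enorm x.
Proof. by rewrite -scaleN1r enormZ normrN1 mul1r. Qed.

Lemma enorm_distC x y : enorm (x - y) = enorm (y - x).
Proof. by rewrite -enormN opprB. Qed.

Lemma enormD x y : enorm (x + y) <= enorm x + enorm y.
Proof.
rewrite -[leRHS]ger0_norm ?addr_ge0 ?enorm_ge0// -[leLHS]ger0_norm ?enorm_ge0//.
rewrite -[leLHS]sqrtr_sqr -[leRHS]sqrtr_sqr ler_wsqrtr// sqrrD !enorm_sqr.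
rewrite innerDl !innerDr (innerC y x).
by have := inner_le x y; rewrite mulr2n; lra.
Qed.

Lemma enormB x y : enorm (x - y) <= enorm x + enorm y.
Proof. by rewrite -(enormN y) enormD. Qed.

Lemma enorm_eq0 x : enorm x = 0 -> x = 0.
Proof.
move=> /eqP; rewrite sqrtr_eq0 => x0.
have {}x0 : inner x x = 0 by apply/eqP; rewrite eq_le x0 inner_ge0.
apply/rowP => i; rewrite mxE; apply/eqP; rewrite -sqrf_eq0 eq_le sqr_ge0 andbT -x0.
by rewrite /inner (bigD1 i)//= -expr2 lerDl sumr_ge0// => j _; rewrite -expr2 sqr_ge0.
Qed.

Lemma coord_le_enorm x i : `|x 0 i| <= enorm x.
Proof.
rewrite -[leLHS]sqrtr_sqr ler_wsqrtr// /inner (bigD1 i)//= -expr2 lerDl.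
by rewrite sumr_ge0// => j _; rewrite -expr2 sqr_ge0.
Qed.

Lemma enorm_le_sum x : enorm x <= \sum_i `|x 0 i|.
Proof.
rewrite -[leRHS]ger0_norm ?sumr_ge0// -sqrtr_sqr ler_wsqrtr//.
rewrite expr2 /inner mulr_suml ler_sum// => i _.
rewrite (le_trans (ler_norm _))// normrM ler_wpM2l//.
by rewrite (bigD1 i)//= lerDl sumr_ge0.
Qed.

Lemma continuous_inner x : continuous (inner x : 'rV[R]_d -> R).
Proof.
apply: continuous_big => [|i _ y]; first exact: add_continuous.
by apply: (@continuousM _ _ (fun=> x 0 i) (fun z : 'rV[R]_d => z 0 i)); [exact: cst_continuous|exact: coord_continuous].
Qed.

Lemma continuous_enorm : continuous (enorm : 'rV[R]_d -> R).
Proof.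
move=> x; apply: (@continuous_comp _ _ _ (fun y : 'rV[R]_d => inner y y) Num.sqrt); last exact: sqrt_continuous.
apply: continuous_big => [|i _ y]; first exact: add_continuous.
by apply: (@continuousM _ _ (fun z : 'rV[R]_d => z 0 i) (fun z : 'rV[R]_d => z 0 i)); exact: coord_continuous.
Qed.

Lemma open_eball x r : open (eball x r).
Proof.
have c : continuous (fun y : 'rV[R]_d => enorm (y - x)).
  move=> y; apply: (@continuous_comp _ _ _ (fun y : 'rV[R]_d => y - x) enorm).
    by apply: (@continuousB _ _ _ id (fun=> x)); [by move=> ?; exact: cvg_id|exact: cst_continuous].
  exact: continuous_enorm.
rewrite (_ : eball x r = (fun y => enorm (y - x)) @^-1` [set t | t < r])//.
by apply: open_comp => [z _|]; [exact: c|exact: open_lt].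
Qed.

End euclidean_geometry.

(** * Convex potentials with Lipschitz gradient *)

Section calculus.
Context {R : realType} {d : nat}.
Implicit Types (x y v w : 'rV[R]_d).

(** The two difference quotients are the same function. *)
Lemma is_derive_line (W : normedModType R) (f : 'rV[R]_d -> W) x v (t : R) :
  derivable f (x + t *: v) v ->
  is_derive t 1 (fun s : R => f (x + s *: v)) ('D_v f (x + t *: v)).
Proof.
move=> df.
have E : (fun h : R => h^-1 *: (((fun s : R => f (x + s *: v)) \o shift t) (h *: 1) - f (x + t *: v)))
  = (fun h : R => h^-1 *: ((f \o shift (x + t *: v)) (h *: v) - f (x + t *: v))).
  apply/funext => h /=; congr (_ *: (f _ - _)).
  by rewrite scalerDl addrCA [h%:A]mulr1.
by split; [rewrite /derivable E|rewrite /derive E].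
Qed.

Lemma derive_gradient (f : 'rV[R]_d -> R) x v : differentiable f x ->
  'D_v f x = inner (gradient f x) v.
Proof.
move=> df; rewrite deriveE// {1}(row_sum_delta v) linear_sum.
apply: eq_bigr => i _; rewrite linearZ mxE deriveE//=.
by rewrite [LHS]mulrC.
Qed.

Lemma is_derive_inner (f : 'rV[R]_d -> 'rV[R]_d) w x v : derivable f x v ->
  is_derive x v (fun y => inner w (f y)) (inner w ('D_v f x)).
Proof.
move=> df.
have E : (fun h : R => h^-1 *: (((fun y => inner w (f y)) \o shift x) (h *: v) - inner w (f x)))
  = (fun h : R => inner w (h^-1 *: ((f \o shift x) (h *: v) - f x))).
  by apply/funext => h /=; rewrite innerZr innerBr.
have C : (fun h : R => inner w (h^-1 *: ((f \o shift x) (h *: v) - f x))) @ 0^' -->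
    inner w ('D_v f x).
  exact: (@cvg_comp _ _ _ (fun h : R => h^-1 *: ((f \o shift x) (h *: v) - f x)) (inner w)
    _ _ _ df (@continuous_inner _ _ w _)).
by split; [rewrite /derivable E; apply/cvg_ex; eexists; exact: C|rewrite /derive E; exact/cvg_lim].
Qed.

(** The mean value theorem along a segment. *)
Lemma mvt_line (f : 'rV[R]_d -> R) (df : 'rV[R]_d -> R) x v :
  (forall t : R, 0 <= t <= 1 -> is_derive (x + t *: v) v f (df (x + t *: v))) ->
  exists2 c : R, 0 < c < 1 & f (x + v) - f x = df (x + c *: v).
Proof.
move=> H; pose g (t : R) := f (x + t *: v).
have dg (t : R) : 0 <= t <= 1 -> is_derive t 1 g (df (x + t *: v)).
  move=> t01; have D := H t t01; rewrite -(@derive_val _ _ _ _ _ _ _ D).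
  by apply: is_derive_line; exact: ex_derive.
have [||c] := @MVT R g (fun t => df (x + t *: v)) 0 1 ltr01.
- by move=> t; rewrite in_itv/= => /andP[t0 t1]; apply: dg; rewrite !ltW.
- apply: derivable_within_continuous => t; rewrite in_itv/= => t01.
  by have D := dg t t01; exact: ex_derive.
rewrite in_itv/= => c01; rewrite /g scale1r scale0r addr0 subr0 mulr1 => E.
by exists c.
Qed.

Lemma opnorm_ubound (A : 'M[R]_d) v : enorm v <= 1 -> enorm (v *m A) <= opnorm A.
Proof.
move=> v1; apply: ub_le_sup; last by exists v.
exists (\sum_j \sum_i `|A i j|) => _ [u u1 <-].
apply: (le_trans (enorm_le_sum _)); apply: ler_sum => j _; rewrite mxE.
apply: (le_trans (ler_norm_sum _ _ _)); apply: ler_sum => i _.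
by rewrite normrM ler_piMl// (le_trans (coord_le_enorm _ _)).
Qed.

Lemma enorm_mulmx_le (A : 'M[R]_d) v : enorm (v *m A) <= opnorm A * enorm v.
Proof.
have [v0|v0] := eqVneq (enorm v) 0.
  by rewrite (enorm_eq0 v0) mul0mx enorm0 mulr0.
have vp : 0 < enorm v by rewrite lt_neqAle eq_sym v0 enorm_ge0.
have := @opnorm_ubound A ((enorm v)^-1 *: v).
rewrite enormZ ger0_norm ?invr_ge0 ?enorm_ge0// mulVf// lexx => /(_ isT).
rewrite -scalemxAl enormZ ger0_norm ?invr_ge0 ?enorm_ge0// mulrC.
by rewrite ler_pdivrMr.
Qed.

(** Pairing [f] with the fixed vector [f y - f x] reduces the claim to the scalar mean value
    theorem. *)
Lemma jacobian_lipschitz (f : 'rV[R]_d -> 'rV[R]_d) (B : R) x y :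
  (forall t : R, 0 <= t <= 1 -> differentiable f (x + t *: (y - x)) /\
     opnorm ('J f (x + t *: (y - x))) <= B) ->
  enorm (f y - f x) <= B * enorm (y - x).
Proof.
move=> H; set w := f y - f x; set v := y - x in H *.
have [|c /andP[c0 c1]] := @mvt_line (fun z => inner w (f z)) (fun z => inner w ('D_v f z)) x v.
  by move=> t t01; apply: is_derive_inner; apply: diff_derivable; have [] := H t t01.
have -> : x + v = y by rewrite addrC subrK.
rewrite -innerBr -/w -enorm_sqr => E.
have [df op] := H c (ltac:(by rewrite !ltW)).
have : enorm w ^+ 2 <= enorm w * (B * enorm v).
  rewrite E deriveEjacobian//; apply: (le_trans (inner_le _ _)).
  rewrite ler_wpM2l ?enorm_ge0//; apply: (le_trans (enorm_mulmx_le _ _)).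
  by rewrite ler_wpM2r ?enorm_ge0.
have [->|w0] := eqVneq (enorm w) 0.
  by move=> _; apply: (le_trans _ (@mulr_ge0 _ B (enorm v) _ _)); rewrite ?enorm_ge0//;
    apply: le_trans op; apply: le_trans (opnorm_ubound _ (v := 0) _);
    rewrite ?mul0mx ?enorm0.
by rewrite expr2 ler_pM2l// lt_neqAle eq_sym w0 enorm_ge0.
Qed.

End calculus.

Section potentials.
Context {R : realType} {d : nat}.
Implicit Types (phi : 'rV[R]_d -> \bar R) (x y v w : 'rV[R]_d).

Lemma convex_dom phi x y (t : R) : convex phi -> 0 <= t <= 1 ->
  dom phi x -> dom phi y -> dom phi (t *: x + (1 - t) *: y).
Proof.
move=> cphi t01 dx dy; apply: (le_lt_trans (cphi x y t t01)).
have H (s : R) z : 0 <= s -> dom phi z -> (s%:E * phi z < +oo)%E.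
  move=> s0; rewrite /dom/=; case: (phi z) => [a|//|] _; first by rewrite -EFinM ltry.
  have [->|sn] := eqVneq s 0; first by rewrite mul0e.
  have sp : (0 < s%:E)%E by rewrite lte_fin lt_neqAle eq_sym sn.
  by rewrite gt0_muleNy.
have /andP[t0 t1] := t01.
by apply: lte_add_pinfty; apply: H => //; rewrite subr_ge0.
Qed.

Lemma dom_segment phi x y (t : R) : convex phi -> 0 <= t <= 1 ->
  dom phi x -> dom phi y -> dom phi (x + t *: (y - x)).
Proof.
move=> cphi /andP[t0 t1] dx dy.
rewrite (_ : x + _ = (1 - t) *: x + (1 - (1 - t)) *: y); last first.
  by apply/rowP => i; rewrite !mxE; ring.
by apply: convex_dom => //; lra.
Qed.

Lemma dom_fineK phi x : potential phi -> dom phi x -> (fine (phi x))%:E = phi x.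
Proof. by move=> [nN _] dx; rewrite fineK// fin_numE nN lt_eqF. Qed.

Lemma nablaE phi x : dom phi x -> nabla phi x = gradient (fine \o phi) x.
Proof. by move=> dx; rewrite /nabla mem_set. Qed.

(** By convexity the difference quotients from the right are at most the increment to [y]. *)
Lemma subgradient phi x y : potential phi -> convex phi -> dom phi x ->
  differentiable (fine \o phi) x ->
  ((fine (phi x) + inner (nabla phi x) (y - x))%:E <= phi y)%E.
Proof.
move=> pphi cphi dx df.
have [dy|] := pselect (dom phi y); last first.
  by move/negP; rewrite -leNgt leye_eq => /eqP ->; exact: leey.
rewrite -(dom_fineK pphi dy) lee_fin -lerBrDl nablaE// -derive_gradient//.
set f := fine \o phi in df *; set v := y - x.
have dv : derivable f x v by exact: diff_derivable.
rewrite -/(f x) -/(f y).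
have cv := cvg_dnbhs_at_right (dv : (fun h : R => h^-1 *: ((f \o shift x) (h *: v) - f x)) @ 0^' --> _).
rewrite -[X in X <= _](cvg_lim _ cv)//; apply: limr_le; first by apply/cvg_ex; eexists; exact: cv.
near=> h; have h0 : 0 < h by near: h; exact: nbhs_right_gt.
have h1 : h <= 1 by near: h; apply: nbhs_right_le.
rewrite /= [X in X <= _](_ : _ = h^-1 * (f (h *: v + x) - f x))//.
rewrite mulrC ler_pdivrMr//.
have := cphi y x h (ltac:(by rewrite (ltW h0) h1)).
rewrite (_ : h *: y + _ = h *: v + x); last by apply/rowP => i; rewrite !mxE; ring.
have dh : dom phi (h *: v + x).
  by rewrite addrC; apply: dom_segment => //; rewrite (ltW h0).
rewrite -(dom_fineK pphi dh) -(dom_fineK pphi dx) -(dom_fineK pphi dy).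
rewrite -!EFinM -EFinD lee_fin /f /=; lra.
Unshelve. all: by end_near. Qed.

Lemma nabla_lipschitz phi (beta a rho : R) x y : 0 <= beta -> 0 <= a ->
  smooth beta a phi -> convex phi -> dom phi x -> dom phi y ->
  enorm x <= rho -> enorm y <= rho ->
  enorm (nabla phi y - nabla phi x) <= beta * (1 + rho) `^ a * enorm (y - x).
Proof.
move=> beta0 a0 [_ _ [H|[-> H]]] cphi dx dy xr yr; last by rewrite powRr0 mulr1 H.
have rho0 : 0 <= rho by exact: le_trans (enorm_ge0 x) xr.
(* The segment stays in the ball of radius [rho], where the bracket is at most [1 + rho]. *)
apply: jacobian_lipschitz => t t01.
have [dn op] := H _ (dom_segment cphi t01 dx dy).
split => //; apply: (le_trans op); rewrite ler_wpM2l// /bracket.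
have e0 := enorm_ge0 (x + t *: (y - x)).
apply: ge0_ler_powR; rewrite ?nnegrE//; [lra|lra|].
rewrite lerD2l (_ : x + _ = (1 - t) *: x + t *: y); last first.
  by apply/rowP => i; rewrite !mxE; ring.
have /andP[t0 t1] := t01; have t1' : 0 <= 1 - t by lra.
apply: (le_trans (enormD _ _)); rewrite !enormZ !ger0_norm//.
have := ler_wpM2l t0 yr; have := ler_wpM2l t1' xr; lra.
Qed.

(** One application of the mean value theorem; it loses a factor 2 against the Taylor bound. *)
Lemma descent phi (beta a rho : R) x y : 0 <= beta -> 0 <= a ->
  smooth beta a phi -> convex phi -> dom phi x -> dom phi y ->
  enorm x <= rho -> enorm y <= rho ->
  fine (phi y) <= fine (phi x) + inner (nabla phi x) (y - x)
                  + beta * (1 + rho) `^ a * enorm (y - x) ^+ 2.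
Proof.
move=> beta0 a0 sphi cphi dx dy xr yr; have [_ df _] := sphi.
set v := y - x; set B := beta * _.
have [|c /andP[c0 c1]] := @mvt_line _ _ (fine \o phi) (fun z => inner (nabla phi z) v) x v.
  move=> t t01; have dt := dom_segment cphi t01 dx dy.
  apply: DeriveDef; first exact/diff_derivable/df.
  by rewrite derive_gradient; [rewrite nablaE|exact: df].
have -> : x + v = y by rewrite addrC subrK.
rewrite /=; set z := x + c *: v => E.
have dz : dom phi z by apply: dom_segment => //; rewrite !ltW.
have rho0 : 0 <= rho by exact: le_trans (enorm_ge0 x) xr.
have c1' : 0 <= 1 - c by lra.
have zr : enorm z <= rho.
  rewrite /z (_ : x + _ = (1 - c) *: x + c *: y); last first.
    by apply/rowP => i; rewrite !mxE; ring.
  apply: (le_trans (enormD _ _)); rewrite !enormZ !ger0_norm ?(ltW c0)//.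
  have := ler_wpM2l (ltW c0) yr; have := ler_wpM2l c1' xr; lra.
have B0 : 0 <= B by rewrite mulr_ge0// powR_ge0.
have v0 := enorm_ge0 v.
have L := nabla_lipschitz beta0 a0 sphi cphi dx dz xr zr.
have I := inner_le (nabla phi z - nabla phi x) v.
have zx : enorm (z - x) <= enorm v.
  by rewrite /z addrAC subrr add0r enormZ ger0_norm ?(ltW c0)// ler_piMl// ltW.
have : enorm (nabla phi z - nabla phi x) * enorm v <= B * enorm v ^+ 2.
  rewrite expr2 mulrA ler_wpM2r//; apply: (le_trans L); exact: ler_wpM2l.
move: I; rewrite innerBl; lra.
Qed.

End potentials.

(** * Borel measurability, null sets and the support *)

Lemma measurable_fun_mem {d : measure_display} {T : measurableType d} (A : set T) :
  measurable A -> measurable_fun setT (fun x => x \in A).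
Proof.
move=> mA; apply: (@measurable_fun_bool _ _ _ _ true); rewrite setTI.
rewrite (_ : _ @^-1` _ = A)//.
by apply/seteqP; split => x /= xA; [exact: set_mem|exact: mem_set].
Qed.

Section nonmeasurable_integrands.
Context {d : measure_display} {T : measurableType d} {R : realType}.
Variable mu : {measure set T -> \bar R}.
Local Open Scope ereal_scope.
Import HBNNSimple.

(** The integral of a nonnegative function is a supremum over the simple functions below it, so
    it is monotone. This is how a risk that depends on the minimizer is compared with a
    measurable bound. *)
Lemma ge0_le_integral_nonmeasurable (f g : T -> \bar R) :
  (forall x, 0 <= f x) -> (forall x, f x <= g x) ->
  \int[mu]_x f x <= \int[mu]_x g x.
Proof.
move=> f0 fg; have g0 x : 0 <= g x := le_trans (f0 x) (fg x).
rewrite !ge0_integralTE//; apply: ereal_sup_le => _ [h hf <-].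
exists h => // x.
exact: le_trans (hf x) (fg x).
Qed.

Lemma ae_le_integral_nonmeasurable (N : set T) (f g : T -> \bar R) :
  measurable N -> mu N = 0 -> (forall x, 0 <= f x) ->
  measurable_fun setT g -> (forall x, 0 <= g x) ->
  (forall x, ~ N x -> f x <= g x) -> \int[mu]_x f x <= \int[mu]_x g x.
Proof.
move=> mN N0 f0 mg g0 fg; (* Raising [g] to [+oo] on the null set makes the comparison hold everywhere. *)
pose g' x := if x \in N then +oo else g x.
have mg' : measurable_fun setT g'.
  by apply: measurable_fun_ifT => //; exact: measurable_fun_mem.
have g'0 x : 0 <= g' x by rewrite /g'; case: ifP.
rewrite (@ge0_ae_eq_integral _ _ _ mu setT g g')//; last first.
  exists N; split => // x /= /not_implyP[_]; rewrite /g'.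
  by case: ifPn => //; rewrite inE.
apply: ge0_le_integral_nonmeasurable => // x.
rewrite /g'; case: ifPn => [_|]; first exact: leey.
by rewrite notin_setE; exact: fg.
Qed.

End nonmeasurable_integrands.

Section almost_sure_equality.
Context {d : measure_display} {T : measurableType d} {R : realType}.
Variables (P : probability T R) (S : set T).
Hypotheses (mS : measurable S) (PS : P S = 1%E).

Lemma full_setC : P (~` S) = 0%E.
Proof. by rewrite probability_setC// PS subee. Qed.

Lemma integral_full_set (f g : T -> \bar R) : measurable_fun setT f -> measurable_fun setT g ->
  (forall x, S x -> f x = g x) -> (\int[P]_x f x = \int[P]_x g x)%E.
Proof.
move=> mf mg fg; apply: ae_eq_integral => //.
exists (~` S); split; [exact: measurableC|exact: full_setC|].
by move=> x /= /not_implyP[_] fgx Sx; apply: fgx; exact: fg.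
Qed.

Lemma mean_full_set (f g : T -> R) : measurable_fun setT f -> measurable_fun setT g ->
  (forall x, S x -> f x = g x) -> mean P f = mean P g.
Proof.
move=> mf mg fg; congr fine; apply: integral_full_set.
- exact/measurable_EFinP.
- exact/measurable_EFinP.
- by move=> x Sx; rewrite fg.
Qed.

End almost_sure_equality.

Section borel.
Context {R : realType} {d : nat}.
Local Notation V := 'rV[R]_d.
Local Notation B := (borel_rV R d).

Lemma measurable_open_rV (A : set V) : open A -> measurable (A : set B).
Proof. by move=> oA; apply: sub_sigma_algebra. Qed.

Lemma measurable_eball (x : V) (r : R) : measurable (eball x r : set B).
Proof. by apply: measurable_open_rV; exact: open_eball. Qed.

(** The Euclidean norm dominates the sup norm, which defines the topology. *)
Lemma eball_nbhs (x : V) (A : set V) : nbhs x A -> exists2 e : R, 0 < e & eball x e `<=` A.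
Proof.
move=> /nbhs_ballP[e e0 xA]; exists e => // y xy; apply: xA; split => // i j.
rewrite /ball/= (ord1 i) -normrN opprB; apply: le_lt_trans xy.
by have := coord_le_enorm (y - x) j; rewrite !mxE.
Qed.

Lemma nbhs_eball (x : V) (e : R) : 0 < e -> nbhs x (eball x e).
Proof. by move=> e0; apply: open_nbhs_nbhs; split; [exact: open_eball|rewrite /eball/= subrr enorm0]. Qed.

Lemma lsc_measurable (f : V -> \bar R) :
  (forall c : R, open [set x | (c%:E < f x)%E]) -> measurable_fun (setT : set B) f.
Proof.
move=> H; apply: (measurability _ (ErealGenOInfty.measurableE R)).
move=> _ [_ [c ->] <-]; rewrite setTI; apply: measurable_open_rV.
rewrite (_ : _ @^-1` _ = [set x | (c%:E < f x)%E]); first exact: H.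
by apply/seteqP; split => x /=; rewrite in_itv/= andbT.
Qed.

Lemma continuous_measurable (f : V -> R) : continuous f -> measurable_fun (setT : set B) f.
Proof.
move=> cf; apply/(@measurable_EFinP _ B); apply: lsc_measurable => c.
rewrite (_ : mkset _ = f @^-1` [set t | c < t]).
  by apply: open_comp => [x _|]; [exact: cf|exact: open_gt].
by apply/seteqP; split => x /=; rewrite lte_fin.
Qed.

Lemma patched_measurable (U : set V) (f : V -> \bar R) (b : \bar R) :
  open U -> (forall x, ~ U x -> f x = b) ->
  (forall c : R, open (U `&` [set x | (c%:E < f x)%E])) ->
  measurable_fun (setT : set B) f.
Proof.
move=> oU fb H; apply: (measurability _ (ErealGenOInfty.measurableE R)).
move=> _ [_ [c ->] <-]; rewrite setTI.
rewrite (_ : _ @^-1` _ = (U `&` [set x | (c%:E < f x)%E]) `|`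
    (if (c%:E < b)%E then ~` U else set0)).
  apply: (@measurableU _ B); first exact: measurable_open_rV.
  case: ifP => _; last exact: (@measurable0 _ B).
  by apply: (@measurableC _ B); exact: measurable_open_rV.
apply/seteqP; split => x /=; rewrite in_itv/= andbT.
  move=> cfx; have [Ux|nUx] := pselect (U x); first by left.
  by right; move: cfx; rewrite (fb x nUx) => ->.
by move=> [[]//|]; case: ifP => // cb nUx; rewrite (fb x nUx).
Qed.

Lemma measurable_vector_fun (U : set V) (f : V -> V) :
  open U -> (forall x, U x -> {for x, continuous f}) -> (forall x, ~ U x -> f x = 0) ->
  measurable_fun (setT : set B) (f : B -> B).
Proof.
move=> oU cf f0; apply: (@measurability _ _ B B setT f (@open V)) => //.
move=> _ [A oA <-]; rewrite setTI.
rewrite (_ : f @^-1` A = (U `&` f @^-1` A) `|` (if 0 \in A then ~` U else set0)).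
  apply: (@measurableU _ B).
    apply: measurable_open_rV; rewrite openE => x [Ux Ax].
    apply: filterI; first exact: open_nbhs_nbhs.
    by apply: cf => //; exact: open_nbhs_nbhs.
  case: ifP => _; last exact: (@measurable0 _ B).
  by apply: (@measurableC _ B); exact: measurable_open_rV.
apply/seteqP; split => x /=.
  move=> Afx; have [Ux|nUx] := pselect (U x); first by left.
  by right; move: Afx; rewrite (f0 x nUx) => A0; rewrite mem_set.
by move=> [[]//|]; case: ifPn => // /[!inE] A0 nUx; rewrite (f0 x nUx).
Qed.

Variable P : probability B R.

Lemma open_msupportC : open (~` msupport P).
Proof.
rewrite openE => x /existsNP[e /not_implyP[e0 /negP]]; rewrite -leNgt => xe.
have e2 : 0 < e / 2 by rewrite divr_gt0.
apply: (filterS _ (nbhs_eball x e2)) => y xy /(_ _ e2); apply/negP; rewrite -leNgt.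
apply: le_trans xe; apply: le_measure; rewrite ?inE.
- exact: measurable_eball.
- exact: measurable_eball.
- move=> z yz; have := enormD (z - y) (y - x); rewrite addrA subrK.
  by move: xy yz; rewrite /eball/=; lra.
Qed.

Lemma measurable_msupport : measurable (msupport P : set B).
Proof.
rewrite -[msupport P]setCK; apply: (@measurableC _ B).
by apply: measurable_open_rV; exact: open_msupportC.
Qed.

(** Rational centers and inverse integer radii give a countable basis of the topology. *)
Definition rational_cube (qk : 'rV[rat]_d * nat) : set V :=
  [set y | forall i, `|y 0 i - ratr (qk.1 0 i)| < qk.2.+1%:R^-1].

Lemma rational_cube_approx (x : V) (e : R) : 0 < e ->
  exists2 qk, rational_cube qk x & rational_cube qk `<=` eball x e.
Proof.
move=> e0; pose k := Num.truncn (2 * d%:R / e).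
have k0 : 0 < k.+1%:R^-1 :> R by rewrite invr_gt0.
have ke : d%:R * (2 * k.+1%:R^-1) < e.
  have : 2 * d%:R / e < k.+1%:R by apply: real_truncnS_gt; rewrite num_real.
  have : 2 * d%:R / e < k.+1%:R by apply: real_truncnS_gt; exact: num_real.
  by rewrite ltr_pdivrMr// => ?; rewrite mulrA (mulrC d%:R) ltr_pdivrMr// [ltRHS]mulrC.
have /choice[q qx] : forall i : 'I_d, exists q : rat, `|x 0 i - ratr q| < k.+1%:R^-1.
  move=> i; have /rat_in_itvoo[q] : x 0 i < x 0 i + k.+1%:R^-1 by rewrite ltrDl.
  rewrite in_itv/= => /andP[q1 q2]; exists q; move: q1 q2 k0.
  set c := k.+1%:R^-1; set z := x 0 i; set s := ratr q => q1 q2 c0.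
  by rewrite ltr_norml; apply/andP; split; lra.
exists (\row_i q i, k) => [i|y yq]; first by rewrite mxE.
rewrite /eball/=; apply: (le_lt_trans (enorm_le_sum _)); apply: le_lt_trans ke.
rewrite -[X in X%:R * _]card_ord mulr_natl -sumr_const; apply: ler_sum => i _.
rewrite !mxE (_ : y 0 i - x 0 i = (y 0 i - ratr (q i)) - (x 0 i - ratr (q i))); last by ring.
apply: (le_trans (ler_normB _ _)).
have h1 : `|y 0 i - ratr (q i)| < k.+1%:R^-1 by have := yq i; rewrite /= mxE.
move: h1 (qx i); set c := k.+1%:R^-1 => h1 h2; lra.
Qed.

Lemma measurable_rational_cube qk : measurable (rational_cube qk : set B).
Proof.
rewrite (_ : rational_cube qk =
    \bigcap_(i in [set: 'I_d]) [set y : V | `|y 0 i - ratr (qk.1 0 i)| < qk.2.+1%:R^-1]).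
  apply: (@fin_bigcap_measurable _ B) => [|i _]; first exact: finite_finset.
  apply: measurable_open_rV.
  rewrite (_ : mkset _ = (fun y : V => `|y 0 i - ratr (qk.1 0 i)|) @^-1` [set t | t < qk.2.+1%:R^-1])//.
  apply: open_comp => [y _|]; last exact: open_lt.
  apply: (@continuous_comp _ _ _ (fun y : V => y 0 i - ratr (qk.1 0 i)) (@Num.norm _ _)).
    by apply: (@continuousB _ _ _ (fun y : V => y 0 i) (fun=> ratr (qk.1 0 i)));
      [exact: coord_continuous|exact: cst_continuous].
  exact: norm_continuous.
by apply/seteqP; split => y /= yq i; [move=> _; exact: yq|exact: (yq i I)].
Qed.

(** Every point off the support has a null rational cube around it, and there are countably many
    of them. *)
Lemma msupport_full : P (msupport P) = 1%E.
Proof.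
(* The null rational cubes are countably many and cover the complement of the support. *)
pose N (m : nat) : set B := if unpickle m is Some qk then
  (if P (rational_cube qk) == 0%E then rational_cube qk else set0) else set0.
have nN m : P.-negligible (N m).
  rewrite /N; case: (unpickle m) => [qk|]; last exact: negligible_set0.
  case: ifPn => [/eqP qk0|_]; last exact: negligible_set0.
  by exists (rational_cube qk); split => //; exact: measurable_rational_cube.
have : P.-negligible (~` msupport P).
  apply: negligibleS (negligible_bigcup nN) => x /existsNP[e /not_implyP[e0 /negP]].
  rewrite -leNgt => xe.
  have [qk xqk qke] := rational_cube_approx x e0.
  exists (pickle qk) => //; rewrite /N pickleK ifT//; apply/eqP.
  apply/eqP; rewrite eq_le measure_ge0 andbT; apply: le_trans xe.
  apply: le_measure => //; rewrite ?inE; first exact: measurable_rational_cube.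
  exact: measurable_eball.
move=> /(negligibleP _ (measurableC measurable_msupport)) H.
have := probability_setC P (measurableC measurable_msupport).
by rewrite setCK H sube0.
Qed.

End borel.

(** * The Poincare inequality on a ball *)

(** The zero map satisfies the expansion that characterizes the differential. *)
Lemma differentiable_near0 {R : realType} {V W : normedModType R} (f : V -> W) (x : V) :
  (\forall y \near x, f y = 0) -> differentiable f x.
Proof.
move=> f0; have fx : f x = 0 by exact: nbhs_singleton f0.
have key : f \o shift x = cst (f x) + (\0 : {linear V -> W}) +o_ 0 id.
  apply/eqaddoP => _/posnumP[e].
  have : \forall h \near (0 : V), f (h + x) = 0.
    by move/nbhs0P : f0; apply: filterS => h; rewrite addrC.
  apply: filterS => h fh.
  rewrite /= [X in `|X|](_ : _ = 0) ?normr0 ?mulr_ge0//.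
  by change (f (h + x) - (f x + 0) = 0); rewrite fh fx addr0 subr0.
have c0 : continuous ((\0 : {linear V -> W}) : V -> W) by exact: cst_continuous.
by apply/diff_locallyP; rewrite (diff_unique c0 key).
Qed.

Section cutoff.
Context {R : realType}.

Definition sqpos (u : R) : R := Num.max 0 u ^+ 2.

(** A first-order expansion uniform in [u]: it gives the derivative without separating the signs. *)
Lemma sqpos_remainder (u h : R) :
  `|sqpos (u + h) - sqpos u - 2 * Num.max 0 u * h| <= h ^+ 2.
Proof.
rewrite /sqpos ler_norml.
by case: (leP 0 (u + h)) => ?; case: (leP 0 u) => ?; apply/andP; split; nra.
Qed.

Lemma differentiable_sqpos (u : R) : differentiable sqpos u.
Proof.
apply/derivable1_diffP/cvg_ex; exists (2 * Num.max 0 u) => /=.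
apply/cvgrPdist_le => e e0; near=> h.
have h0 : h != 0 by near: h; exact: nbhs_dnbhs_neq.
have he : `|h| <= e by near: h; exact: dnbhs0_le.
rewrite [X in `|X|](_ : _ = - (h^-1 * (sqpos (u + h) - sqpos u - 2 * Num.max 0 u * h))); last first.
  rewrite [h%:A]mulr1 (addrC h u) /GRing.scale/=.
  by set p := sqpos (u + h); set q := sqpos u; set m := Num.max 0 u; field.
rewrite normrN normrM normfV; apply: le_trans he.
rewrite mulrC ler_pdivrMr ?normr_gt0// -expr2 real_normK ?num_real//.
exact: sqpos_remainder.
Unshelve. all: by end_near. Qed.

(** A differentiable step, 0 on the negative half-line and 1 beyond 1. *)
Definition step (u : R) : R := 1 - sqpos (1 - sqpos u).

Lemma step_ge1 (u : R) : 1 <= u -> step u = 1.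
Proof.
move=> u1; have u2 : 1 <= sqpos u.
  by rewrite /sqpos (max_idPr _) ?exprn_ege1//; apply: le_trans u1.
by rewrite /step /sqpos (max_idPl _) ?expr0n ?subr0// subr_le0.
Qed.

Lemma step_le0 (u : R) : u <= 0 -> step u = 0.
Proof.
move=> u0; rewrite /step /sqpos (max_idPl u0) expr0n/= subr0 (max_idPr _)//.
by rewrite expr1n subrr.
Qed.

Lemma differentiable_step (u : R) : differentiable step u.
Proof.
apply: differentiableB; first exact: differentiable_cst.
apply: (differentiable_comp (f := fun v => 1 - sqpos v) (g := sqpos)); last exact: differentiable_sqpos.
by apply: differentiableB; [exact: differentiable_cst|exact: differentiable_sqpos].
Qed.

Lemma step_bounds (u : R) : `|step u| <= 1.
Proof.
rewrite ler_norml /step /sqpos.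
by case: (leP 0 u) => ?; case: (leP 0 (1 - _)) => ?; apply/andP; split; nra.
Qed.

Context {d : nat}.

Lemma differentiable_inner_self (x : 'rV[R]_d) : differentiable (fun y : 'rV[R]_d => inner y y) x.
Proof.
rewrite (_ : (fun y => _) = \sum_i (fun y : 'rV[R]_d => y 0 i * y 0 i)); last first.
  by apply/funext => y; rewrite fct_sumE.
by apply: differentiable_sum => i; apply: differentiableM; exact: differentiable_coord.
Qed.

(** Equal to 1 where [|x|^2 <= 2 r^2] and to 0 where [|x|^2 >= 3 r^2], which leaves margins both
    around the support, in the ball of radius [r], and inside the domain, of radius [2 r]. *)
Definition ball_cutoff (r : R) (x : 'rV[R]_d) : R := step (3 - r ^- 2 * inner x x).

Lemma differentiable_ball_cutoff (r : R) (x : 'rV[R]_d) : differentiable (ball_cutoff r) x.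
Proof.
apply: (differentiable_comp (f := fun y : 'rV[R]_d => 3 - r ^- 2 * inner y y) (g := step)); last exact: differentiable_step.
apply: differentiableB; first exact: differentiable_cst.
by apply: differentiableM; [exact: differentiable_cst|exact: differentiable_inner_self].
Qed.

End cutoff.

Section poincare_on_ball.
Context {R : realType} {d : nat}.
Local Notation B := (borel_rV R d).
Variables (P : probability B R) (CPI r : R).
Hypotheses (r0 : 0 < r) (PI : poincare P CPI) (CPI0 : 0 <= CPI).

Lemma variance_var (f : B -> R) : bdmeas f -> ('V_P[f] = (var P f)%:E)%E.
Proof.
move=> bf; rewrite /variance unlock ![in LHS]unlock meanE; last first.
  by apply/bdmeas_sqr/bdmeasB => //; exact: bdmeas_cst.
by apply: eq_integral => x _.
Qed.

Hypothesis supp : forall x, msupport P x -> enorm x <= r.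

(** The Poincare inequality is assumed for functions differentiable everywhere. A cutoff extends
    to them any [w] differentiable on the ball of radius [2 r], without a change near the support. *)
Lemma poincare_ball (S : set B) (w : 'rV[R]_d -> R) (g : B -> \bar R) :
  measurable S -> P S = 1%E -> S `<=` msupport P ->
  bdmeas (w : B -> R) -> (forall x, enorm x < 2 * r -> differentiable w x) ->
  (forall x, ~ (enorm x < 2 * r) -> w x = 0) ->
  measurable_fun setT g -> (forall x, 0 <= g x)%E ->
  (forall x, S x -> (enorm (gradient w x) ^+ 2)%:E <= g x)%E ->
  ((var P w)%:E <= CPI%:E * \int[P]_x g x)%E.
Proof.
move=> mS PS Ssupp bw dw w0 mg g0 wg.
pose f x := ball_cutoff r x * w x.
have r2 : 0 < r ^+ 2 by rewrite exprn_gt0.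
have inner_scaled x : r ^- 2 * inner x x = enorm x ^+ 2 / r ^+ 2 by rewrite enorm_sqr mulrC.
have open_level (a : R) : open [set x : 'rV[R]_d | inner x x < a].
  rewrite (_ : mkset _ = (fun x : 'rV[R]_d => inner x x) @^-1` [set t | t < a])//.
  apply: open_comp => [x _|]; last exact: open_lt.
  exact/differentiable_continuous/differentiable_inner_self.
have open_level' (a : R) : open [set x : 'rV[R]_d | a < inner x x].
  rewrite (_ : mkset _ = (fun x : 'rV[R]_d => inner x x) @^-1` [set t | a < t])//.
  apply: open_comp => [x _|]; last exact: open_gt.
  exact/differentiable_continuous/differentiable_inner_self.
have f_in x : inner x x < 2 * r ^+ 2 -> f x = w x.
  move=> xr; rewrite /f /ball_cutoff step_ge1 ?mul1r//.
  have : r ^- 2 * inner x x <= 2 by rewrite mulrC ler_pdivrMr// ltW.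
  lra.
have f_out x : 3 * r ^+ 2 < inner x x -> f x = 0.
  move=> xr; rewrite /f /ball_cutoff step_le0 ?mul0r//.
  have : 3 <= r ^- 2 * inner x x by rewrite mulrC ler_pdivlMr// ltW.
  lra.
have df x : differentiable f x.
  have [xr|xr] := ltP (enorm x) (2 * r).
    by apply: differentiableM; [exact: differentiable_ball_cutoff|exact: dw].
  apply: differentiable_near0.
  have : \forall y \near x, 3 * r ^+ 2 < inner y y.
    apply: (open_nbhs_nbhs (p := x)); split; first exact: open_level'.
    rewrite /= -enorm_sqr; have := lerXn2r 2 _ _ xr.
    rewrite !nnegrE enorm_ge0 mulr_ge0 ?(ltW r0)// => /(_ isT isT).
    rewrite exprMn; lra.
  by apply: filterS => y; exact: f_out.
(* [2 * r ^+ 2] exceeds [r ^+ 2], so the cutoff is 1 on a neighbourhood of [S] and the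
   gradients of [f] and [w] agree there. *)
have S_level x : S x -> inner x x < 2 * r ^+ 2.
  move=> /Ssupp/supp xr; have := lerXn2r 2 _ _ xr.
  rewrite !nnegrE enorm_ge0 (ltW r0) enorm_sqr => /(_ isT isT); lra.
have gradE x : S x -> gradient f x = gradient w x.
  move=> Sx; apply/rowP => i; rewrite !mxE; apply: near_eq_derive.
  have : \forall y \near x, inner y y < 2 * r ^+ 2.
    by apply: (open_nbhs_nbhs (p := x)); split; [exact: open_level|exact: S_level].
  by apply: filterS => y; exact: f_in.
have bf : bdmeas (f : B -> R).
  apply: bdmeasM => //; split; last by exists 1 => x; exact: step_bounds.
  apply: continuous_measurable => x.
  exact/differentiable_continuous/differentiable_ball_cutoff.
have -> : var P w = var P f.
  have [[mf _] [mw _]] := (bf, bw).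
  have mE : mean P w = mean P f.
    by apply: (mean_full_set mS PS mw mf) => x Sx; rewrite f_in//; exact: S_level.
  rewrite /var mE; apply: (mean_full_set mS PS).
  - by apply: (measurable_funX 2); apply: measurable_funB.
  - by apply: (measurable_funX 2); apply: measurable_funB.
  - by move=> x Sx; rewrite f_in//; exact: S_level.
rewrite -variance_var//; apply: (le_trans (PI df)).
apply: lee_wpmul2l; first by rewrite lee_fin.
apply: (@ae_le_integral_nonmeasurable _ _ _ P (~` S)) => //.
- exact: measurableC.
- exact: full_setC.
- by move=> x; rewrite lee_fin sqr_ge0.
- by move=> x /contrapT Sx; rewrite gradE//; exact: wg.
Qed.

End poincare_on_ball.

(** * Conjugates and the Fenchel gap *)

Section conjugates.
Context {R : realType} {d : nat}.
Local Notation V := 'rV[R]_d.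
Local Notation B := (borel_rV R d).
Implicit Types (phi psi : V -> \bar R) (x y : V).

Lemma fenchel_young phi x y : ((inner x y)%:E - phi x <= conjugate phi y)%E.
Proof. by apply: ereal_sup_ubound; exists x. Qed.

Lemma conjugate_le phi y (c : \bar R) :
  (forall x, (inner x y)%:E - phi x <= c)%E -> (conjugate phi y <= c)%E.
Proof. by move=> H; apply: ge_ereal_sup => _ [x _ <-]. Qed.

(** A supremum of affine functions is lower semicontinuous. *)
Lemma measurable_conjugate phi : measurable_fun (setT : set B) (conjugate phi).
Proof.
apply: lsc_measurable => c.
rewrite (_ : mkset _ = \bigcup_x [set y | (c%:E < (inner x y)%:E - phi x)%E]).
  apply: bigcup_open => x _; case: (phi x) => [b| |].
  - rewrite (_ : mkset _ = inner x @^-1` [set t | c + b < t]).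
      by apply: open_comp => [y _|]; [exact: continuous_inner|exact: open_gt].
    by apply/seteqP; split => y /=; rewrite -EFinB lte_fin ltrBrDr.
  - by rewrite (_ : mkset _ = set0) ?open0//; apply/seteqP; split => y.
  - rewrite (_ : mkset _ = setT); first exact: openT.
    by apply/seteqP; split => y //= _; exact: ltry.
apply/seteqP; split => y /=.
  by move=> /ereal_sup_gt[_ [x _ <-] cx]; exists x.
by move=> [x _ cx]; apply: lt_le_trans cx (fenchel_young phi x y).
Qed.

Lemma measurable_smooth phi (beta a : R) : potential phi -> smooth beta a phi ->
  measurable_fun (setT : set B) phi.
Proof.
move=> pphi [od df _]; apply: (@patched_measurable _ _ (dom phi) _ +oo%E) => //.
  by move=> x; rewrite /dom/= => /negP; rewrite -leNgt leye_eq => /eqP.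
move=> c; rewrite openE => x [dx cx].
have cf : {for x, continuous (fine \o phi)} by exact/differentiable_continuous/df.
have dn : \forall y \near x, dom phi y by exact: open_nbhs_nbhs.
have cn : \forall y \near x, c < (fine \o phi) y.
  apply: (cf [set t | c < t]); apply: open_nbhs_nbhs; split; first exact: open_gt.
  by rewrite /= -lte_fin dom_fineK.
apply: filterS2 dn cn => y dy cy; split => //=.
by rewrite -(dom_fineK pphi dy) lte_fin.
Qed.

Lemma continuous_nabla phi (beta a : R) x : smooth beta a phi -> dom phi x ->
  {for x, continuous (nabla phi)}.
Proof.
move=> [od _ [H|[_ H]]] dx; first exact/differentiable_continuous/(H x dx).1.
move=> A /eball_nbhs[e e0 eA].
have b0 : 0 < `|beta| + 1 by rewrite ltr_wpDl.
have dn : \forall y \near x, dom phi y by exact: open_nbhs_nbhs.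
have en := nbhs_eball x (divr_gt0 e0 b0).
apply: filterS2 dn en => y dy xy; apply: eA; rewrite /eball/=.
apply: (le_lt_trans (H y x dy dx)).
apply: (@le_lt_trans _ _ ((`|beta| + 1) * enorm (y - x))).
  rewrite ler_wpM2r ?enorm_ge0//; have := ler_norm beta; lra.
by rewrite mulrC -ltr_pdivlMr.
Qed.

Lemma measurable_nabla phi (beta a : R) : smooth beta a phi ->
  measurable_fun (setT : set B) (nabla phi : B -> B).
Proof.
move=> sphi; have [od _ _] := sphi.
apply: (measurable_vector_fun od) => x dx; first exact: continuous_nabla sphi dx.
by rewrite /nabla memNset.
Qed.

(** Equality in Fenchel-Young, because the gradient is a subgradient. *)
Lemma fenchel_equality phi x : potential phi -> convex phi -> dom phi x ->
  differentiable (fine \o phi) x ->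
  conjugate phi (nabla phi x) = (inner x (nabla phi x) - fine (phi x))%:E.
Proof.
move=> pphi cphi dx df; apply/eqP; rewrite eq_le; apply/andP; split; last first.
  by rewrite EFinB dom_fineK//; exact: fenchel_young.
apply: conjugate_le => y; have := subgradient y pphi cphi dx df.
have [dy|] := pselect (dom phi y); last first.
  by move=> /negP; rewrite -leNgt leye_eq => /eqP -> _; rewrite leNye.
rewrite -(dom_fineK pphi dy).
by rewrite -EFinB !lee_fin innerBr (innerC x) (innerC y); lra.
Qed.

End conjugates.

Section ball_potentials.
Context {R : realType} {d : nat}.
Local Notation V := 'rV[R]_d.
Local Notation B := (borel_rV R d).
Variables (beta a r : R) (x0 : V).
Hypotheses (beta0 : 0 <= beta) (a0 : 0 <= a) (r0 : 0 < r) (x0r : enorm x0 <= r).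

(** The properties shared by the candidate potentials. The point [x0] of the ball at which the
    gradient is bounded turns the Lipschitz bound on gradients into a uniform bound. *)
Definition ball_potential (phi : V -> \bar R) : Prop :=
  [/\ potential phi, convex phi, smooth beta a phi, dom phi = eball 0 (2 * r) &
      enorm (nabla phi x0) <= r].

Implicit Types (phi psi : V -> \bar R) (x y : V).

Definition smoothness : R := beta * (1 + 2 * r) `^ a.

Definition potential_bound : R := 2 * r * (r + smoothness * r) + 4 * smoothness * r ^+ 2.

Lemma smoothness_ge0 : 0 <= smoothness.
Proof. by rewrite mulr_ge0// powR_ge0. Qed.

Lemma potential_bound_ge0 : 0 <= potential_bound.
Proof.
have L0 := smoothness_ge0; have r0' := ltW r0.
have := mulr_ge0 L0 (sqr_ge0 r); have := mulr_ge0 r0' r0'; have := mulr_ge0 L0 (mulr_ge0 r0' r0').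
by rewrite /potential_bound; lra.
Qed.

Lemma ball_domE phi x : ball_potential phi -> dom phi x <-> enorm x < 2 * r.
Proof. by case=> _ _ _ -> _; rewrite /eball/= subr0. Qed.

Lemma ball_potential_off phi x : ball_potential phi -> ~ (enorm x < 2 * r) -> phi x = +oo%E.
Proof.
move=> bp; rewrite -(ball_domE x bp) /dom/= => /negP.
by rewrite -leNgt leye_eq => /eqP.
Qed.

Lemma fine_ball_potential_off phi x : ball_potential phi -> ~ (enorm x < 2 * r) ->
  fine (phi x) = 0.
Proof. by move=> bp /(ball_potential_off bp) ->. Qed.

Lemma ball_potential_differentiable phi x : ball_potential phi -> enorm x < 2 * r ->
  differentiable (fine \o phi) x.
Proof. by move=> bp xr; have [_ _ [_ df _] _ _] := bp; apply: df; apply/ball_domE. Qed.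

Let dom0 phi : ball_potential phi -> dom phi 0.
Proof. by move=> bp; apply/ball_domE => //; rewrite enorm0 mulr_gt0. Qed.

Lemma enorm_nabla0 phi : ball_potential phi -> enorm (nabla phi 0) <= r + smoothness * r.
Proof.
move=> bp; have [pphi cphi sphi _ nx0] := bp.
have r0' := r0; have x0r' := x0r.
have x0d : dom phi x0 by apply/ball_domE => //; lra.
have x02 : enorm x0 <= 2 * r by lra.
have e0 : enorm (0 : V) <= 2 * r by rewrite enorm0; lra.
have := nabla_lipschitz beta0 a0 sphi cphi x0d (dom0 bp) x02 e0.
rewrite sub0r enormN -/smoothness => H.
have := enormD (nabla phi 0 - nabla phi x0) (nabla phi x0); rewrite subrK.
have := ler_wpM2l smoothness_ge0 x0r; lra.
Qed.

(** From [phi 0 = 0], the subgradient inequality below and the descent inequality above. *)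
Lemma fine_ball_potential_bound phi x : ball_potential phi ->
  `|fine (phi x)| <= potential_bound.
Proof.
move=> bp; have [pphi cphi sphi _ _] := bp; have r0' := r0.
have [xr|xr] := pselect (enorm x < 2 * r); last first.
  by rewrite fine_ball_potential_off// normr0 potential_bound_ge0.
have dx : dom phi x by apply/ball_domE.
have L0 := smoothness_ge0; have xn0 := enorm_ge0 x; have g0 := enorm_ge0 (nabla phi 0).
have e0 : enorm (0 : V) <= 2 * r by rewrite enorm0; lra.
have lo := subgradient x pphi cphi (dom0 bp) (ball_potential_differentiable bp _).
rewrite enorm0 -(dom_fineK pphi dx) lee_fin in lo.
have {}lo := lo (ltac:(lra)).
have up := descent beta0 a0 sphi cphi (dom0 bp) dx e0 (ltW xr).
rewrite -/smoothness subr0 in up; rewrite subr0 in lo.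
have phi00 : fine (phi 0) = 0 by rewrite pphi.2.
rewrite phi00 in lo up.
have I := normr_inner_le (nabla phi 0) x.
have N : enorm (nabla phi 0) * enorm x <= (r + smoothness * r) * (2 * r).
  by apply: ler_pM => //; [exact: enorm_nabla0|exact: ltW].
have N2 : smoothness * enorm x ^+ 2 <= smoothness * (2 * r) ^+ 2.
  by rewrite ler_wpM2l// lerXn2r ?nnegrE ?mulr_ge0 ?(ltW xr)//; lra.
have := le_trans I N; rewrite !ler_norml /potential_bound; rewrite exprMn in N2.
move=> /andP[I1 I2]; have := mulr_ge0 L0 (sqr_ge0 r) => ?; apply/andP; split; lra.
Qed.

Lemma bdmeas_fine_ball_potential phi : ball_potential phi ->
  bdmeas (fine \o phi : B -> R).
Proof.
move=> bp; have [pphi _ sphi _ _] := bp; split.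
  apply: (@measurableT_comp _ _ _ B _ _ fine) => //.
  exact: measurable_smooth pphi sphi.
by exists potential_bound => x; exact: fine_ball_potential_bound.
Qed.

Lemma conjugate_ball_potential_fin phi y : ball_potential phi ->
  conjugate phi y \is a fin_num.
Proof.
move=> bp; have [pphi _ _ _ _] := bp.
rewrite fin_numE; apply/andP; split.
  rewrite gt_eqF//; apply: (lt_le_trans _ (fenchel_young phi 0 y)).
  by rewrite pphi.2 sube0 ltNyr.
rewrite lt_eqF//; apply: (@le_lt_trans _ _ (2 * r * enorm y + potential_bound)%:E).
  apply: conjugate_le => x.
  have [xr|xr] := pselect (enorm x < 2 * r); last first.
    by rewrite (ball_potential_off bp xr) leNye.
  have dx : dom phi x by apply/ball_domE.
  rewrite -(dom_fineK pphi dx) -EFinB lee_fin.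
  have := fine_ball_potential_bound x bp; rewrite ler_norml => /andP[H _].
  have := inner_le x y; have := ler_wpM2r (enorm_ge0 y) (ltW xr); lra.
exact: ltry.
Qed.

Lemma fine_conjugateK phi y : ball_potential phi ->
  (fine (conjugate phi y))%:E = conjugate phi y.
Proof. by move=> bp; rewrite fineK// conjugate_ball_potential_fin. Qed.

Lemma measurable_fine_conjugate phi :
  measurable_fun (setT : set B) (fine \o conjugate phi).
Proof.
apply: (@measurableT_comp _ _ _ B _ _ fine) => //; exact: measurable_conjugate.
Qed.

(** Conjugation is a contraction for the sup distance over the common domain, so a net of the
    potentials is a net of their conjugates. *)
Lemma conjugate_contraction phi psi (h : R) y : ball_potential phi -> ball_potential psi ->
  (forall x, enorm x < 2 * r -> `|fine (phi x) - fine (psi x)| <= h) ->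
  `|fine (conjugate phi y) - fine (conjugate psi y)| <= h.
Proof.
have one f g : ball_potential f -> ball_potential g ->
    (forall x, enorm x < 2 * r -> `|fine (f x) - fine (g x)| <= h) ->
    fine (conjugate f y) - fine (conjugate g y) <= h.
  move=> bf bg H; rewrite lerBlDr -lee_fin EFinD !fine_conjugateK//.
  apply: conjugate_le => x.
  have [xr|xr] := pselect (enorm x < 2 * r); last first.
    by rewrite (ball_potential_off bf xr) leNye.
  have [[pf _ _ _ _] [pg _ _ _ _]] := (bf, bg).
  have df : dom f x by apply/ball_domE.
  have dg : dom g x by apply/ball_domE.
  apply: le_trans (leeD2l _ (fenchel_young g x y)).
  rewrite -(dom_fineK pf df) -(dom_fineK pg dg) -!EFinB -EFinD lee_fin.
  by have := H x xr; rewrite ler_norml => /andP[]; lra.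
move=> bp bs H; rewrite ler_norml; apply/andP; split; last exact: one.
have : fine (conjugate psi y) - fine (conjugate phi y) <= h.
  by apply: one => // x xr; rewrite distrC; exact: H.
lra.
Qed.

(** The defect in the Fenchel-Young inequality, at the primal point [x] and the dual point [y]. *)
Definition fenchel_gap phi x y : R :=
  fine (conjugate phi y) + fine (phi x) - inner x y.

Lemma fenchel_gap_ge phi x y z : ball_potential phi -> enorm z < 2 * r ->
  inner (z - x) y - fine (phi z) + fine (phi x) <= fenchel_gap phi x y.
Proof.
move=> bp zr; have [pphi _ _ _ _] := bp.
have dz : dom phi z by apply/ball_domE.
have := fenchel_young phi z y.
rewrite -(dom_fineK pphi dz) -(fine_conjugateK y bp) -EFinB lee_fin.
by rewrite /fenchel_gap innerBl; lra.
Qed.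

(** The supremum in the conjugate runs over a ball, and the subgradient inequality at [x] makes
    the function under it at most linear. *)
Lemma fenchel_gap_le phi x y : ball_potential phi -> enorm x <= r ->
  fenchel_gap phi x y <= 3 * r * enorm (y - nabla phi x).
Proof.
move=> bp xr; have [pphi cphi _ _ _] := bp; have r0' := r0.
have x2 : enorm x < 2 * r by lra.
have dx : dom phi x by apply/ball_domE.
rewrite /fenchel_gap lerBlDr -lerBrDr -lee_fin fine_conjugateK//.
apply: conjugate_le => z.
have [zr|zr] := pselect (enorm z < 2 * r); last first.
  by rewrite (ball_potential_off bp zr) leNye.
have dz : dom phi z by apply/ball_domE.
have := subgradient z pphi cphi dx (ball_potential_differentiable bp x2).
rewrite -(dom_fineK pphi dz) -EFinB !lee_fin => H.
have I := inner_le (z - x) (y - nabla phi x).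
have zx : enorm (z - x) <= 3 * r by have := enormB z x; lra.
have := ler_wpM2r (enorm_ge0 (y - nabla phi x)) zx.
move: I H; rewrite innerBr (innerC (z - x) (nabla phi x)) [inner (z - x) y]innerBl; lra.
Qed.

(** The supremum that defines the conjugate is tested at [x + t (y - nabla phi x)]. There is room
    for a step of length less than [r] inside the domain, which dictates the term [(M + r) / r] in
    the choice [t = (2 L)^-1]. *)
Lemma fenchel_gap_quadratic phi x y (M : R) : ball_potential phi -> enorm x <= r ->
  enorm (nabla phi x) <= r -> enorm y <= M ->
  enorm (nabla phi x - y) ^+ 2 <=
    4 * (smoothness + (M + r) / r + 1) * fenchel_gap phi x y.
Proof.
move=> bp xr nr yM; have [pphi cphi sphi _ _] := bp; have r0' := r0.
have L0 := smoothness_ge0.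
have M0 : 0 <= M := le_trans (enorm_ge0 y) yM.
set L := smoothness + (M + r) / r + 1.
have c0 : 0 <= (M + r) / r by rewrite divr_ge0//; lra.
have Lp : 0 < L by rewrite /L; lra.
set g := y - nabla phi x.
have gE : enorm (nabla phi x - y) = enorm g by rewrite enorm_distC.
have gM : enorm g <= M + r by have := enormB y (nabla phi x); rewrite -/g; lra.
pose t := (2 * L)^-1.
have t0 : 0 < t by rewrite invr_gt0 mulr_gt0.
have tL : 2 * (t * L) = 1 by rewrite mulrCA mulVf// gt_eqF// mulr_gt0.
pose z := x + t *: g.
have zx : z - x = t *: g by rewrite /z addrC addKr.
have tg : t * enorm g < r.
  rewrite /t mulrC ltr_pdivrMr ?mulr_gt0//.
  have e : r * ((M + r) / r) = M + r by rewrite mulrC divfK// gt_eqF.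
  have := mulr_ge0 (ltW r0) L0; rewrite /L; lra.
have zr : enorm z < 2 * r.
  apply: (le_lt_trans (enormD _ _)); rewrite enormZ ger0_norm ?(ltW t0)//; lra.
have x2 : enorm x < 2 * r by lra.
have dx : dom phi x by apply/ball_domE.
have dz : dom phi z by apply/ball_domE.
have D := descent beta0 a0 sphi cphi dx dz (ltW x2) (ltW zr).
have G := fenchel_gap_ge x y bp zr.
rewrite -/smoothness in D; rewrite zx in D G.
rewrite gE; rewrite innerZr enormZ exprMn real_normK ?num_real// in D.
rewrite innerZl in G.
have gg : enorm g ^+ 2 = inner g y - inner (nabla phi x) g.
  by rewrite enorm_sqr {2}/g innerBr (innerC g (nabla phi x)).
have S1 : smoothness * t ^+ 2 * enorm g ^+ 2 <= t / 2 * enorm g ^+ 2.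
  rewrite ler_wpM2r ?sqr_ge0// expr2 mulrA [leRHS]mulrC ler_pM2r//.
  have SL : smoothness <= L by rewrite /L; lra.
  have := ler_wpM2r (ltW t0) SL; lra.
have T : t / 2 * enorm g ^+ 2 <= fenchel_gap phi x y.
  apply: le_trans G; have tgg : t * enorm g ^+ 2 = t * (inner g y) - t * inner (nabla phi x) g by rewrite gg mulrBr.
  lra.
have L4 : 0 <= 4 * L by rewrite mulr_ge0// ltW.
apply: le_trans (ler_wpM2l L4 T).
rewrite (_ : 4 * L * (t / 2 * enorm g ^+ 2) = 2 * (t * L) * enorm g ^+ 2); last by field.
by rewrite tL mul1r.
Qed.

End ball_potentials.

(** * The excess risk and its variance *)

Section transport.
Context {R : realType} {d : nat}.
Local Notation V := 'rV[R]_d.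
Local Notation B := (borel_rV R d).
Variables (P Q : probability B R) (phi0 : V -> \bar R) (F : set (V -> \bar R)).
Variables (beta a CPI gamma C1 q1 r M : R).
Hypotheses (beta0 : 0 <= beta) (a0 : 0 <= a) (CPI0 : 0 <= CPI) (r0 : 0 < r) (M0 : 0 <= M).
Hypothesis st : setting P Q phi0 F.
Hypothesis hyp : assumptions P phi0 F beta a CPI gamma C1 q1 r.
Hypothesis nabla0M : forall x, msupport P x -> enorm (nabla phi0 x) <= M.

Let T : B -> B := nabla phi0.

(** A set of full measure on which [phi0] is finite and all the gradients are bounded. *)
Definition good_set : set B := msupport P `&` dom phi0.

Local Notation S := good_set.

Lemma measurable_good_set : measurable S.
Proof.
apply: (@measurableI _ B); first exact: measurable_msupport.
by apply: measurable_open_rV; have [] := smooth_phi0 hyp.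
Qed.

Lemma good_set_full : P S = 1%E.
Proof.
have mD : measurable (dom phi0 : set B).
  by apply: measurable_open_rV; have [] := smooth_phi0 hyp.
have mM := measurable_msupport P.
have z1 : P (~` msupport P) = 0%E by apply: full_setC => //; exact: msupport_full.
have z2 : P (~` dom phi0) = 0%E by apply: full_setC => //; exact: P_dom_phi0 st.
have : P (~` S) = 0%E.
  rewrite /good_set setCI; apply/eqP; rewrite eq_le measure_ge0 andbT.
  apply: (le_trans (measureU2 _ _ _)); [exact: measurableC|exact: measurableC|].
  by rewrite [X in (X + _)%E]z1 [X in (_ + X)%E]z2 adde0.
move=> H; have := probability_setC P (measurableC measurable_good_set).
by rewrite setCK H sube0.
Qed.

Lemma good_set_nonempty : exists x0, S x0.
Proof.
apply/set0P/negP => /eqP S0; have := good_set_full.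
by rewrite S0 measure0 => /eqP; rewrite eq_sym onee_eq0.
Qed.

Lemma good_set_enorm x : S x -> enorm x <= r.
Proof. by move=> [/(support_P hyp)]. Qed.

Lemma candidate_ball_potential phi x0 : F phi -> S x0 -> ball_potential beta a r x0 phi.
Proof.
move=> Fphi [sx0 _]; split.
- exact: potential_F st _ Fphi.
- exact: convex_F st _ Fphi.
- exact: smooth_F hyp _ Fphi.
- exact: dom_F hyp _ Fphi.
- by apply: (nabla_F hyp).
Qed.

Let measurable_T : measurable_fun setT T.
Proof. exact: measurable_nabla (smooth_phi0 hyp). Qed.

(** Replacing a function by 0 off the good set makes it bounded without a change in its mean. *)
Definition onS (f : B -> R) (x : B) : R := if x \in S then f x else 0.

Lemma onSE (f : B -> R) (x : B) : S x -> onS f x = f x.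
Proof. by move=> Sx; rewrite /onS mem_set. Qed.

Lemma bdmeas_onS (f : B -> R) (b : R) : measurable_fun setT f -> (forall x, S x -> `|f x| <= b) ->
  bdmeas (onS f).
Proof.
move=> mf fb; split.
  apply: measurable_fun_ifT => //.
  exact: (measurable_fun_mem measurable_good_set).
exists (Num.max 0 b) => x; rewrite /onS; case: ifPn => [/set_mem Sx|_].
  by rewrite le_max fb// orbT.
by rewrite normr0 le_max lexx.
Qed.

Lemma integral_onS (f : B -> \bar R) (g : B -> R) : measurable_fun setT f ->
  bdmeas (onS g) -> (forall x, S x -> f x = (g x)%:E) ->
  (\int[P]_x f x = (mean P (onS g))%:E)%E.
Proof.
move=> mf bg fg; rewrite meanE//.
apply: (integral_full_set measurable_good_set good_set_full) => //.
  by apply/measurable_EFinP; have [] := bg.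
by move=> x Sx; rewrite onSE// fg.
Qed.

Lemma integral_Q (f : B -> \bar R) : measurable_fun setT f ->
  (\int[Q]_y f y = \int[P]_x f (T x))%E.
Proof.
move=> mf.
have ge0 (g : B -> \bar R) : measurable_fun setT g -> (forall x, 0 <= g x)%E ->
    (\int[Q]_y g y = \int[P]_x g (T x))%E.
  move=> mg g0; rewrite -(@ge0_integral_pushforward _ _ _ _ _ _ measurable_T P setT g)//.
  by apply: eq_measure_integral => A mA _; exact: pushforward_Q st _ mA.
rewrite integralE [RHS]integralE.
rewrite (ge0 _ (measurable_funepos mf) (funepos_ge0 f)).
rewrite (ge0 _ (measurable_funeneg mf) (funeneg_ge0 f)).
by rewrite -[fun x => f (T x)]/(f \o T) (funepos_comp f T) (funeneg_comp f T).
Qed.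

Lemma mean_Q (f : B -> R) : measurable_fun setT f -> mean Q f = mean P (f \o T).
Proof. by move=> mf; congr fine; rewrite integral_Q//; exact/measurable_EFinP. Qed.

Let measurable_coord (i : 'I_d) : measurable_fun setT (fun x : B => x 0 i).
Proof. by apply: continuous_measurable; exact: coord_continuous. Qed.

Lemma measurable_inner_T : measurable_fun setT (fun x : B => inner x (T x)).
Proof.
apply: measurable_sum => i; apply: measurable_funM => //.
exact: (measurableT_comp (measurable_coord i) measurable_T).
Qed.

Lemma inner_T_bound x : S x -> `|inner x (T x)| <= r * M.
Proof.
move=> Sx; apply: (le_trans (normr_inner_le _ _)).
by apply: ler_pM; rewrite ?enorm_ge0 ?good_set_enorm//; apply: nabla0M; case: Sx.
Qed.

Definition gap (phi : V -> \bar R) (x : B) : R := fenchel_gap phi x (T x).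

Definition excess (phi : V -> \bar R) : R := mean P (onS (gap phi)).

Definition gap_bound : R := 3 * r * (M + r).

(** Pointwise stability: the error of the gradient is controlled by the gap. *)
Lemma gap_quadratic phi x : F phi -> S x ->
  enorm (nabla phi x - nabla phi0 x) ^+ 2 <=
    4 * (smoothness beta a r + (M + r) / r + 1) * gap phi x.
Proof.
move=> Fphi Sx; have bp := candidate_ball_potential Fphi Sx.
have n1 : enorm (nabla phi x) <= r by case: bp.
have n2 : enorm (T x) <= M by apply: nabla0M; case: Sx.
exact: (fenchel_gap_quadratic beta0 a0 r0 (good_set_enorm Sx) bp (good_set_enorm Sx) n1 n2).
Qed.

Let Lp : 0 < 4 * (smoothness beta a r + (M + r) / r + 1).
Proof.
have L0 := smoothness_ge0 a r beta0; have r0' := r0; have M0' := M0.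
have : 0 <= (M + r) / r by rewrite divr_ge0//; lra.
lra.
Qed.

Lemma gap_ge0 phi x : F phi -> S x -> 0 <= gap phi x.
Proof.
move=> Fphi Sx; rewrite -(pmulr_rge0 _ Lp); apply: le_trans (gap_quadratic Fphi Sx).
exact: sqr_ge0.
Qed.

Lemma gap_le phi x : F phi -> S x -> gap phi x <= gap_bound.
Proof.
move=> Fphi Sx; have bp := candidate_ball_potential Fphi Sx.
apply: (le_trans (fenchel_gap_le beta0 a0 r0 (good_set_enorm Sx) (T x) bp (good_set_enorm Sx))).
rewrite /gap_bound ler_wpM2l//; first by rewrite mulr_ge0// ltW.
apply: (le_trans (enormB _ _)); apply: lerD; last by case: bp.
by apply: nabla0M; case: Sx.
Qed.

Lemma measurable_gap phi : F phi -> measurable_fun setT (gap phi).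
Proof.
move=> Fphi; have [x0 Sx0] := good_set_nonempty.
have bp := candidate_ball_potential Fphi Sx0.
apply: measurable_funB; last exact: measurable_inner_T.
apply: measurable_funD.
  exact: (measurableT_comp (measurable_fine_conjugate phi) measurable_T).
by have [] := bdmeas_fine_ball_potential beta0 a0 r0 (good_set_enorm Sx0) bp.
Qed.

Lemma bdmeas_gap phi : F phi -> bdmeas (onS (gap phi)).
Proof.
move=> Fphi; apply: (@bdmeas_onS _ gap_bound); first exact: measurable_gap.
by move=> x Sx; rewrite ger0_norm ?gap_ge0// gap_le.
Qed.

Lemma excess_ge0 phi : F phi -> 0 <= excess phi.
Proof.
move=> Fphi; apply: mean_ge0 => x; rewrite /onS.
by case: ifPn => // /set_mem Sx; exact: gap_ge0.
Qed.

Lemma bdmeas_fine_candidate phi : F phi -> bdmeas (fine \o phi : B -> R).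
Proof.
move=> Fphi; have [x0 Sx0] := good_set_nonempty.
have H := bdmeas_fine_ball_potential beta0 a0 r0 (good_set_enorm Sx0) (candidate_ball_potential Fphi Sx0).
exact: H.
Qed.

Let conj_T_bound phi x : F phi -> S x ->
  `|fine (conjugate phi (T x))| <= gap_bound + potential_bound beta a r + r * M.
Proof.
move=> Fphi Sx; have bp := candidate_ball_potential Fphi Sx.
have := fine_ball_potential_bound beta0 a0 r0 (good_set_enorm Sx) x bp.
have := inner_T_bound Sx; have := gap_ge0 Fphi Sx; have := gap_le Fphi Sx.
by rewrite /gap /fenchel_gap !ler_norml; lra.
Qed.

Lemma bdmeas_conj_T phi : F phi -> bdmeas (onS (fun x => fine (conjugate phi (T x)))).
Proof.
move=> Fphi.
apply: bdmeas_onS => [|x Sx]; last exact: (conj_T_bound Fphi Sx).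
exact: (measurableT_comp (measurable_fine_conjugate phi) measurable_T).
Qed.

Lemma bdmeas_onS_fine phi : F phi -> bdmeas (onS (fine \o phi)).
Proof.
move=> Fphi; have [mu [b ub]] := bdmeas_fine_candidate Fphi.
exact: bdmeas_onS mu (fun x _ => ub x).
Qed.

Lemma semidualE phi : F phi ->
  semidual P Q phi = (mean P (onS (fine \o phi)) +
                      mean P (onS (fun x => fine (conjugate phi (T x)))))%:E.
Proof.
move=> Fphi; have [x0 Sx0] := good_set_nonempty.
have bp := candidate_ball_potential Fphi Sx0; have [pphi _ sphi _ _] := bp.
rewrite /semidual EFinD; congr (_ + _)%E.
  apply: integral_onS; [exact: measurable_smooth pphi sphi|exact: bdmeas_onS_fine|].
  move=> x Sx; rewrite /= dom_fineK//; apply/(ball_domE _ bp).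
  by have := good_set_enorm Sx; have r0' := r0; lra.
rewrite integral_Q; last exact: measurable_conjugate.
apply: integral_onS; last by move=> x Sx; rewrite (fine_conjugateK beta0 a0 r0 (good_set_enorm Sx0) (T x) bp).
- exact: (measurableT_comp (measurable_conjugate phi) measurable_T).
- exact: bdmeas_conj_T.
Qed.

Let pairing_bdmeas : bdmeas (onS (fun x => inner x (T x))).
Proof. exact: bdmeas_onS measurable_inner_T inner_T_bound. Qed.

(** The potential [phi0] and its conjugate cancel in the Fenchel equality, so that only the
    pairing with the transport map remains. *)
Lemma semidual_phi0E : semidual P Q phi0 = (mean P (onS (fun x => inner x (T x))))%:E.
Proof.
have pphi := potential_phi0 st; have cphi := convex_phi0 st.
have sphi := smooth_phi0 hyp; have [_ df _] := sphi.
have mphi := measurable_smooth pphi sphi.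
have d0 : dom phi0 0 by rewrite /dom/= pphi.2.
have mfine : measurable_fun setT (fine \o phi0 : B -> R) by apply: measurableT_comp.
have phi0b x : S x -> `|fine (phi0 x)| <= r * M + enorm (nabla phi0 0) * r.
  move=> Sx; have [sx dx] := Sx.
  have lo := subgradient x pphi cphi d0 (df _ d0).
  have up := subgradient 0 pphi cphi dx (df _ dx).
  rewrite -(dom_fineK pphi dx) pphi.2/= subr0 lee_fin add0r in lo.
  rewrite pphi.2 lee_fin sub0r innerNr innerC in up.
  have I1 := inner_T_bound Sx; have I2 := normr_inner_le (nabla phi0 0) x.
  have I3 := ler_wpM2l (enorm_ge0 (nabla phi0 0)) (good_set_enorm Sx).
  have I4 : 0 <= enorm (nabla phi0 0) * r by rewrite mulr_ge0 ?enorm_ge0// ltW.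
  have I5 : 0 <= r * M by rewrite mulr_ge0// ltW.
  have I6 := le_trans I2 I3.
  by move: I1 I6; rewrite /T !ler_norml; lra.
have b1 : bdmeas (onS (fine \o phi0)) by exact: bdmeas_onS mfine phi0b.
have m2 : measurable_fun setT (fun x : B => inner x (T x) - (fine \o phi0) x).
  by apply: measurable_funB => //; exact: measurable_inner_T.
have b2 : bdmeas (onS (fun x => inner x (T x) - (fine \o phi0) x)).
  apply: (bdmeas_onS m2) => x Sx; apply: (le_trans (ler_normB _ _)).
  exact: lerD (inner_T_bound Sx) (phi0b x Sx).
rewrite /semidual (integral_onS mphi b1); last first.
  by move=> x [_ dx]; rewrite /= dom_fineK.
rewrite integral_Q; last exact: measurable_conjugate.
rewrite (integral_onS _ b2); last 2 first.
- exact: (measurableT_comp (measurable_conjugate phi0) measurable_T).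
- move=> x [_ dx]; exact: fenchel_equality pphi cphi dx (df _ dx).
rewrite -EFinD -meanD//; congr (_%:E); apply: eq_mean => x.
by rewrite /onS; case: ifP => _; rewrite ?addr0//=; ring.
Qed.

(** The excess risk is the mean Fenchel gap. *)
Lemma semidual_excess phi : F phi ->
  (semidual P Q phi - semidual P Q phi0 = (excess phi)%:E)%E.
Proof.
move=> Fphi; rewrite semidualE// semidual_phi0E -EFinB; congr (_%:E).
have b1 := bdmeas_onS_fine Fphi; have b2 := bdmeas_conj_T Fphi.
rewrite -meanD// -meanB//; last exact: bdmeasD.
apply: eq_mean => x; rewrite /onS; case: ifP => _; last by rewrite addr0 subr0.
by rewrite /gap /fenchel_gap /=; ring.
Qed.

Definition potential_diff (phi psi : V -> \bar R) (x : B) : R := fine (phi x) - fine (psi x).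

Definition conjugate_diff (phi psi : V -> \bar R) (y : B) : R :=
  fine (conjugate phi y) - fine (conjugate psi y).

Lemma bdmeas_potential_diff phi psi : F phi -> F psi -> bdmeas (potential_diff phi psi).
Proof. by move=> Fp Fs; apply: bdmeasB; exact: bdmeas_fine_candidate. Qed.

Lemma conjugate_diff_bound phi psi (h : R) y : F phi -> F psi ->
  (forall x, enorm x < 2 * r -> `|potential_diff phi psi x| <= h) ->
  `|conjugate_diff phi psi y| <= h.
Proof.
move=> Fp Fs H; have [x0 Sx0] := good_set_nonempty.
exact: (conjugate_contraction beta0 a0 r0 (good_set_enorm Sx0) y (candidate_ball_potential Fp Sx0)
  (candidate_ball_potential Fs Sx0) H).
Qed.

Lemma potential_diff_bound phi psi x : F phi -> F psi ->
  `|potential_diff phi psi x| <= 2 * potential_bound beta a r.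
Proof.
move=> Fp Fs; have [x0 Sx0] := good_set_nonempty.
apply: (le_trans (ler_normB _ _)).
have b f (Ff : F f) := fine_ball_potential_bound beta0 a0 r0 (good_set_enorm Sx0) x
  (candidate_ball_potential Ff Sx0).
by have := b _ Fp; have := b _ Fs; lra.
Qed.

Lemma bdmeas_conjugate_diff phi psi : F phi -> F psi -> bdmeas (conjugate_diff phi psi).
Proof.
move=> Fp Fs; split; first by apply: measurable_funB; exact: measurable_fine_conjugate.
exists (2 * potential_bound beta a r) => y; apply: conjugate_diff_bound => // x _.
exact: potential_diff_bound.
Qed.

Let conj_diff_T phi psi x : F phi -> F psi -> S x ->
  conjugate_diff phi psi (T x) = (gap phi x - gap psi x) - potential_diff phi psi x.
Proof.
by move=> Fp Fs Sx; rewrite /conjugate_diff /gap /fenchel_gap /potential_diff; ring.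
Qed.

Lemma mean_conjugate_diff phi psi : F phi -> F psi ->
  mean Q (conjugate_diff phi psi) =
  mean P (fun x => (onS (gap phi) x - onS (gap psi) x) - onS (potential_diff phi psi) x).
Proof.
move=> Fp Fs; have [mc _] := bdmeas_conjugate_diff Fp Fs.
rewrite mean_Q//; apply: (mean_full_set measurable_good_set good_set_full).
- exact: measurableT_comp mc measurable_T.
- apply: measurable_funB; last first.
    have [m [b H]] := bdmeas_potential_diff Fp Fs.
    by have [] := bdmeas_onS m (fun x _ => H x).
  by apply: measurable_funB; [have [] := bdmeas_gap Fp|have [] := bdmeas_gap Fs].
- by move=> x Sx; rewrite /= !onSE// conj_diff_T.
Qed.

Let bdmeas_onS_pd phi psi : F phi -> F psi -> bdmeas (onS (potential_diff phi psi)).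
Proof.
move=> Fp Fs; have [m [b H]] := bdmeas_potential_diff Fp Fs.
exact: bdmeas_onS m (fun x _ => H x).
Qed.

Let mean_onS_pd phi psi : F phi -> F psi ->
  mean P (onS (potential_diff phi psi)) = mean P (potential_diff phi psi).
Proof.
move=> Fp Fs; apply: (mean_full_set measurable_good_set good_set_full).
- by have [] := bdmeas_onS_pd Fp Fs.
- by have [] := bdmeas_potential_diff Fp Fs.
- by move=> x Sx; rewrite onSE.
Qed.

Lemma excess_diff phi psi : F phi -> F psi ->
  excess phi - excess psi =
    mean P (potential_diff phi psi) + mean Q (conjugate_diff phi psi).
Proof.
move=> Fp Fs; have gp := bdmeas_gap Fp; have gs := bdmeas_gap Fs.
rewrite mean_conjugate_diff// meanB//; [|exact: bdmeasB|exact: bdmeas_onS_pd].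
by rewrite meanB// mean_onS_pd// /excess; ring.
Qed.

(** The Poincare inequality turns the pointwise stability into a variance bound. *)
Lemma var_potential_diff phi psi : F phi -> F psi ->
  var P (potential_diff phi psi) <=
    CPI * (8 * (smoothness beta a r + (M + r) / r + 1)) * (excess phi + excess psi).
Proof.
move=> Fp Fs; have [x0 Sx0] := good_set_nonempty.
have bp := candidate_ball_potential Fp Sx0; have bs := candidate_ball_potential Fs Sx0.
set c := 8 * _; have c0 : 0 < c by have := Lp; rewrite /c; lra.
pose g x := c * (onS (gap phi) x + onS (gap psi) x).
have gp := bdmeas_gap Fp; have gs := bdmeas_gap Fs.
have gsum := bdmeasD gp gs.
have bg : bdmeas g by apply: bdmeasM => //; exact: bdmeas_cst.
have onS0 f x : F f -> 0 <= onS (gap f) x.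
  by move=> Ff; rewrite /onS; case: ifPn => // /set_mem; exact: gap_ge0.
rewrite -lee_fin.
have -> : (CPI * c * (excess phi + excess psi))%:E = (CPI%:E * \int[P]_x (g x)%:E)%E.
  rewrite -(meanE P bg) -EFinM; congr (_%:E).
  rewrite -[LHS]mulrA; congr (CPI * _).
  by rewrite /g (meanZ P c gsum) (meanD P gp gs).
apply: (@poincare_ball _ _ P CPI r r0 (poincare_P hyp) CPI0 (support_P hyp) S
  (potential_diff phi psi) (EFin \o g) measurable_good_set good_set_full).
- by move=> x [].
- exact: bdmeas_potential_diff.
- move=> x xr; apply: differentiableB.
    exact: (ball_potential_differentiable bp xr).
  exact: (ball_potential_differentiable bs xr).
- move=> x xr; rewrite /potential_diff.
  by rewrite (fine_ball_potential_off bp xr) (fine_ball_potential_off bs xr) subrr.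
- by apply/measurable_EFinP; have [] := bg.
- by move=> x; rewrite lee_fin mulr_ge0 ?(ltW c0)// addr_ge0 ?onS0.
move=> x Sx; rewrite lee_fin /g !onSE//.
have xr : enorm x < 2 * r by have := good_set_enorm Sx; have r0' := r0; lra.
have dp := ball_potential_differentiable bp xr.
have ds := ball_potential_differentiable bs xr.
have -> : gradient (potential_diff phi psi) x = nabla phi x - nabla psi x.
  rewrite !nablaE; [|exact/(ball_domE _ bs)|exact/(ball_domE _ bp)].
  apply/rowP => i; rewrite !mxE.
  rewrite (_ : potential_diff phi psi = (fine \o phi) - (fine \o psi))//.
  by rewrite deriveB//; exact: diff_derivable.
have G1 := gap_quadratic Fp Sx; have G2 := gap_quadratic Fs Sx.
set u := nabla phi x - nabla phi0 x in G1; set v := nabla psi x - nabla phi0 x in G2.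
have -> : nabla phi x - nabla psi x = u - v by rewrite /u /v opprB addrA subrK.
have H : enorm (u - v) ^+ 2 <= 2 * enorm u ^+ 2 + 2 * enorm v ^+ 2.
  have E := enormB u v; have e0 := enorm_ge0 (u - v).
  have eu := enorm_ge0 u; have ev := enorm_ge0 v.
  have := sqr_ge0 (enorm u - enorm v); nra.
by apply: (le_trans H); rewrite /c; lra.
Qed.

(** Composed with the transport map, a difference of conjugates is a difference of gaps minus a
    difference of potentials. Gaps are nonnegative and bounded, so their second moments are at most
    [gap_bound] times their means. *)
Lemma var_conjugate_diff phi psi : F phi -> F psi ->
  var Q (conjugate_diff phi psi) <=
    2 * gap_bound * (excess phi + excess psi) + 2 * var P (potential_diff phi psi).
Proof.
move=> Fp Fs; have gp := bdmeas_gap Fp; have gs := bdmeas_gap Fs.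
have gd := bdmeasB gp gs; have pd := bdmeas_onS_pd Fp Fs.
have [mc _] := bdmeas_conjugate_diff Fp Fs.
set D := fun x => onS (gap phi) x - onS (gap psi) x in gd.
have -> : var Q (conjugate_diff phi psi) =
    var P (fun x => D x - onS (potential_diff phi psi) x).
  rewrite /var -mean_conjugate_diff//.
  move: (mean Q (conjugate_diff phi psi)) => m.
  have msq : measurable_fun setT (fun y => (conjugate_diff phi psi y - m) ^+ 2).
    by apply: (measurable_funX 2); exact: measurable_funB.
  rewrite (mean_Q msq).
  apply: (mean_full_set measurable_good_set good_set_full).
  - exact: measurableT_comp msq measurable_T.
  - apply: (measurable_funX 2); apply: measurable_funB => //.
    by apply: measurable_funB; [case: gd|case: pd].
  - by move=> x Sx; rewrite /= /D !onSE// conj_diff_T.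
apply: (le_trans (varB_le P gd pd)); rewrite lerD//.
  rewrite -mulrA ler_pM2l//; apply: (le_trans (var_le_second_moment _ gd)).
  rewrite /excess -meanD// -meanZ; last exact: bdmeasD.
  have gsum := bdmeasD gp gs.
  apply: le_mean; first exact: bdmeas_sqr.
    by apply: bdmeasM => //; exact: bdmeas_cst.
  move=> x; rewrite /D /onS; case: ifPn => [/set_mem Sx|_].
    have := gap_ge0 Fp Sx; have := gap_ge0 Fs Sx.
    have := gap_le Fp Sx; have := gap_le Fs Sx.
    set u := gap phi x; set v := gap psi x => *; nra.
  by rewrite addr0 subr0 expr0n mulr0.
rewrite ler_pM2l// /var mean_onS_pd// le_eqVlt; apply/orP; left; apply/eqP.
have [mp _] := bdmeas_potential_diff Fp Fs; have [mp' _] := pd.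
apply: (mean_full_set measurable_good_set good_set_full).
- by apply: (measurable_funX 2); exact: measurable_funB.
- by apply: (measurable_funX 2); exact: measurable_funB.
- by move=> x Sx; rewrite onSE.
Qed.

End transport.

(** * Empirical measures and nets *)

Section empirical_integrals.
Context {d : measure_display} {T : measurableType d} {R : realType}.
Variables (n : nat) (x : 'I_n -> T).

Lemma ge0_integral_empirical (f : T -> \bar R) : measurable_fun setT f ->
  (forall y, 0 <= f y)%E ->
  (\int[empirical x]_y f y = (n%:R^-1)%:E * \sum_i f (x i))%E.
Proof.
move=> mf f0; pose y k := if insub k is Some i then x i else point.
pose m k : {measure set T -> \bar R} := dirac (y k).
have c0 : 0 <= n%:R^-1 :> R by rewrite invr_ge0.
have yE (i : 'I_n) : y i = x i by rewrite /y valK.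
rewrite (eq_measure_integral (mscale (NngNum c0) (msum m n))); last first.
  move=> A mA _; rewrite /mscale/= /empirical /msum; congr (_ * _)%E.
  by apply: eq_bigr => i _; rewrite /m yE.
rewrite ge0_integral_mscale//= ge0_integral_measure_sum//; congr (_ * _)%E.
apply: eq_bigr => i _; rewrite integral_dirac// diracT mul1e.
by rewrite yE.
Qed.

Lemma integral_empirical (f : T -> \bar R) (g : 'I_n -> R) : measurable_fun setT f ->
  (forall i, f (x i) = (g i)%:E) ->
  (\int[empirical x]_y f y = (n%:R^-1 * \sum_i g i)%:E)%E.
Proof.
move=> mf fg; rewrite integralE !ge0_integral_empirical//;
  do ?[exact: measurable_funepos|exact: measurable_funeneg].
under eq_bigr do rewrite funeposE fg -EFin_max.
under [X in (_ - _ * X)%E]eq_bigr do rewrite funenegE fg -EFinN -EFin_max.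
rewrite !sumEFin -!EFinM -EFinB -mulrBr -sumrB; congr (_ * _)%:E.
by apply: eq_bigr => i _; case: (leP (g i) 0) => ?; case: (leP (- g i) 0) => ?; lra.
Qed.

End empirical_integrals.

Section nets.
Context {R : realType} {d : nat}.
Local Notation V := 'rV[R]_d.

(** A nonempty set of natural numbers has a least element, so the infimum is one of the covers. *)
Lemma covering_number_attained (E : Type) (dist : E -> E -> \bar R) (h H : R) (A : set E) :
  (exists f, A f) -> (lne (covering_number dist h A) <= H%:E)%E ->
  exists N (c : 'I_N -> E), ln N%:R <= H /\
    forall f, A f -> exists i, (dist (c i) f <= h%:E)%E.
Proof.
move=> [f0 Af0]; rewrite /covering_number; set K := [set N : nat | _].
move=> lH.
have [[N0 KN0]|K0] := pselect (exists N, K N); last first.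
  move: lH; rewrite (_ : [set _ | _ in K] = set0) ?ereal_inf0//.
  by apply/seteqP; split => [y [N KN _]|//]; case: K0; exists N.
have ex : exists N, `[< K N >] by exists N0; apply/asboolP.
case: (ex_minnP ex) => N /asboolP KN Nmin.
have [c cP] := KN; exists N, c; split => //.
have N1 : (0 < N)%N by have [i _] := cP _ Af0; exact: leq_ltn_trans (ltn_ord i).
have Nr : 0 < N%:R :> R by rewrite ltr0n.
rewrite -lee_fin -lne_EFin//; apply: le_trans lH.
have le_inf : ((N%:R)%:E <= ereal_inf [set (k%:R)%:E | k in K] :> \bar R)%E.
  apply: le_ereal_inf_tmp => _ [k Kk <-]; rewrite lee_fin ler_nat; apply: Nmin.
  exact/asboolP.
rewrite lee_lne// in_itv/= leey andbT ?lee_fin ?(ltW Nr)//.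
by apply: le_trans le_inf; rewrite lee_fin ltW.
Qed.

Lemma dist_Loo_triangle (A : set V) (c f g : V -> \bar R) (h : R) (x : V) :
  (dist_Loo A c f <= h%:E)%E -> (dist_Loo A c g <= h%:E)%E -> A x ->
  f x \is a fin_num -> g x \is a fin_num -> `|fine (f x) - fine (g x)| <= 2 * h.
Proof.
move=> cf cg Ax ffin gfin.
have Hf : (`|c x - f x| <= h%:E)%E by apply: le_trans cf; apply: ereal_sup_ubound; exists x.
have Hg : (`|c x - g x| <= h%:E)%E by apply: le_trans cg; apply: ereal_sup_ubound; exists x.
move: Hf Hg; rewrite -(fineK ffin) -(fineK gfin) /=.
case: (c x) => [b| |]//=; rewrite !lee_fin => Hf Hg.
by move: Hf Hg; rewrite !ler_norml; lra.
Qed.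

End nets.

(** * The risk bound *)

Section risk.
Context {R : realType} {d : nat}.
Local Notation V := 'rV[R]_d.
Local Notation B := (borel_rV R d).
Variables (P Q : probability B R) (phi0 : V -> \bar R) (F : set (V -> \bar R)).
Variables (beta a CPI gamma C1 q1 r M : R).
Hypotheses (beta0 : 0 <= beta) (a0 : 0 <= a) (CPI0 : 0 <= CPI) (gamma0 : 0 <= gamma)
  (C10 : 0 <= C1) (q10 : 0 <= q1) (r0 : 0 < r) (M0 : 0 <= M).
Hypothesis st : setting P Q phi0 F.
Hypothesis hyp : assumptions P phi0 F beta a CPI gamma C1 q1 r.
Hypothesis nabla0M : forall x, msupport P x -> enorm (nabla phi0 x) <= M.

Lemma candidate_nets (psi : V -> \bar R) (h : R) : F psi -> 0 < h ->
  net F (fun f => potential_diff f psi : B -> R) (fun f => conjugate_diff f psi)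
    (2 * h) (C1 * logp h^-1 `^ q1 * h `^ (- gamma)).
Proof.
move=> Fpsi h0; have [x0 Sx0] := good_set_nonempty st hyp.
have bp f (Ff : F f) := candidate_ball_potential st hyp Ff Sx0.
have [N [c [NH cP]]] := covering_number_attained (ex_intro _ psi Fpsi) (entropy_F hyp h0).
(* Centers may lie outside [F]: each is replaced by a member of [F] that it is close to,
   which doubles the radius. *)
pose close i f := F f /\ (dist_Loo (eball 0 (2 * r)) (c i) f <= h%:E)%E.
have /choice[rep repP] : forall i, exists g, F g /\ (forall f, close i f -> close i g).
  move=> i; have [[f cf]|nc] := pselect (exists f, close i f).
    by exists f; split => //; case: cf.
  by exists psi; split => // f cf; case: nc; exists f.
have /choice[idx idxP] : forall f, exists i, F f -> close i f.
  move=> f; have [Ff|nF] := pselect (F f).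
    by have [i ci] := cP f Ff; exists i => _; split.
  by have [i _] := cP psi Fpsi; exists i.
exists N, rep, idx; split => // [i|f Ff]; first by case: (repP i).
have cf := idxP f Ff; have [Frep /(_ f cf) [_ cg]] := repP (idx f).
set g := rep (idx f) in Frep cg *.
have close_fg x : `|fine (f x) - fine (g x)| <= 2 * h.
  have [xr|xr] := pselect (enorm x < 2 * r); last first.
    rewrite (fine_ball_potential_off (bp f Ff) xr) (fine_ball_potential_off (bp g Frep) xr).
    by rewrite subrr normr0 mulr_ge0// ltW.
  have fin k (Fk : F k) : k x \is a fin_num.
    have dk : dom k x by apply/(ball_domE x (bp k Fk)).
    by rewrite -(dom_fineK (potential_F st Fk) dk).
  apply: (dist_Loo_triangle cf.2 cg) => //; [|exact: fin|exact: fin].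
  by rewrite /eball/= subr0.
move=> x; split.
  rewrite /potential_diff (_ : _ - _ - _ = fine (f x) - fine (g x)); last by ring.
  exact: close_fg.
rewrite /conjugate_diff (_ : _ - _ - _ = fine (conjugate f x) - fine (conjugate g x)); last by ring.
by apply: (conjugate_diff_bound beta0 a0 r0 st hyp x Ff Frep) => y _; exact: close_fg.
Qed.

(** Off a null event the sample lies where the potentials are finite. *)
Lemma samples_in_ball (dO : measure_display) (Omega : measurableType dO)
    (Pr : probability Omega R) (n : nat) (X : 'I_n -> {mfun Omega >-> B}) :
  (forall i, has_law Pr (X i) P) ->
  exists N : set Omega, [/\ measurable N, Pr N = 0%E &
    forall w, ~ N w -> forall i, enorm (X i w : V) < 2 * r].
Proof.
move=> law; pose D : set B := ~` eball 0 (2 * r).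
have mD : measurable D by apply: (@measurableC _ B); exact: measurable_eball.
have PD : P D = 0%E.
  apply/eqP; rewrite eq_le measure_ge0 andbT.
  rewrite -(full_setC (measurable_good_set hyp) (good_set_full st hyp)).
  apply: le_measure; rewrite ?inE//; first exact: (measurableC (measurable_good_set hyp)).
  move=> x Dx Sx; apply: Dx; rewrite /eball/= subr0.
  by have := good_set_enorm hyp Sx; have r0' := r0; lra.
pose N (k : nat) : set Omega := if insub k is Some i then X i @^-1` D else set0.
have nN k : Pr.-negligible (N k).
  rewrite /N; case: insubP => [i _ _|_]; last exact: negligible_set0.
  exists (X i @^-1` D); split => //; last first.
    by have := law i D mD; rewrite /distribution /pushforward PD.
  by rewrite -[X in measurable X]setTI; exact: measurable_funP.
have [A [mA A0 NA]] := negligible_bigcup nN.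
exists A; split => // w nAw i; apply: contrapT => wi; apply: nAw; apply: NA.
by exists i => //; rewrite /N valK /D /= /eball/= subr0.
Qed.

Lemma semidual_empirical (n : nat) (x y : 'I_n -> B) (f : V -> \bar R) : F f ->
  (forall i, enorm (x i : V) < 2 * r) ->
  semidual (empirical x) (empirical y) f =
    (n%:R^-1 * (\sum_i fine (f (x i)) + \sum_i fine (conjugate f (y i))))%:E.
Proof.
move=> Ff xr; have [x0 Sx0] := good_set_nonempty st hyp.
have bp := candidate_ball_potential st hyp Ff Sx0; have [pf _ sf _ _] := bp.
rewrite /semidual mulrDr EFinD; congr (_ + _)%E.
  apply: integral_empirical; first exact: (measurable_smooth pf sf).
  by move=> i; rewrite dom_fineK//; apply/(ball_domE _ bp).
apply: integral_empirical; first exact: measurable_conjugate.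
by move=> i; rewrite (fine_conjugateK beta0 a0 r0 (good_set_enorm hyp Sx0) _ bp).
Qed.

Definition stability_constant : R := 4 * (smoothness beta a r + (M + r) / r + 1).

Definition variance_constant : R := 6 * CPI * stability_constant + 2 * gap_bound r M.

Definition risk_constant : R := 2 `^ (q1 + 1) * stability_constant *
  (3 + oracle_constant C1 variance_constant (2 * potential_bound beta a r)).

Lemma stability_constant_gt0 : 0 < stability_constant.
Proof.
have L0 := smoothness_ge0 a r beta0; have r0' := r0; have M0' := M0.
have : 0 <= (M + r) / r by rewrite divr_ge0//; lra.
rewrite /stability_constant; lra.
Qed.

Lemma variance_constant_ge0 : 0 <= variance_constant.
Proof.
have s0 := stability_constant_gt0; have r0' := r0; have M0' := M0; have c0 := CPI0.
have g0 : 0 <= gap_bound r M by rewrite /gap_bound mulr_ge0//; lra.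
have := mulr_ge0 c0 (ltW s0); rewrite /variance_constant; lra.
Qed.

Let oracle := oracle_constant C1 variance_constant (2 * potential_bound beta a r).

Let oracle_ge0 : 0 <= oracle.
Proof.
apply: oracle_constant_ge0 => //; first exact: variance_constant_ge0.
by rewrite mulr_ge0// potential_bound_ge0.
Qed.

Lemma risk_constant_gt0 : 0 < risk_constant.
Proof.
have o1 : 0 < 3 + oracle by rewrite ltr_wpDr ?oracle_ge0.
apply: mulr_gt0 => //; apply: mulr_gt0; [exact: powR_gt0|exact: stability_constant_gt0].
Qed.

(** The stability estimate, integrated. *)
Lemma sqnorm_le_excess (f : V -> \bar R) : F f ->
  (sqnorm_L2 P (fun x => nabla f x - nabla phi0 x)%R <= (stability_constant * excess P phi0 f)%:E)%E.
Proof.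
move=> Ff; have bg := bdmeas_gap beta0 a0 r0 M0 st hyp nabla0M Ff.
have s0 := stability_constant_gt0.
rewrite /excess -meanZ//.
have bcg : bdmeas (fun x => stability_constant * onS P phi0 (gap phi0 f) x).
  by apply: bdmeasM => //; exact: bdmeas_cst.
rewrite meanE//; apply: (@ae_le_integral_nonmeasurable _ _ _ P (~` good_set P phi0)).
- exact: (measurableC (measurable_good_set hyp)).
- exact: (full_setC (measurable_good_set hyp) (good_set_full st hyp)).
- by move=> x; rewrite lee_fin sqr_ge0.
- by apply/measurable_EFinP; case: bcg.
- move=> x; rewrite lee_fin mulr_ge0 ?(ltW s0)// /onS; case: ifPn => // /set_mem Sx.
  exact: (gap_ge0 beta0 a0 r0 M0 st hyp nabla0M Ff Sx).
- move=> x /contrapT Sx; rewrite lee_fin onSE//.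
  exact: (gap_quadratic beta0 a0 r0 st hyp nabla0M Ff Sx).
Qed.

(** The Bernstein condition: the variance of the loss is bounded by the excess risk. *)
Lemma var_diff_le_excess (f psi : V -> \bar R) : F f -> F psi ->
  var P (potential_diff f psi : B -> R) + var Q (conjugate_diff f psi) <=
    variance_constant * (excess P phi0 f + excess P phi0 psi).
Proof.
move=> Ff Fpsi.
have := var_potential_diff beta0 a0 CPI0 r0 M0 st hyp nabla0M Ff Fpsi.
have := var_conjugate_diff beta0 a0 r0 M0 st hyp nabla0M Ff Fpsi.
rewrite /variance_constant /stability_constant.
set vq := var Q _; set vp := var P _; set e := _ + excess _ _ _.
set k := _ + _ + 1 => H1 H2.
have -> : (6 * CPI * (4 * k) + 2 * gap_bound r M) * e =
  3 * (CPI * (8 * k) * e) + 2 * gap_bound r M * e by ring.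
lra.
Qed.

(** At almost every outcome the minimizer satisfies the oracle inequality against [psi], and the
    stability estimate turns its excess risk into the error of the gradient. *)
Lemma risk_le_excess (n : nat) (psi : V -> \bar R) (dO : measure_display)
    (Omega : measurableType dO) (Pr : probability Omega R)
    (X Y : 'I_n -> {mfun Omega >-> B}) (phih : Omega -> V -> \bar R) :
  (2 <= n)%N -> F psi -> two_samples Pr P Q X Y ->
  (forall w, argmin_on F
     (semidual (empirical (fun i => X i w)) (empirical (fun i => Y i w))) (phih w)) ->
  (\int[Pr]_w sqnorm_L2 P (fun x => nabla (phih w) x - nabla phi0 x)%R <=
    (stability_constant * (3 * excess P phi0 psi +
       oracle * logp n%:R `^ (q1 + 1) * rate gamma n))%:E)%E.
Proof.
move=> n2 Fpsi samples argmin.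
have nr0 : 0 < n%:R :> R by rewrite ltr0n (leq_trans _ n2).
have s0 := stability_constant_gt0.
have e0 f (Ff : F f) := excess_ge0 beta0 a0 r0 M0 st hyp nabla0M Ff.
have pb0 : 0 <= 2 * potential_bound beta a r by rewrite mulr_ge0// potential_bound_ge0.
have [G [mG G0 IG HG]] := @erm_oracle_inequality _ _ _ _ _ Pr P Q n X Y _ F
  (fun f => potential_diff f psi : B -> R) (fun f => conjugate_diff f psi) gamma C1 q1
  variance_constant (2 * potential_bound beta a r) gamma0 C10 q10 variance_constant_ge0 pb0
  (excess P phi0) psi n2 samples
  (fun f Ff => bdmeas_potential_diff beta0 a0 r0 st hyp Ff Fpsi)
  (fun f Ff => bdmeas_conjugate_diff beta0 a0 r0 st hyp Ff Fpsi)
  (fun f Ff => excess_diff beta0 a0 r0 M0 st hyp nabla0M Ff Fpsi)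
  (fun f Ff => var_diff_le_excess Ff Fpsi) e0 Fpsi
  (fun f x Ff => potential_diff_bound beta0 a0 r0 st hyp x Ff Fpsi)
  (fun f y Ff => conjugate_diff_bound beta0 a0 r0 st hyp y Ff Fpsi
     (fun x _ => potential_diff_bound beta0 a0 r0 st hyp x Ff Fpsi))
  (fun h h0 => candidate_nets Fpsi h0).
have [lawX _ _] := samples.
have [N [mN N0 NX]] := samples_in_ball lawX.
pose g w := stability_constant * (3 * excess P phi0 psi + G w).
have g0 w : 0 <= g w by rewrite mulr_ge0 ?(ltW s0)// addr_ge0// mulr_ge0// e0.
have mg : measurable_fun setT g by apply: measurable_funM => //; apply: measurable_funD.
apply: (@le_trans _ _ (\int[Pr]_w (g w)%:E)%E).
  apply: (ae_le_integral_nonmeasurable mN N0).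
  - by move=> w; apply: integral_ge0 => x _; rewrite lee_fin sqr_ge0.
  - exact/measurable_EFinP.
  - by move=> w; rewrite lee_fin.
  move=> w Nw; have [Fphi /(_ psi Fpsi)] := argmin w.
  rewrite !semidual_empirical//; [|exact: NX|exact: NX].
  rewrite lee_fin ler_pM2l ?invr_gt0// => erm.
  apply: (le_trans (sqnorm_le_excess Fphi)); rewrite lee_fin ler_pM2l//.
  by apply: HG => //; rewrite /potential_diff /conjugate_diff !sumrB; lra.
under eq_integral do rewrite EFinM.
rewrite ge0_integralZl//;
  do ?[by apply/measurable_EFinP; exact: measurable_funD
      | by move=> w _; rewrite lee_fin addr_ge0// mulr_ge0// e0
      | by rewrite lee_fin ltW].
rewrite [X in (_ <= X)%E]EFinM; apply: lee_wpmul2l; first by rewrite lee_fin ltW.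
under eq_integral do rewrite EFinD.
rewrite ge0_integralD//;
  do ?[by apply/measurable_EFinP | by move=> w _; rewrite lee_fin mulr_ge0// e0
      | by move=> w _; rewrite lee_fin].
rewrite integral_cst//=; have := probability_setT Pr => ->; rewrite mule1 EFinD.
exact: leeD2l.
Qed.

(** The infimum over the competitors [psi], after trading [max 1 (ln n)] for [2 * ln n], which is
    at least 1 since [n >= 2]. *)
Lemma candidate_risk_bound : risk_bound P Q phi0 F gamma risk_constant (q1 + 1).
Proof.
move=> n n2 dO Omega Pr X Y phih samples _ argmin.
have nr2 : 2 <= n%:R :> R by rewrite ler_nat.
have ln2 := @ln2_ge_half R.
have lnn : ln 2 <= ln n%:R :> R by rewrite ler_ln ?posrE//; lra.
have s0 := stability_constant_gt0; have o0 := oracle_ge0.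
have e0 f (Ff : F f) := excess_ge0 beta0 a0 r0 M0 st hyp nabla0M Ff.
have rho0 := rate_gt0 (R := R) gamma n2.
set rho := rate gamma n in rho0 *.
set I := (\int[Pr]_w _)%E; set c := risk_constant * _.
have lnp : 0 < ln n%:R :> R by lra.
have c0 : 0 < c by rewrite mulr_gt0 ?risk_constant_gt0// powR_gt0.
pose q := q1 + 1; have q0 : 0 <= q by rewrite /q; have q10' := q10; lra.
have L1 : 1 <= logp n%:R `^ q :> R.
  by rewrite -[leLHS](powRr0 (logp n%:R)) ler_powR// logp_ge1.
have L2 : logp n%:R `^ q <= 2 `^ q * ln n%:R `^ q :> R.
  rewrite -powRM//; last exact: ltW.
  apply: ge0_ler_powR; rewrite ?nnegrE//.
  - exact: le_trans (logp_ge1 _).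
  - by rewrite mulr_ge0// ltW.
  - by rewrite /logp ge_max; apply/andP; split; lra.
set Lq := logp n%:R `^ q in L1 L2; set z := 2 `^ q * _ in L2.
have cE : c = stability_constant * (3 + oracle) * z.
  by rewrite /c /risk_constant /z -/oracle -/q; ring.
have bound psi : F psi -> (I <= (c * (excess P phi0 psi + rho))%:E)%E.
  move=> Fpsi; apply: (le_trans (risk_le_excess n2 Fpsi samples argmin)).
  have -> : c * (excess P phi0 psi + rho) =
      stability_constant * ((3 + oracle) * z * (excess P phi0 psi + rho)).
    by rewrite cE; ring.
  rewrite lee_fin ler_pM2l// -/q -/Lq -/rho.
  have e := e0 _ Fpsi; have z1 : 1 <= z by exact: le_trans L2.
  have z0 : 0 <= z by lra.
  have H1 : 3 * excess P phi0 psi <= 3 * (z * excess P phi0 psi).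
    by rewrite ler_pM2l// ler_peMl.
  have H2 : oracle * Lq * rho <= oracle * z * rho.
    by apply: ler_wpM2r; [exact: ltW|exact: ler_wpM2l].
  have H3 : 0 <= z * rho by rewrite mulr_ge0// ltW.
  have H4 : 0 <= oracle * (z * excess P phi0 psi) by rewrite mulr_ge0// mulr_ge0.
  lra.
have [w0 _] : [set: Omega] !=set0.
  apply/set0P/negP => /eqP O0; have := probability_setT Pr.
  by rewrite O0 measure0 => /eqP; rewrite eq_sym onee_eq0.
have Fw0 := (argmin w0).1.
have ellE : ell_star P Q phi0 F = ereal_inf [set (excess P phi0 f)%:E | f in F].
  rewrite /ell_star; congr ereal_inf; apply/seteqP; split => _ [f Ff <-]; exists f => //;
  by rewrite (semidual_excess beta0 a0 r0 M0 st hyp nabla0M Ff).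
have ell_fin : ell_star P Q phi0 F \is a fin_num.
  rewrite ge0_fin_numE; rewrite ellE.
    apply: (@le_lt_trans _ _ (excess P phi0 (phih w0))%:E); last exact: ltry.
    by apply: ereal_inf_lbound; exists (phih w0).
  by apply: le_ereal_inf_tmp => _ [f Ff <-]; rewrite lee_fin e0.
apply/lee_addgt0Pr => e ep.
(* [bound] holds for every competitor, hence for one of excess below [ell_star + e / c]. *)
have ec : 0 < e / c by rewrite divr_gt0.
have inf_fin : ereal_inf [set (excess P phi0 f)%:E | f in F] \is a fin_num by rewrite -ellE.
have [_ [f Ff <-]] := lb_ereal_inf_adherent ec inf_fin.
rewrite -ellE => He.
apply: (le_trans (bound f Ff)).
have [l lE] : exists l : R, ell_star P Q phi0 F = l%:E.
  by exists (fine (ell_star P Q phi0 F)); rewrite fineK.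
rewrite lE -EFinD lte_fin in He.
rewrite lE -EFinD lee_fin.
have : c * excess P phi0 f <= c * (l + e / c).
  by rewrite ler_pM2l// ltW.
rewrite [leRHS]mulrDr [c * (e / c)]mulrCA divff ?gt_eqF// mulr1; lra.
Qed.

End risk.

(** The gradient is Lipschitz on the bounded set that carries [P], hence bounded there. *)
Lemma nabla_bounded {R : realType} {d : nat} (P : probability (borel_rV R d) R)
    (phi0 : 'rV[R]_d -> \bar R) (beta a r : R) :
  0 <= beta -> 0 <= a -> 0 < r -> potential phi0 -> convex phi0 -> smooth beta a phi0 ->
  (forall x, msupport P x -> enorm x <= r) ->
  exists2 M, 0 <= M & forall x, msupport P x -> enorm (nabla phi0 x) <= M.
Proof.
move=> beta0 a0 r0 pphi cphi sphi supp.
have c0 : 0 <= beta * (1 + r) `^ a by rewrite mulr_ge0// powR_ge0.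
have M0 : 0 <= enorm (nabla phi0 0) + beta * (1 + r) `^ a * r.
  by rewrite addr_ge0 ?enorm_ge0// mulr_ge0// ltW.
exists (enorm (nabla phi0 0) + beta * (1 + r) `^ a * r) => // x sx.
have [dx|dx] := pselect (dom phi0 x); last by rewrite /nabla memNset// enorm0.
have d0 : dom phi0 0 by rewrite /dom/= pphi.2.
have e0 : enorm (0 : 'rV[R]_d) <= r by rewrite enorm0 ltW.
have := nabla_lipschitz beta0 a0 sphi cphi d0 dx e0 (supp x sx).
rewrite subr0 => H; have := enormD (nabla phi0 x - nabla phi0 0) (nabla phi0 0).
rewrite subrK; have := ler_wpM2l c0 (supp x sx); lra.
Qed.

Theorem theorem1 (R : realType) (beta a CPI gamma C1 q1 r : R)
    (beta0 : 0 <= beta) (a0 : 0 <= a) (CPI0 : 0 <= CPI) (gamma0 : 0 <= gamma)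
    (C10 : 0 <= C1) (q10 : 0 <= q1) (r0 : 0 < r) :
  (forall (d : nat) (P Q : probability (borel_rV R d) R)
      (phi0 : 'rV[R]_d -> \bar R) (F : set ('rV[R]_d -> \bar R)),
    (2 <= d)%N ->
    setting P Q phi0 F ->
    assumptions P phi0 F beta a CPI gamma C1 q1 r ->
    exists C q : R,
      [/\ 0 <= C, 0 <= q & risk_bound P Q phi0 F gamma C q])
  /\
  (forall M : R, exists C q : R, [/\ 0 <= C, 0 <= q &
    forall (d : nat) (P Q : probability (borel_rV R d) R)
      (phi0 : 'rV[R]_d -> \bar R) (F : set ('rV[R]_d -> \bar R)),
    (2 <= d)%N ->
    setting P Q phi0 F ->
    assumptions P phi0 F beta a CPI gamma C1 q1 r ->
    (forall x, msupport P x -> enorm (nabla phi0 x) <= M) ->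
    risk_bound P Q phi0 F gamma C q]).
Proof.
have uniform (M : R) : 0 <= M -> exists C q : R, [/\ 0 <= C, 0 <= q &
    forall (d : nat) (P Q : probability (borel_rV R d) R)
      (phi0 : 'rV[R]_d -> \bar R) (F : set ('rV[R]_d -> \bar R)),
    setting P Q phi0 F ->
    assumptions P phi0 F beta a CPI gamma C1 q1 r ->
    (forall x, msupport P x -> enorm (nabla phi0 x) <= M) ->
    risk_bound P Q phi0 F gamma C q].
  move=> M0; exists (risk_constant beta a CPI C1 q1 r M), (q1 + 1); split.
  - by apply/ltW/risk_constant_gt0.
  - by rewrite addr_ge0.
  - by move=> d P Q phi0 F st hyp nablaM; exact: candidate_risk_bound st hyp nablaM.
split=> [d P Q phi0 F _ st hyp|M].
  have [M M0 nablaM] := nabla_bounded beta0 a0 r0 (potential_phi0 st) (convex_phi0 st)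
    (smooth_phi0 hyp) (support_P hyp).
  have [C [q [C0 q0 H]]] := uniform M M0.
  by exists C, q; split => //; exact: H.
have M0 : 0 <= Num.max 0 M by rewrite le_max lexx.
have [C [q [C0 q0 H]]] := uniform _ M0.
exists C, q; split => // d P Q phi0 F _ st hyp nablaM; apply: H st hyp _ => x sx.
by rewrite le_max nablaM ?orbT.
Qed.
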